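(* Let $\mathcal S=\{\phi_i\}_{i\in I}$ be a finite conformal IFS with limit set $\Lambda$ and canonical projection $\pi:\Sigma_I^+\to\Lambda$, let $\psi:\Sigma_I^+\times\Lambda\to\mathbb R$ be Hölder continuous with (unique) equilibrium measure $\hat\mu_\psi$ with respect to the overlap lift map $\Phi$, and let $\mu_\psi:=(\pi_2)_*\hat\mu_\psi$ where $\pi_2(\omega,x)=x$. Then $$HD(\mu_\psi)\le t(\mathcal S,\psi),$$ where $t(\mathcal S,\psi)$ is the unique zero of the function $t\mapsto P_\sigma\big(t\log|\phi_{\omega_1}'(\pi(\sigma\omega))|-\log o(\mathcal S,\hat\mu_\psi)\big)$, $P_\sigma$ denoting topological pressure with respect to the shift $\sigma:\Sigma_I^+\to\Sigma_I^+$.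
   Context: Finite conformal IFS: $I$ finite, $\phi_i$ injective conformal contractions on the closure of an open $V\subset\mathbb R^q$ (with $|\phi_i'|<\kappa<1$); $\Sigma_I^+=I^{\mathbb N}$, shift $\sigma$; limit set $\Lambda=\bigcup_\omega\bigcap_n\phi_{\omega_1}\circ\cdots\circ\phi_{\omega_n}(V)$; $\pi(\omega)$ the point $\bigcap_n\phi_{\omega_1}\circ\cdots\circ\phi_{\omega_n}(V)$. Overlap lift map $\Phi(\omega,x)=(\sigma\omega,\phi_{\omega_1}(x))$ on $\Sigma_I^+\times\Lambda$; equilibrium measure = $\Phi$-invariant probability maximizing $h_\mu(\Phi)+\int\psi\,d\mu$. $S_n\psi=\sum_{k=0}^{n-1}\psi\circ\Phi^k$. $b_n((\omega,x),\tau,\hat\mu_\psi)$ is the number of $(\eta_1,\dots,\eta_n)\in I^n$ for which some $y\in\Lambda$ satisfies $\phi_{\eta_n}\circ\cdots\circ\phi_{\eta_1}(y)=\phi_{\omega_n}\circ\cdots\circ\phi_{\omega_1}(x)$ and $|S_n\psi(\eta,y)/n-\int\psi\,d\hat\mu_\psi|<\tau$, with $\eta=(\eta_1,\dots,\eta_n,\omega_{n+1},\dots)$. Overlap number: $o(\mathcal S,\hat\mu_\psi)=\exp\big(\lim_{\tau\to0}\lim_{n\to\infty}\frac1n\int\log b_n((\omega,x),\tau,\hat\mu_\psi)\,d\hat\mu_\psi\big)$. $HD(\mu)=\inf\{HD(Z): \mu(\Lambda\setminus Z)=0\}$. *)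

(* Defs.v *)
From HB Require Import structures.
From mathcomp Require Import all_boot all_order all_algebra.
From mathcomp Require Import all_classical all_reals all_analysis.
Import Order.TTheory GRing.Theory Num.Theory.
Import numFieldNormedType.Exports.

Set Implicit Arguments.
Unset Strict Implicit.
Unset Printing Implicit Defensive.

Local Open Scope classical_set_scope.
Local Open Scope ring_scope.

(* Euclidean norm (the default norm on matrices in MathComp is the sup norm;
   conformality refers to the Euclidean structure). *)
Definition enorm (R : realType) (q : nat) (v : 'rV[R]_q) : R :=
  Num.sqrt (\sum_(j < q) (v ord0 j) ^+ 2).

(* Euclidean diameter, in \bar R (so that unbounded sets get +oo). *)
Definition ediam (R : realType) (q : nat) (A : set 'rV[R]_q) : \bar R :=
  ereal_sup [set (enorm (x - y))%:E | x in A & y in A].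

Definition hterm (R : realType) (q : nat) (s : R) (U : set 'rV[R]_q) : R :=
  if `[< U = set0 >] then 0 else powR (fine (ediam U)) s.

Definition hcontent (R : realType) (q : nat) (s delta : R) (Z : set 'rV[R]_q)
  : \bar R :=
  ereal_inf [set (\sum_(0 <= i <oo) (hterm s (U i))%:E)%E
            | U in [set U : nat -> set 'rV[R]_q |
                     Z `<=` \bigcup_i U i /\ forall i, (ediam (U i) <= delta%:E)%E]].

Definition hmeasure (R : realType) (q : nat) (s : R) (Z : set 'rV[R]_q) : \bar R :=
  ereal_sup [set hcontent s delta Z | delta in [set delta : R | 0 < delta]].

Definition hdim (R : realType) (q : nat) (Z : set 'rV[R]_q) : \bar R :=
  ereal_inf [set s%:E | s in [set s : R | 0 <= s /\ hmeasure s Z = 0%E]].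

Definition deriv_norm (R : realType) (q : nat) (f : 'rV[R]_q -> 'rV[R]_q)
  (x : 'rV[R]_q) : R :=
  sup [set enorm ('d f x v) | v in [set v : 'rV[R]_q | enorm v <= 1]].

Definition conformal_at (R : realType) (q : nat) (f : 'rV[R]_q -> 'rV[R]_q)
  (x : 'rV[R]_q) : Prop :=
  differentiable f x /\
  exists c : R, 0 < c /\ forall v, enorm ('d f x v) = c * enorm v.

Definition conformal_IFS (R : realType) (q : nat) (I : finType)
  (V : set 'rV[R]_q) (phi : I -> 'rV[R]_q -> 'rV[R]_q) : Prop :=
  [/\ open V /\ V !=set0 /\ (exists M : R, forall x, V x -> enorm x <= M),
      (forall i x, closure V x -> closure V (phi i x)) /\
      (forall i x y, closure V x -> closure V y -> phi i x = phi i y -> x = y),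
      (exists W : set 'rV[R]_q, [/\ open W, closure V `<=` W &
          forall i, (forall x, W x -> conformal_at (phi i) x) /\
                    (forall v x, W x -> {for x, continuous (fun y => 'd (phi i) y v)})]),
      (exists s : R, s < 1 /\ forall i x y, closure V x -> closure V y ->
          enorm (phi i x - phi i y) <= s * enorm (x - y)) &
      (exists kappa : R, kappa < 1 /\
          forall i x, closure V x -> deriv_norm (phi i) x < kappa)].

(* sshift on Sigma_I^+ = I^N (coordinates indexed from 0: w 0 = omega_1) *)
Definition sshift (I : Type) (w : nat -> I) : nat -> I := fun n => w n.+1.

Fixpoint comp_word (R : realType) (q : nat) (I : Type)
  (phi : I -> 'rV[R]_q -> 'rV[R]_q) (w : nat -> I) (n : nat) : 'rV[R]_q -> 'rV[R]_q :=
  match n with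
  | 0 => id
  | m.+1 => comp_word phi w m \o phi (w m)
  end.

Fixpoint fwd_word (R : realType) (q : nat) (I : Type)
  (phi : I -> 'rV[R]_q -> 'rV[R]_q) (w : nat -> I) (n : nat) (x : 'rV[R]_q)
  : 'rV[R]_q :=
  match n with
  | 0 => x
  | m.+1 => phi (w m) (fwd_word phi w m x)
  end.

Definition cyl_image (R : realType) (q : nat) (I : Type) (V : set 'rV[R]_q)
  (phi : I -> 'rV[R]_q -> 'rV[R]_q) (w : nat -> I) (n : nat) : set 'rV[R]_q :=
  comp_word phi w n @` closure V.

Definition limit_set (R : realType) (q : nat) (I : Type) (V : set 'rV[R]_q)
  (phi : I -> 'rV[R]_q -> 'rV[R]_q) : set 'rV[R]_q :=
  [set x | exists w : nat -> I, forall n, cyl_image V phi w n x].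

Definition ifs_proj (R : realType) (q : nat) (I : Type) (V : set 'rV[R]_q)
  (phi : I -> 'rV[R]_q -> 'rV[R]_q) (w : nat -> I) : 'rV[R]_q :=
  xget 0 [set x | forall n, cyl_image V phi w n x].

(* The space Sigma_I^+ x R^q with the Borel sigma-algebra (generated by      *)
(* cylinder x open rectangles).  i0 only witnesses that I is nonempty.       *)
Definition XT (R : realType) (q : nat) (I : finType) (i0 : I) :=
  ((nat -> I) * 'rV[R]_q)%type.
HB.instance Definition _ (R : realType) (q : nat) (I : finType) (i0 : I) :=
  Choice.on (XT R q i0).
HB.instance Definition _ (R : realType) (q : nat) (I : finType) (i0 : I) :=
  isPointed.Build (XT R q i0) (fun _ => i0, 0).

Definition gens (R : realType) (q : nat) (I : finType) (i0 : I)
  : set (set (XT R q i0)) :=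
  [set A | exists n (w : {ffun 'I_n -> I}) (U : set 'rV[R]_q), open U /\
     A = [set z : XT R q i0 | (forall k : 'I_n, z.1 k = w k) /\ U z.2]].

Definition XM (R : realType) (q : nat) (I : finType) (i0 : I)
  : measurableType (@gens R q I i0).-sigma :=
  @g_sigma_algebraType (XT R q i0 : pointedType) (@gens R q I i0).

Section Lift.
Variables (R : realType) (q : nat) (I : finType) (i0 : I).
Variables (V : set 'rV[R]_q) (phi : I -> 'rV[R]_q -> 'rV[R]_q).
Variable psi : XT R q i0 -> R.

Local Notation X := (XT R q i0).
Local Notation Lambda := (limit_set V phi).

Definition Phi_lift (z : X) : X := (sshift z.1, phi (z.1 0%N) z.2).

Definition SxL : set X := [set z | Lambda z.2].

Definition birkhoff (n : nat) (z : X) : R := \sum_(k < n) psi (iter k Phi_lift z).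

(* Hoelder continuity of psi on Sigma_I^+ x Lambda, for the metric
   max(d(w,w'), |x - y|) with d(w,w') = 2^{-(length of common prefix)}:
   d(w,w') <= 2^{-n} iff w and w' agree on their first n coordinates. *)
Definition holder_cont : Prop :=
  exists C a : R, 0 < a /\
    forall (w w' : nat -> I) (x y : 'rV[R]_q) (n : nat),
      Lambda x -> Lambda y -> (forall k, (k < n)%N -> w k = w' k) ->
      `|psi (w, x) - psi (w', y)| <=
        C * powR (Num.max ((2^-1) ^+ n) (enorm (x - y))) a.

Definition invariant_prob (mu : probability (XM R q i0) R) : Prop :=
  mu SxL = 1%E /\
  forall A : set X, measurable (A : set (XM R q i0)) ->
    mu (Phi_lift @^-1` A `&` SxL) = mu (A `&` SxL).

Definition integ (mu : probability (XM R q i0) R) (f : X -> R) : \bar R :=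
  (\int[mu]_(z in (SxL : set (XM R q i0))) (f z)%:E)%E.

Definition is_partition (m : nat) (P : 'I_m -> set X) : Prop :=
  [/\ forall j, measurable (P j : set (XM R q i0)),
      (forall j j', j != j' -> P j `&` P j' = set0) &
      (forall z, exists j, P j z)].

Definition join_cell (m n : nat) (P : 'I_m -> set X) (s : {ffun 'I_n -> 'I_m})
  : set X := [set z | SxL z /\ forall k : 'I_n, P (s k) (iter k Phi_lift z)].

Definition part_entropy_n (mu : probability (XM R q i0) R) (m : nat)
  (P : 'I_m -> set X) (n : nat) : R :=
  \sum_(s : {ffun 'I_n -> 'I_m})
     - (fine (mu (join_cell P s)) * ln (fine (mu (join_cell P s)))).

Definition part_entropy (mu : probability (XM R q i0) R) (m : nat)
  (P : 'I_m -> set X) : R :=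
  limn (fun n => part_entropy_n mu P n / n%:R).

Definition entropy (mu : probability (XM R q i0) R) : \bar R :=
  ereal_sup [set x | exists m (P : 'I_m -> set X),
                       is_partition P /\ x = (part_entropy mu P)%:E].

Definition equilibrium (mu : probability (XM R q i0) R) : Prop :=
  invariant_prob mu /\
  forall nu : probability (XM R q i0) R, invariant_prob nu ->
    (entropy nu + integ nu psi <= entropy mu + integ mu psi)%E.

Definition ext_word (n : nat) (eta : {ffun 'I_n -> I}) (w : nat -> I) : nat -> I :=
  fun k => odflt (w k) (omap eta (insub k)).

Definition bcount (mu : probability (XM R q i0) R) (tau : R) (n : nat) (z : X)
  : nat :=
  #|[set eta : {ffun 'I_n -> I} |
     `[< exists y, Lambda y /\
          fwd_word phi (ext_word eta z.1) n y = fwd_word phi z.1 n z.2 /\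
          `|birkhoff n (ext_word eta z.1, y) / n%:R - fine (integ mu psi)| < tau >]]|.

Definition overlap_seq (mu : probability (XM R q i0) R) (tau : R) (n : nat) : R :=
  fine (integ mu (fun z => ln (bcount mu tau n z)%:R)) / n%:R.

Definition log_overlap (mu : probability (XM R q i0) R) : R :=
  lim (limn (overlap_seq mu tau) @[tau --> 0^'+]).

Definition overlap_number (mu : probability (XM R q i0) R) : R :=
  expR (log_overlap mu).

(* HD(mu_psi) for mu_psi = (pi_2)_* mu:  inf of HD(Z) over Z with
   mu_psi(Lambda \ Z) = 0 (Lambda \ Z contained in a mu_psi-null Borel set) *)
Definition HD_proj_measure (mu : probability (XM R q i0) R) : \bar R :=
  ereal_inf [set hdim Z | Z in [set Z : set 'rV[R]_q |
     exists B : set 'rV[R]_q, <<s [set U : set 'rV[R]_q | open U] >> B /\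
       Lambda `\` Z `<=` B /\ mu [set z : X | B z.2] = 0%E]].

End Lift.

Definition cyl_sup (R : realType) (I : finType) (f : (nat -> I) -> R) (n : nat)
  (w : {ffun 'I_n -> I}) : R :=
  sup [set \sum_(k < n) f (iter k (@sshift I) t)
      | t in [set t : nat -> I | forall k : 'I_n, t k = w k]].

Definition pressure (R : realType) (I : finType) (f : (nat -> I) -> R) : R :=
  limn (fun n => ln (\sum_(w : {ffun 'I_n -> I}) expR (cyl_sup f w)) / n%:R).

(* Main.v *)
Require Import Defs.
From HB Require Import structures.
From mathcomp Require Import all_boot all_order all_algebra.
From mathcomp Require Import all_classical all_reals all_analysis.
From mathcomp Require Import ring lra zify.
Import Order.TTheory GRing.Theory Num.Theory.
Import numFieldNormedType.Exports.
Local Open Scope classical_set_scope.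
Local Open Scope ring_scope.
Set Implicit Arguments.
Unset Strict Implicit.
Unset Printing Implicit Defensive.

(* Let N_n(x) be the number of words w of length n whose cylinder image
   phi_w (closure V) contains x.  Reversing the letters of the histories counted
   by b_n gives b_n(z) <= N_n(pi_2 (Phi^n z)), so if l = log o(S, mu) and c < l,
   then mu gives mass bounded below to {N_n >= e^{nc}} and hence positive mass to
   the set of points with log N_n(x) >= n (c - o(1)) infinitely often.  This set is
   mapped into itself by every phi_i, and the equilibrium measure satisfies a
   zero-one law for such sets, so it has full measure.

   Zero-one law: an i.i.d. block process with the Gibbs weights e^{S_n psi} / Z_n
   competes with mu, whence the n-letter marginals of mu have bounded relative
   entropy with respect to the Gibbs weights.  An invariant set of measure in
   (0, 1) would be approximated by a cylinder event that mu sees in every one of K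
   consecutive blocks with probability bounded below, although the Gibbs weight of
   such a repetition decays exponentially in K.

   Dimension: when P(s) < 0, the s-th powers of the sizes of the cylinder images
   sum to e^{nl} times an exponentially small factor.  A Vitali-type selection
   exploits the multiplicity e^{nc} of the covering of {N_n >= e^{nc}} and divides
   this cost by e^{nc}; as c can be taken close to l, the limsup set has zero
   s-dimensional measure. *)

(** * Subadditive sequences *)

(** The measures live on Sigma x Lambda, where the second coordinate remembers a whole past, while
    the estimates count finite words. Contraction bridges the two: after N steps the second
    coordinate is known, up to an error exponentially small in N, from the letters read meanwhile.
    So every event becomes, after a shift in time, nearly an event on future letters; the
    first-letter partition carries the full entropy; and competitors of mu can be assembled from
    independent letters, a point of Lambda being the projection of a past. Fullness of the limsup
    set then comes from the variational inequality and the Hoelder regularity of psi, in place of an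
    ergodic theorem. Two obstacles shape the statements. The maps phi_i are controlled only near
    closure V and psi only on Sigma x Lambda, so measurability and invariance are phrased for traces
    on that set. The derivatives are merely continuous, so distortion is controlled up to a factor
    e^(n e) with e arbitrarily small; this loss, like the gap between c and l, is paid out of the
    strict inequality P(s) < 0 for s > t. *)

Section Fekete.
Variables (R : realType) (a : nat -> R).
Hypothesis subadd : forall m n, a (m + n)%N <= a m + a n.

(** Euclidean division of n by k: the full blocks cost [a k] each, and C absorbs the finitely many
    remainders together with the discrepancy (r / k) [a k]. *)
Lemma subadditive_affine_bound k : (0 < k)%N ->
  exists C, forall n, a n <= n%:R * (a k / k%:R) + C.
Proof.
move=> k0.
have kR : 0 < k%:R :> R by rewrite ltr0n.
exists (\sum_(r < k) `|a r| + `|a k|) => n.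
have mulk m r : a (m * k + r)%N <= m%:R * a k + a r.
  elim: m => [|m IH]; first by rewrite mul0n add0n mul0r add0r.
  rewrite mulSn -addnA (le_trans (subadd _ _)) // -natr1 mulrDl mul1r.
  by rewrite addrAC addrC lerD2l.
rewrite {1}(divn_eq n k) (le_trans (mulk _ _)) //.
have rk : (n %% k < k)%N by rewrite ltn_mod.
have Er : a (n %% k)%N <= \sum_(r < k) `|a r|.
  rewrite (bigD1 (Ordinal rk)) //= (le_trans (ler_norm _)) // lerDl.
  by apply: sumr_ge0 => i _; exact: normr_ge0.
have -> : n%:R * (a k / k%:R) = (n %/ k)%:R * a k + (n %% k)%:R / k%:R * a k.
  rewrite {1}(divn_eq n k) natrD natrM; field; exact: lt0r_neq0.
have : `|(n %% k)%:R / k%:R * a k| <= `|a k|.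
  rewrite normrM ler_piMl // ger0_norm ?divr_ge0 //.
  by rewrite ler_pdivrMr // mul1r ler_nat ltnW.
rewrite ler_norml => /andP[+ _]; lra.
Qed.

(** Fekete's lemma. The limit is the infimum of a k / k over k > 0, which the linear lower bound
    keeps finite. *)
Lemma subadditive_cvg (L : R) : (forall n, n%:R * L <= a n) ->
  cvgn (fun n => a n / n%:R) /\
  forall k, (0 < k)%N -> limn (fun n => a n / n%:R) <= a k / k%:R.
Proof.
move=> lb; pose E := [set a k / k%:R | k in [set k | (0 < k)%N]].
have infE : has_inf E.
  split; first by exists (a 1%N / 1); exists 1%N.
  exists L => _ [k k0 <-]; rewrite ler_pdivlMr ?ltr0n //.
  by rewrite mulrC lb.
have C0 : (fun n => a n / n%:R) @ \oo --> inf E.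
  apply/cvgrPdist_le => e e0.
  have e2 : 0 < e / 2 by rewrite divr_gt0.
  have [_ [k k0 <-] ke] := inf_adherent e2 infE.
  have [C HC] := subadditive_affine_bound k0.
  exists (Num.truncn (2 * `|C| / e)).+1 => // n /= nN.
  have n0 : (0 < n)%N by apply: leq_trans nN.
  have nR : 0 < n%:R :> R by rewrite ltr0n.
  have h1 : inf E <= a n / n%:R by apply: ge_inf; [case: infE | exists n].
  rewrite distrC ger0_norm ?subr_ge0 // lerBlDr.
  rewrite ler_pdivrMr // (le_trans (HC n)) //.
  have : 2 * `|C| / e < n%:R.
    by rewrite -truncn_lt_nat // divr_ge0 ?mulr_ge0 // ltW.
  rewrite ltr_pdivrMr // => hC.
  have : a k / k%:R * n%:R <= (inf E + e / 2) * n%:R by rewrite ler_pM2r // ltW.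
  have := ler_norm C.
  nra.
split; first by apply/cvg_ex; exists (inf E).
move=> k k0; rewrite (cvg_lim _ C0) //.
by apply: ge_inf; [case: infE | exists k].
Qed.
End Fekete.

(** * Relative entropy and multiplicity covering *)

Lemma ln_prodr (R : realType) (T : finType) (F : T -> R) : (forall t, 0 < F t) ->
  ln (\prod_t F t) = \sum_t ln (F t).
Proof.
move=> F0.
suff [] : 0 < \prod_t F t /\ ln (\prod_t F t) = \sum_t ln (F t) by [].
apply: (big_ind2 (fun x y => 0 < x /\ ln x = y)) => [|x _ y _ [x0 <-] [y0 <-]|//].
  by rewrite ltr01 ln1.
by rewrite mulr_gt0 // lnM.
Qed.

(** This is ln (1 + x) <= x at x = g / p - 1. The implication between the supports excludes the
    convention ln 0 = 0, under which the inequality may fail. *)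
Lemma ln_ratio_le (R : realType) (p g : R) : 0 <= p -> 0 <= g ->
  (p != 0 -> g != 0) -> p * ln g - p * ln p <= g - p.
Proof.
move=> p0 g0 pg; have [->|pn0] := eqVneq p 0; first by rewrite !mul0r !subr0.
have pp : 0 < p by rewrite lt_neqAle eq_sym pn0.
have gp : 0 < g by rewrite lt_neqAle eq_sym pg.
have -> : p * ln g - p * ln p = p * ln (1 + (g / p - 1)).
  by rewrite addrCA subrr addr0 ln_div ?posrE // mulrBr.
have -> : g - p = p * (g / p - 1) by field.
rewrite ler_pM2l //; apply: le_ln1Dx.
by rewrite ltrBrDr addNr divr_gt0.
Qed.

Section Gibbs.
Variables (R : realType) (T : finType).
Implicit Types p g m : T -> R.

Definition shannon p : R := \sum_t - (p t * ln (p t)).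

Lemma gibbs p g : (forall t, 0 <= p t) -> (forall t, 0 <= g t) ->
  \sum_t g t <= \sum_t p t -> (forall t, p t != 0 -> g t != 0) ->
  shannon p <= \sum_t - (p t * ln (g t)).
Proof.
move=> p0 g0 gp pg; rewrite -subr_ge0 -sumrB.
rewrite (@le_trans _ _ (\sum_t (p t - g t))) //; first by rewrite sumrB subr_ge0.
apply: ler_sum => t _; have := ln_ratio_le (p0 t) (g0 t) (pg t); lra.
Qed.

(** Gibbs' inequality against [g], which is m rescaled to mass 1/2 on D and m halved off D, yields
    p(D) (- ln m(D)) <= C + ln 2. A bounded relative entropy thus keeps m(D) away from 0 in terms of
    p(D) alone. *)
Lemma kl_mass_bound p m (D : pred T) (C : R) :
  (forall t, 0 <= p t) -> \sum_t p t = 1 ->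
  (forall t, 0 < m t) -> \sum_t m t = 1 ->
  \sum_t p t * (ln (p t) - ln (m t)) <= C -> 0 < \sum_(t | D t) p t ->
  expR (- ((C + ln 2) / \sum_(t | D t) p t)) <= \sum_(t | D t) m t.
Proof.
move=> p0 p1 m0 m1 klC pD; set mD := \sum_(t | D t) m t.
have mD0 : 0 < mD.
  have [t Dt _] : exists2 t, D t & p t != 0.
    apply: contrapT => h; move: pD; rewrite big1 ?ltxx // => t Dt.
    by apply: contrapT => /eqP pt; apply: h; exists t.
  by rewrite /mD (bigD1 t) //= ltr_pwDl // sumr_ge0 // => i _; exact: ltW.
pose g t := if D t then m t / (2 * mD) else m t / 2.
have gpos t : 0 < g t by rewrite /g; case: ifP => _; rewrite divr_gt0 // mulr_gt0.
have sg : \sum_t g t <= \sum_t p t.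
  rewrite p1 (bigID D) /=.
  rewrite (eq_bigr (fun t => m t / (2 * mD))); last by move=> t Dt; rewrite /g Dt.
  rewrite -mulr_suml -/mD [X in _ + X](eq_bigr (fun t => m t / 2)); last first.
    by move=> t /negbTE Dt; rewrite /g Dt.
  rewrite -mulr_suml.
  have : mD + \sum_(t | ~~ D t) m t = 1 by rewrite -m1 [RHS](bigID D).
  have -> : mD / (2 * mD) = 2^-1 by field; exact: lt0r_neq0.
  lra.
have := gibbs p0 (fun t => ltW (gpos t)) sg (fun t _ => lt0r_neq0 (gpos t)).
rewrite /shannon -subr_ge0 -sumrB.
have -> : \sum_t (- (p t * ln (g t)) - - (p t * ln (p t))) =
  \sum_t p t * (ln (p t) - ln (m t)) + \sum_t p t * ln 2 +
  \sum_(t | D t) p t * ln mD.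
  rewrite [X in _ = _ + X]big_mkcond -!big_split /=; apply: eq_bigr => t _.
  rewrite /g; case: ifP => _.
    by rewrite ln_div ?posrE ?mulr_gt0 // lnM ?posrE //; ring.
  by rewrite ln_div ?posrE //; ring.
rewrite -!mulr_suml p1 mul1r => h.
rewrite -ler_ln ?posrE ?expR_gt0 // expRK -mulNr ler_pdivrMr // mulrC.
lra.
Qed.
End Gibbs.

Section WeightedVitali.
Variables (R : realType) (X : Type) (T : finType) (B : T -> set X) (r : T -> R).

(** An index of maximal r is selected, everything that meets its set is discarded, and the remaining
    family is smaller. An empty set meets nothing, hence the nonemptiness in the last clause. *)
Lemma greedy_disjoint (F : {set T}) : exists G : {set T}, [/\ G \subset F,
  (forall v v', v \in G -> v' \in G -> v != v' -> B v `&` B v' = set0) &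
  (forall w, w \in F -> B w !=set0 ->
     exists v, [/\ v \in G, B w `&` B v !=set0 & r w <= r v])].
Proof.
have [n] := ubnP #|F|; elim: n F => // n IH F Fn.
have [->|[w0 w0F]] := set_0Vmem F.
  by exists finset.set0; split => [|v v'|w]; rewrite ?sub0set ?inE.
have [v vF vmax] : exists2 v, v \in F & forall w, w \in F -> r w <= r v.
  by have [v vF vm] := @Order.TotalTheory.arg_maxP _ _ _ w0 (mem F) r w0F; exists v.
(* The conjunct [w != v] matters when [B v] is empty: it is then disjoint from itself, and v would
   never leave the family. *)
pose F' := [set w in F | (w != v) && `[< B w `&` B v = set0 >]]%SET.
have F'F : F' \subset F by apply/fintype.subsetP => w; rewrite inE => /andP[].
have F'n : (#|F'| < n)%N.
  apply: leq_trans (_ : #|F| <= n)%N; last by rewrite -ltnS.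
  apply/proper_card/properP; split => //; exists v => //.
  by rewrite inE eqxx /= andbF.
have [G [GF dG cG]] := IH _ F'n.
have GF' w : w \in G -> w != v /\ B w `&` B v = set0.
  by move/(fintype.subsetP GF); rewrite inE => /and3P[_ ? /asboolP].
exists (v |: G)%SET; split.
- rewrite finset.subUset finset.sub1set vF; exact: fintype.subset_trans F'F.
- move=> a b; rewrite !inE => /orP[/eqP->|aG] /orP[/eqP->|bG]; first by rewrite eqxx.
  + by move=> _; rewrite setIC; case: (GF' _ bG).
  + by move=> _; case: (GF' _ aG).
  + exact: dG.
- move=> w wF wne; have [wF'|wF'] := boolP (w \in F').
    by have [u [uG h1 h2]] := cG _ wF' wne; exists u; split; rewrite // !inE uG orbT.
  exists v; split; [by rewrite !inE eqxx| |exact: vmax].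
  move: wF'; rewrite inE wF /= negb_and negbK => /orP[/eqP wv|/asboolPn].
    by rewrite -wv setIid.
  by move/eqP/set0P.
Qed.

(* Each greedy pass removes a disjoint subfamily, hence lowers the covering
   multiplicity of every point by at most one; N passes are available, and the
   cheapest of the N extracted families costs at most the average. *)
Lemma multiplicity_vitali (a : T -> R) (E : set X) (N : nat) (F : {set T}) :
  (forall w, 0 <= a w) -> (0 < N)%N ->
  (forall x, E x -> (N <= #|[set w in F | `[< B w x >]]%SET|)%N) ->
  exists G : {set T}, [/\ G \subset F,
    N%:R * \sum_(w in G) a w <= \sum_(w in F) a w &
    forall x, E x -> exists w v,
      [/\ v \in G, B w x, B w `&` B v !=set0 & r w <= r v]].
Proof.
move=> a0; case: N => // N _; elim: N F => [|N IH] F FE.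
  have [G [GF _ cG]] := greedy_disjoint F.
  exists G; split => //.
    rewrite mul1r [leRHS](big_setID G) /= (finset.setIidPr GF) lerDl.
    by apply: sumr_ge0 => i _.
  move=> x /FE; rewrite card_gt0 => /set0Pn[w]; rewrite inE => /andP[wF /asboolP Bx].
  have [|v [vG h1 h2]] := cG w wF; first by exists x.
  by exists w, v.
have [G [GF dG cG]] := greedy_disjoint F.
have coverG x : E x -> exists w v,
    [/\ v \in G, B w x, B w `&` B v !=set0 & r w <= r v].
  move=> /FE Ex; have : (0 < #|[set w in F | `[< B w x >]]%SET|)%N.
    exact: leq_trans Ex.
  rewrite card_gt0 => /set0Pn[w]; rewrite inE => /andP[wF /asboolP Bx].
  have [|v [vG h1 h2]] := cG w wF; first by exists x.
  by exists w, v.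
have [|G1 [G1F cost1 cov1]] := IH (F :\: G)%SET.
  move=> x Ex; have := FE x Ex.
  set S := [set w in F | `[< B w x >]]%SET => SN.
  have S1 : (#|S :&: G| <= 1)%N.
    apply/card_le1_eqP => u v; rewrite !inE.
    move=> /andP[/andP[_ /asboolP Bu] uG] /andP[/andP[_ /asboolP Bv] vG].
    apply: contrapT => /eqP; rewrite eq_sym => uv.
    by have := dG _ _ uG vG uv; rewrite -subset0 => /(_ x); apply.
  have -> : [set w in F :\: G | `[< B w x >]]%SET = (S :\: G)%SET.
    by apply/setP => w; rewrite !inE andbA.
  by rewrite cardsD; lia.
have costF : \sum_(w in F) a w = \sum_(w in G) a w + \sum_(w in F :\: G) a w.
  by rewrite (big_setID G) /= (finset.setIidPr GF).
have [le1|lt1] := leP (\sum_(w in G) a w) (\sum_(w in G1) a w).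
  exists G; split => //; rewrite costF -natr1.
  have := ler_wpM2l (ler0n R N.+1) le1; lra.
exists G1; split => //; first exact: fintype.subset_trans G1F (finset.subsetDl _ _).
rewrite costF -natr1; lra.
Qed.
End WeightedVitali.

(** * Words *)

Section Words.
Variable I : finType.
Implicit Types (t : nat -> I) (a b k n : nat).

Definition prefix_word n t : {ffun 'I_n -> I} := [ffun k => t (val k)].

Definition iter_shift n t : nat -> I := fun k => t (n + k)%N.

Definition left_word a b (w : {ffun 'I_(a + b) -> I}) : {ffun 'I_a -> I} :=
  [ffun i => w (lshift b i)].
Definition right_word a b (w : {ffun 'I_(a + b) -> I}) : {ffun 'I_b -> I} :=
  [ffun i => w (rshift a i)].

Lemma ext_word_ord n (w : {ffun 'I_n -> I}) t (i : 'I_n) : ext_word w t i = w i.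
Proof. by rewrite /ext_word valK. Qed.

Lemma prefix_word_ext n (w : {ffun 'I_n -> I}) t : prefix_word n (ext_word w t) = w.
Proof. by apply/ffunP => i; rewrite ffunE ext_word_ord. Qed.

Lemma prefix_wordP n t (w : {ffun 'I_n -> I}) :
  (forall k : 'I_n, t k = w k) <-> prefix_word n t = w.
Proof.
split=> [h|<- k]; last by rewrite ffunE.
by apply/ffunP => k; rewrite ffunE h.
Qed.

Lemma prefix_word_eq n t (u : nat -> I) : prefix_word n t = prefix_word n u <->
  forall k, (k < n)%N -> t k = u k.
Proof.
split=> [/ffunP h k kn|h]; first by have := h (Ordinal kn); rewrite !ffunE.
by apply/ffunP => k; rewrite !ffunE; apply: h; exact: ltn_ord.
Qed.

Lemma left_prefix_word a b t : left_word (prefix_word (a + b) t) = prefix_word a t.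
Proof. by apply/ffunP => i; rewrite !ffunE. Qed.

Lemma right_prefix_word a b t :
  right_word (prefix_word (a + b) t) = prefix_word b (iter_shift a t).
Proof. by apply/ffunP => i; rewrite !ffunE. Qed.

Lemma iter_sshift n t : iter n (@sshift I) t = iter_shift n t.
Proof.
elim: n t => [|n IH] t; first by [].
by rewrite iterS IH; apply/funext => k; rewrite /sshift /iter_shift addnS addSn.
Qed.

Definition cat_word a b (u : {ffun 'I_a -> I}) (v : {ffun 'I_b -> I}) :
    {ffun 'I_(a + b) -> I} :=
  [ffun i => match fintype.split i with inl j => u j | inr j => v j end].

Lemma left_cat_word a b (u : {ffun 'I_a -> I}) (v : {ffun 'I_b -> I}) :
  left_word (cat_word u v) = u.
Proof.
apply/ffunP => i; rewrite !ffunE /=.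
by rewrite -[lshift b i]/(unsplit (inl i)) unsplitK.
Qed.

Lemma right_cat_word a b (u : {ffun 'I_a -> I}) (v : {ffun 'I_b -> I}) :
  right_word (cat_word u v) = v.
Proof.
apply/ffunP => i; rewrite !ffunE /=.
by rewrite -[rshift a i]/(unsplit (inr i)) unsplitK.
Qed.

Lemma cat_left_right a b (w : {ffun 'I_(a + b) -> I}) :
  cat_word (left_word w) (right_word w) = w.
Proof.
apply/ffunP => i; rewrite !ffunE /=; case: splitP => j ij; rewrite ffunE;
  by congr (w _); apply/val_inj.
Qed.

Lemma prefix_word_cat a b t :
  prefix_word (a + b) t = cat_word (prefix_word a t) (prefix_word b (iter_shift a t)).
Proof. by rewrite -(left_prefix_word a b) -right_prefix_word cat_left_right. Qed.

Lemma sum_word_split (R : realType) a b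
  (F : {ffun 'I_a -> I} -> {ffun 'I_b -> I} -> R) :
  \sum_(w : {ffun 'I_(a + b) -> I}) F (left_word w) (right_word w) =
  \sum_u \sum_v F u v.
Proof.
rewrite pair_big /= (reindex (fun p => cat_word p.1 p.2)) /=.
  by apply: eq_bigr => -[u v] _ /=; rewrite left_cat_word right_cat_word.
exists (fun w => (left_word w, right_word w)) => [[u v] _|w _] /=.
  by rewrite left_cat_word right_cat_word.
exact: cat_left_right.
Qed.
End Words.

(** * Euclidean norm *)

Section EuclideanNorm.
Variables (R : realType) (q : nat).
Implicit Types u v x y : 'rV[R]_q.

Let sumsq_ge0 v : 0 <= \sum_(j < q) v ord0 j ^+ 2.
Proof. by apply: sumr_ge0 => j _; exact: sqr_ge0. Qed.

Lemma enorm_ge0 v : 0 <= enorm v. Proof. exact: sqrtr_ge0. Qed.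

Lemma enorm_sqr v : enorm v ^+ 2 = \sum_(j < q) v ord0 j ^+ 2.
Proof. by rewrite sqr_sqrtr. Qed.

Lemma enorm0 : enorm (0 : 'rV[R]_q) = 0.
Proof.
by rewrite /enorm big1 ?sqrtr0 // => j _; rewrite mxE expr0n.
Qed.

Lemma enormN v : enorm (- v) = enorm v.
Proof. by rewrite /enorm; under eq_bigr do rewrite mxE sqrrN. Qed.

Lemma enormB x y : enorm (x - y) = enorm (y - x).
Proof. by rewrite -enormN opprB. Qed.

(** A sum of squares factors as 2 |u| |v| (|u| |v| - A); only the degenerate case of a zero vector
    has to be treated apart. *)
Lemma cauchy_schwarz_row u v :
  \sum_(j < q) u ord0 j * v ord0 j <= enorm u * enorm v.
Proof.
set A := \sum_(j < q) u ord0 j * v ord0 j.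
have key : 0 <= \sum_(j < q)
    (enorm v * u ord0 j - enorm u * v ord0 j) ^+ 2.
  by apply: sumr_ge0 => j _; exact: sqr_ge0.
have E : \sum_(j < q) (enorm v * u ord0 j - enorm u * v ord0 j) ^+ 2 =
   2 * (enorm u * enorm v) * (enorm u * enorm v - A).
  have -> : \sum_(j < q) (enorm v * u ord0 j - enorm u * v ord0 j) ^+ 2 =
    \sum_(j < q) (enorm v ^+ 2 * u ord0 j ^+ 2 + enorm u ^+ 2 * v ord0 j ^+ 2 -
       2 * (enorm u * enorm v) * (u ord0 j * v ord0 j)).
    by apply: eq_bigr => j _; ring.
  rewrite sumrB big_split /= -!mulr_sumr -!enorm_sqr -/A; ring.
rewrite E in key.
have := enorm_ge0 u; rewrite le_eqVlt => /orP[/eqP u0|u0].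
  have uj j : u ord0 j = 0.
    have := enorm_sqr u; rewrite -u0 expr0n /= => /esym/eqP.
    rewrite psumr_eq0; last by move=> i _; exact: sqr_ge0.
    by move=> /allP/(_ j (mem_index_enum _)); rewrite /= sqrf_eq0 => /eqP.
  by rewrite /A big1 ?mulr_ge0 ?enorm_ge0 // => j _; rewrite uj mul0r.
have := enorm_ge0 v; rewrite le_eqVlt => /orP[/eqP v0|v0].
  have vj j : v ord0 j = 0.
    have := enorm_sqr v; rewrite -v0 expr0n /= => /esym/eqP.
    rewrite psumr_eq0; last by move=> i _; exact: sqr_ge0.
    by move=> /allP/(_ j (mem_index_enum _)); rewrite /= sqrf_eq0 => /eqP.
  by rewrite /A big1 ?mulr_ge0 ?enorm_ge0 // => j _; rewrite vj mulr0.
by move: key; rewrite pmulr_rge0 ?subr_ge0 // !mulr_gt0.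
Qed.

Lemma enormD u v : enorm (u + v) <= enorm u + enorm v.
Proof.
rewrite -(@ler_pXn2r _ 2) ?nnegrE ?addr_ge0 ?enorm_ge0 //.
rewrite sqrrD !enorm_sqr.
have -> : \sum_(j < q) (u + v) ord0 j ^+ 2 = \sum_(j < q) u ord0 j ^+ 2 +
    2 * (\sum_(j < q) u ord0 j * v ord0 j) + \sum_(j < q) v ord0 j ^+ 2.
  by rewrite mulr_sumr -!big_split /=; apply: eq_bigr => j _; rewrite mxE; ring.
have := cauchy_schwarz_row u v; lra.
Qed.

Lemma enorm_triangle x y z : enorm (x - z) <= enorm (x - y) + enorm (y - z).
Proof. by rewrite (le_trans _ (enormD _ _)) // addrA subrK. Qed.

Lemma enormZ (a : R) v : enorm (a *: v) = `|a| * enorm v.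
Proof.
rewrite /enorm -sqrtr_sqr -sqrtrM ?sqr_ge0 // mulr_sumr.
by under eq_bigr do rewrite mxE exprMn.
Qed.

Lemma coord_le_enorm v j : `|v ord0 j| <= enorm v.
Proof.
rewrite -sqrtr_sqr ler_sqrt // (bigD1 j) //= lerDl.
by apply: sumr_ge0 => i _; exact: sqr_ge0.
Qed.

Lemma norm_le_enorm v : `|v| <= enorm v.
Proof.
rewrite /Num.norm /= mx_normrE; apply: bigmax_le => [|[i j] _]; first exact: enorm_ge0.
by rewrite /= ord1 coord_le_enorm.
Qed.

Lemma coord_le_norm v j : `|v ord0 j| <= `|v|.
Proof.
by rewrite [leRHS]/Num.norm /= mx_normrE (bigD1 (ord0, j)) //= ?le_max ?lexx.
Qed.

Lemma enorm_le_norm v : enorm v <= q%:R * `|v|.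
Proof.
rewrite -(@ler_pXn2r _ 2) ?nnegrE ?mulr_ge0 ?enorm_ge0 // enorm_sqr exprMn.
apply: (@le_trans _ _ (\sum_(j < q) `|v| ^+ 2)).
  apply: ler_sum => j _; rewrite -real_normK ?num_real //.
  by rewrite ler_pXn2r ?nnegrE // coord_le_norm.
rewrite sumr_const card_ord -[leLHS]mulr_natl ler_wpM2r ?sqr_ge0 //.
by rewrite -natrX ler_nat; case: q => // n; rewrite expnS leq_pmulr // expn_gt0.
Qed.

Lemma open_enorm_ball (U : set 'rV[R]_q) x : open U -> U x ->
  exists2 e : R, 0 < e & forall y, enorm (y - x) < e -> U y.
Proof.
move=> oU Ux; have : nbhs x U by exact: open_nbhs_nbhs.
move=> /nbhs_ballP[e /= e0 eU]; exists e => // y xy; apply: eU.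
rewrite -ball_normE /= -normrN opprB; exact: le_lt_trans (norm_le_enorm _) xy.
Qed.

Lemma enorm_continuous : continuous (@enorm R q).
Proof.
move=> x; apply/(@cvgrPdist_lt R R^o _ (nbhs x) (nbhs_filter x)) => e e0.
have e' : 0 < e / (q%:R + 1).
  by rewrite divr_gt0 // ltr_wpDl ?ler0n.
near=> y.
have xy : `|x - y| < e / (q%:R + 1).
  by near: y; exact: cvgr_dist_lt.
have h1 := enormD (x - y) y; have h2 := enormD (y - x) x.
have h3 := enorm_le_norm (x - y).
rewrite subrK in h1; rewrite subrK enormB in h2.
have : `|enorm x - enorm y| <= enorm (x - y) by rewrite ler_norml; lra.
move=> /le_lt_trans; apply; apply: (le_lt_trans h3).
move: xy; rewrite ltr_pdivlMr ?ltr_wpDl ?ler0n // mulrDr mulr1 mulrC.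
have := normr_ge0 (x - y); lra.
Unshelve. all: by end_near. Qed.
End EuclideanNorm.

(** * Geometry of the iterated function system *)

Section IFSGeometry.
Variables (R : realType) (q : nat) (I : finType).
Variables (V : set 'rV[R]_q) (phi : I -> 'rV[R]_q -> 'rV[R]_q).
Hypothesis ifs : conformal_IFS V phi.
Local Notation K := (closure V).
Local Notation Lambda := (limit_set V phi).
Implicit Types (t u : nat -> I) (x y : 'rV[R]_q) (n m : nat).

Lemma ifs_maps i x : K x -> K (phi i x).
Proof. by case: ifs => _ [h _] _ _ _; exact: h. Qed.

Lemma ifs_bounded : exists2 D : R, 0 < D & forall x y, K x -> K y -> enorm (x - y) <= D.
Proof.
case: ifs => [[_ [_ [M VM]]] _ _ _ _].
have KM x : K x -> enorm x <= M.
  have cM : closed (@enorm R q @^-1` [set a | a <= M]).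
    apply: closed_comp; last exact: closed_le.
    by move=> a _; exact: enorm_continuous.
  by move=> Kx; have := closure_subset VM Kx; rewrite -(closure_id _).1.
exists (2 * `|M| + 1) => [|x y Kx Ky].
  by rewrite ltr_wpDl ?mulr_ge0.
rewrite (le_trans (enormD _ _)) // enormN.
have := KM _ Kx; have := KM _ Ky; have := ler_norm M; lra.
Qed.

Lemma ifs_compact : compact K.
Proof.
apply: bounded_closed_compact; last exact: closed_closure.
case: ifs => [[_ [[x0 Vx0] _]] _ _ _ _].
have [D D0 hD] := ifs_bounded.
exists (D + enorm x0); split; first exact: num_real.
move=> M DM x Kx /=; rewrite (le_trans (norm_le_enorm x)) //.
have -> : x = (x - x0) + x0 by rewrite subrK.
have := hD x x0 Kx (subset_closure Vx0); have := enormD (x - x0) x0.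
by move: DM => /ltW; lra.
Qed.

(** The maximum with 1/2 makes the ratio positive, so that its powers behave monotonically. *)
Lemma ifs_contraction : exists s : R, [/\ 0 < s, s < 1 &
  forall i x y, K x -> K y -> enorm (phi i x - phi i y) <= s * enorm (x - y)].
Proof.
case: ifs => _ _ _ [s [s1 hs]] _; exists (Num.max s (1 / 2)).
split; [by rewrite lt_max; apply/orP; right; lra|by rewrite gt_max s1 /=; lra|].
move=> i x y Kx Ky; rewrite (le_trans (hs i x y Kx Ky)) //.
by rewrite ler_wpM2r ?enorm_ge0 // le_max lexx.
Qed.

Lemma ifs_continuous : exists W : set 'rV[R]_q, [/\ open W, K `<=` W &
  forall i x, W x -> {for x, continuous (phi i)}].
Proof.
case: ifs => _ _ [W [oW KW hW]] _ _; exists W; split => // i x Wx.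
by have [/(_ x Wx) [/differentiable_continuous]] := hW i.
Qed.

Lemma comp_wordSl t n :
  comp_word phi t n.+1 = phi (t 0%N) \o comp_word phi (sshift t) n.
Proof.
elim: n => [|n IH]; first by [].
by rewrite /= -/(comp_word phi t n.+1) IH.
Qed.

Lemma comp_word_in t n x : K x -> K (comp_word phi t n x).
Proof. elim: n x => [x Kx|n IH x Kx]; first exact Kx.
exact (IH (phi (t n) x) (@ifs_maps (t n) x Kx)). Qed.

Lemma eq_comp_word t u n : (forall k, (k < n)%N -> t k = u k) ->
  comp_word phi t n = comp_word phi u n.
Proof.
elim: n => //= n IH tu; rewrite tu // IH // => k kn.
by apply: tu; exact: ltnW.
Qed.

Lemma cyl_imageSl t n :
  cyl_image V phi t n.+1 = phi (t 0%N) @` cyl_image V phi (sshift t) n.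
Proof. by rewrite /cyl_image comp_wordSl image_comp. Qed.

Lemma cyl_image_le t m n : (m <= n)%N ->
  cyl_image V phi t n `<=` cyl_image V phi t m.
Proof.
elim: n => [|n IH]; first by rewrite leqn0 => /eqP ->.
rewrite leq_eqVlt => /orP[/eqP -> //|]; rewrite ltnS => /IH h.
apply: subset_trans h => _ [x Kx <-] /=; exists (phi (t n) x) => //.
exact: (@ifs_maps (t n) x Kx).
Qed.

Lemma eq_cyl_image t u n : (forall k, (k < n)%N -> t k = u k) ->
  cyl_image V phi t n = cyl_image V phi u n.
Proof. by move=> tu; rewrite /cyl_image (eq_comp_word tu). Qed.

Lemma comp_word_continuous t n x : K x -> {for x, continuous (comp_word phi t n)}.
Proof.
have [W [_ KW cW]] := ifs_continuous.
elim: n x => [|n IH] x Kx /=; first exact: cvg_id.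
apply: continuous_comp; first exact: (cW _ _ (KW _ Kx)).
by apply: IH; exact: (@ifs_maps (t n) x Kx).
Qed.

Lemma cyl_image_compact t n : compact (cyl_image V phi t n).
Proof.
apply: continuous_compact; last exact: ifs_compact.
apply: continuous_in_subspaceT => x /set_mem Kx.
exact: comp_word_continuous.
Qed.

Lemma cyl_image_closed t n : closed (cyl_image V phi t n).
Proof. by apply: compact_closed; [exact: norm_hausdorff|exact: cyl_image_compact]. Qed.

Lemma comp_word_contraction : exists s : R, [/\ 0 < s, s < 1 &
  forall t n x y, K x -> K y ->
    enorm (comp_word phi t n x - comp_word phi t n y) <= s ^+ n * enorm (x - y)].
Proof.
have [s [s0 s1 hs]] := ifs_contraction; exists s; split => // t n.
elim: n => [|n IH] x y Kx Ky /=; first by rewrite expr0 mul1r.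
rewrite (le_trans (IH _ _ (@ifs_maps _ _ Kx) (@ifs_maps _ _ Ky))) //.
by rewrite exprSr -mulrA ler_wpM2l ?exprn_ge0 ?hs // ltW.
Qed.

Lemma ifs_nonempty : K !=set0.
Proof.
by case: ifs => [[_ [[x Vx] _]] _ _ _ _]; exists x; exact: subset_closure.
Qed.

(** The cylinder images are compact and decreasing, so a cluster point of the images of one point
    lies in all of them. Hence [ifs_proj] never takes its default value. *)
Lemma ifs_projP t n : cyl_image V phi t n (ifs_proj V phi t).
Proof.
have [x0 Kx0] := ifs_nonempty.
have [|p [_ clp]] := ifs_compact (F := (fun k => comp_word phi t k x0) @ \oo) _ _.
  by exists 0%N => // k _; exact: (@comp_word_in t k x0 Kx0).
suff: exists y, [set x | forall n, cyl_image V phi t n x] y.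
  by move=> /(xgetPex 0); exact.
exists p => k /=; apply: (@cyl_image_closed t k).
move=> A; apply: clp; exists k => // m /= km; apply: (@cyl_image_le t k m) => //.
by exists x0.
Qed.

Lemma ifs_proj_unique t x : (forall n, cyl_image V phi t n x) -> x = ifs_proj V phi t.
Proof.
move=> hx; have [D D0 hD] := ifs_bounded.
have [s [s0 s1 hs]] := comp_word_contraction.
apply/eqP; rewrite -subr_eq0 -normr_le0; apply/ler_addgt0Pl => e e0.
rewrite addr0 (le_trans (norm_le_enorm _)) //.
have : (fun n => D * s ^+ n) @ \oo --> D * 0.
  by apply: cvgMr; apply: cvg_expr; rewrite ger0_norm // ltW.
rewrite mulr0 => /cvgrPdist_lt/(_ e e0)[N _ /(_ N (leqnn N))] /=.
have Ds0 : 0 <= D * s ^+ N by apply: mulr_ge0; [exact: ltW|exact/exprn_ge0/ltW].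
rewrite sub0r normrN ger0_norm // => DN.
have [a Ka <-] := hx N; have [b Kb <-] := ifs_projP t N.
rewrite (le_trans (hs _ _ _ _ Ka Kb)) // (le_trans _ (ltW DN)) //.
by rewrite mulrC; apply: ler_wpM2r; [exact/exprn_ge0/ltW|exact: hD].
Qed.

Lemma ifs_proj_sshift t : ifs_proj V phi t = phi (t 0%N) (ifs_proj V phi (sshift t)).
Proof.
apply/esym/ifs_proj_unique => -[|n].
  exists (phi (t 0%N) (ifs_proj V phi (sshift t))) => //.
  by have [x Kx <-] := ifs_projP (sshift t) 0; exact: (@ifs_maps (t 0%N) x Kx).
by rewrite cyl_imageSl; exists (ifs_proj V phi (sshift t)) => //; exact: ifs_projP.
Qed.

Lemma ifs_proj_in t : Lambda (ifs_proj V phi t).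
Proof. by exists t => n; exact: ifs_projP. Qed.

Lemma limit_set_sub : Lambda `<=` K.
Proof. by move=> x [t /(_ 0%N) [y Ky <-]]. Qed.

Lemma ifs_proj_K t : K (ifs_proj V phi t).
Proof. exact: limit_set_sub (ifs_proj_in t). Qed.

Lemma limit_setE : Lambda = range (ifs_proj V phi).
Proof.
apply/seteqP; split=> [x [t ht]|_ [t _ <-]]; last exact: ifs_proj_in.
by exists t => //; rewrite -(ifs_proj_unique ht).
Qed.

Lemma limit_set_maps i x : Lambda x -> Lambda (phi i x).
Proof.
rewrite limit_setE => -[t _ <-].
exists (fun k => if k is m.+1 then t m else i) => //.
by rewrite ifs_proj_sshift.
Qed.

(* Konig's lemma. *)
Lemma limit_set_bigcap : Lambda = \bigcap_n \bigcup_t cyl_image V phi t n.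
Proof.
apply/seteqP; split=> [x [t ht] n _|x hx]; first by exists t.
(* A prefix is good if it extends to cylinders of every length that contain x. If each one-letter
   extension failed at some length [M i], the maximum of these lengths over the finite alphabet
   would contradict goodness. *)
pose good n t := forall m, exists u,
  (forall k, (k < n)%N -> u k = t k) /\ cyl_image V phi u m x.
pose upd n t i : nat -> I := fun k => if k == n then i else t k.
have step n t : good n t -> exists i, good n.+1 (upd n t i).
  move=> gt; apply: contrapT => /forallNP h.
  have h' i : exists m, ~ exists u,
      (forall k, (k < n.+1)%N -> u k = upd n t i k) /\ cyl_image V phi u m x.
    by have /existsNP := h i.
  have [M hM] := choice h'.
  have [u [ut ux]] := gt (\max_i M i)%N.
  apply: (hM (u n)); exists u; split.
    move=> k; rewrite /upd ltnS leq_eqVlt => /orP[/eqP ->|kn]; first by rewrite eqxx.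
    by rewrite ltn_eqF // ut.
  by apply: cyl_image_le ux; exact: leq_bigmax.
have [t0 _ _] := hx 0%N Logic.I.
have step' (p : nat * (nat -> I)) : exists i,
    good p.1 p.2 -> good p.1.+1 (upd p.1 p.2 i).
  have [g|ng] := pselect (good p.1 p.2); last by exists (t0 0%N).
  by have [i gi] := step _ _ g; exists i.
have [nx hnx] := choice step'.
pose fix w n := if n is m.+1 then upd m (w m) (nx (m, w m)) else t0.
have gw n : good n (w n).
  elim: n => [|n IH]; last exact: (hnx (n, w n)).
  by move=> m; have [u _ ux] := hx m Logic.I; exists u.
have wS k n : (k < n)%N -> w n k = w k.+1 k.
  elim: n => // n IH; rewrite ltnS leq_eqVlt => /orP[/eqP -> //|kn].
  by rewrite /= {1}/upd ltn_eqF // IH.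
exists (fun k => w k.+1 k) => n; have [u [uw ux]] := gw n n.
rewrite (@eq_cyl_image _ u) // => k kn.
by rewrite uw // wS.
Qed.

(** At level n only the prefix of length n matters, so the union over all sequences is a finite
    union of compact images. *)
Lemma limit_set_closed : closed Lambda.
Proof.
rewrite limit_set_bigcap; apply: closed_bigI => n _.
have -> : \bigcup_t cyl_image V phi t n =
    \bigcup_(w in [set: {ffun 'I_n -> I}])
      \bigcup_(t in [set t | prefix_word n t = w]) cyl_image V phi t n.
  apply/seteqP; split=> [x [t _ tx]|x [w _ [t _ tx]]]; last by exists t.
  by exists (prefix_word n t) => //; exists t.
apply: closed_bigcup; first exact: finite_finset.
move=> w _; have [[t tw]|/forallNP h] := pselect (exists t, prefix_word n t = w).
  rewrite (_ : \bigcup_(_ in _) _ = cyl_image V phi t n); first exact: cyl_image_closed.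
  apply/seteqP; split=> [x [u /= uw ux]|x tx]; last by exists t.
  rewrite (@eq_cyl_image _ u) //; apply/prefix_word_eq; congruence.
rewrite (_ : \bigcup_(_ in _) _ = set0); first exact: closed0.
by rewrite -subset0 => x [u /= /h].
Qed.
End IFSGeometry.
(* closure V x unfolds to a product over neighbourhoods, whose variables would
   otherwise be taken as implicit arguments. *)
Arguments ifs_maps {R q I V phi} ifs i {x} Kx B nB : rename.
Arguments comp_word_in {R q I V phi} ifs t n {x} Kx B nB : rename.
Arguments ifs_proj_K {R q I V phi} ifs t B nB : rename.

(** * Laws of finite-valued functions *)

(* Sets are only measured through their trace on a set S of full measure: the
   lift map is measurable on Sigma x Lambda only. *)
Section TraceProbability.
Variables (d : measure_display) (T : measurableType d) (R : realType).
Variables (P : probability T R) (S : set T).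
Hypotheses (mS : measurable S) (PS : P S = 1%E).
Implicit Types A B : set T.

Definition tmeas A := measurable (S `&` A).
Definition pm A : R := fine (P (S `&` A)).

Lemma tmeasW A : measurable A -> tmeas A.
Proof. exact: measurableI. Qed.

Lemma tmeas_ext A B : (forall x, S x -> A x <-> B x) -> tmeas A -> tmeas B.
Proof.
move=> AB; rewrite /tmeas (_ : S `&` A = S `&` B) //.
by apply/seteqP; split=> x [Sx] /(AB x Sx).
Qed.

Lemma tmeasC A : tmeas A -> tmeas (~` A).
Proof.
move=> mA; rewrite /tmeas -setDE -[S `\` A]set0U -(setDv S) -setDIr.
exact: measurableD.
Qed.

Lemma tmeas_bigcup (F : nat -> set T) : (forall n, tmeas (F n)) -> tmeas (\bigcup_n F n).
Proof. by move=> mF; rewrite /tmeas setI_bigcupr; exact: bigcupT_measurable. Qed.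

Lemma tmeasU A B : tmeas A -> tmeas B -> tmeas (A `|` B).
Proof. by move=> mA mB; rewrite /tmeas setIUr; exact: measurableU. Qed.

Lemma tmeasI A B : tmeas A -> tmeas B -> tmeas (A `&` B).
Proof. by move=> mA mB; rewrite /tmeas setIIr; exact: measurableI. Qed.

Lemma tmeasD A B : tmeas A -> tmeas B -> tmeas (A `\` B).
Proof. by move=> mA mB; rewrite setDE; apply: tmeasI => //; exact: tmeasC. Qed.

Lemma tmeas_bigcap (F : nat -> set T) : (forall n, tmeas (F n)) -> tmeas (\bigcap_n F n).
Proof.
move=> mF; rewrite -[\bigcap_n _]setCK setC_bigcap; apply: tmeasC.
by apply: tmeas_bigcup => n; exact: tmeasC.
Qed.

Lemma tmeasT : tmeas setT. Proof. by rewrite /tmeas setIT. Qed.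
Lemma tmeas0 : tmeas set0. Proof. by rewrite /tmeas setI0. Qed.

Lemma tmeas_fin (I : finType) (D : pred I) (F : I -> set T) :
  (forall i, tmeas (F i)) -> tmeas [set x | exists2 i, D i & F i x].
Proof.
move=> mF; rewrite /tmeas (_ : _ `&` _ = \bigcup_(i in [set` D]) (S `&` F i)).
  apply: fin_bigcup_measurable; first exact: finite_finset.
  by move=> i _; exact: mF.
by apply/seteqP; split=> [x [Sx [i Di Fi]]|x [i Di [Sx Fi]]];
  [exists i|split => //; exists i].
Qed.

Let Pfin A : tmeas A -> P (S `&` A) = (pm A)%:E.
Proof. by move=> mA; rewrite fineK // fin_num_measure. Qed.

Lemma pmE A : tmeas A -> P (S `&` A) = (pm A)%:E. Proof. exact: Pfin. Qed.

Lemma pm_ge0 A : 0 <= pm A. Proof. exact: fine_ge0. Qed.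

Lemma eq_pm A B : (forall x, S x -> A x <-> B x) -> pm A = pm B.
Proof.
move=> AB; rewrite /pm (_ : S `&` A = S `&` B) //.
by apply/seteqP; split=> x [Sx] /(AB x Sx).
Qed.

Lemma le_pm A B : tmeas A -> tmeas B -> (forall x, S x -> A x -> B x) -> pm A <= pm B.
Proof.
move=> mA mB AB; rewrite -lee_fin -!Pfin //.
by apply: le_measure; rewrite ?inE // => x [Sx Ax]; split => //; exact: AB.
Qed.

Lemma pmT : pm setT = 1. Proof. by rewrite /pm setIT PS. Qed.
Lemma pm0 : pm set0 = 0. Proof. by rewrite /pm setI0 measure0. Qed.

Lemma pm_disjointU A B : tmeas A -> tmeas B ->
  (forall x, S x -> A x -> B x -> False) -> pm (A `|` B) = pm A + pm B.
Proof.
move=> mA mB AB; apply/EFin_inj; rewrite EFinD -!Pfin //; last exact: tmeasU.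
rewrite setIUr measureU //.
by rewrite -subset0 => x [[Sx Ax] [_ Bx]]; exact: (AB x).
Qed.

Lemma pmC A : tmeas A -> pm (~` A) = 1 - pm A.
Proof.
move=> mA; apply/eqP; rewrite eq_sym subr_eq -pmT -(setvU A); apply/eqP.
by apply: pm_disjointU => //; exact: tmeasC.
Qed.

Lemma pm_le1 A : tmeas A -> pm A <= 1.
Proof. by move=> mA; rewrite -pmT; apply: le_pm => //; exact: tmeasT. Qed.

Lemma pmD A B : tmeas A -> tmeas B -> pm A = pm (A `\` B) + pm (A `&` B).
Proof.
move=> mA mB; rewrite -pm_disjointU; first by rewrite setUC setUIDK.
- exact: tmeasD.
- exact: tmeasI.
- by move=> x _ [_ nB] [_ /nB].
Qed.


Lemma pm_bigcup_tail (F : nat -> set T) (e : R) : (forall n, tmeas (F n)) ->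
  {homo F : m n / (m <= n)%N >-> m `<=` n} -> 0 < e ->
  exists N, pm (\bigcup_n F n) - e < pm (F N).
Proof.
move=> mF ndF e0.
have nd : {homo (fun n => S `&` F n) : n m / (n <= m)%N >-> (n <= m)%O}.
  by move=> m n mn; apply/subsetPset; apply: setIS; exact: ndF.
have : EFin \o (fun n => pm (F n)) @ \oo --> (pm (\bigcup_n F n))%:E.
  rewrite -Pfin; last exact: tmeas_bigcup.
  rewrite (_ : EFin \o _ = P \o (fun n => S `&` F n)); last first.
    by apply/funext => n /=; rewrite Pfin.
  rewrite setI_bigcupr; apply: nondecreasing_cvg_mu => //.
  by rewrite -setI_bigcupr; exact: tmeas_bigcup.
move=> /fine_cvgP[_] /cvgrPdist_lt/(_ e e0)[N _ /(_ N (leqnn N))] /= h.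
exists N; move: h; rewrite ltr_norml => /andP[_]; lra.
Qed.

Section FiniteLaw.
Variable F : finType.
Implicit Type X : T -> F.

Definition tfin X := forall t, tmeas [set z | X z = t].
Definition law X t : R := pm [set z | X z = t].

Lemma tfin_pred X (D : pred F) : tfin X -> tmeas [set z | D (X z)].
Proof.
move=> mX; have := tmeas_fin D mX; apply: tmeas_ext => x _; split.
  by move=> [i Di /= ->].
by move=> /= Dx; exists (X x).
Qed.

Lemma law_ge0 X t : 0 <= law X t. Proof. exact: pm_ge0. Qed.

Lemma law_pred X (D : pred F) : tfin X ->
  pm [set z | D (X z)] = \sum_(t | D t) law X t.
Proof.
move=> mX.
have Es : forall s : seq F, uniq s -> pm [set z | X z \in s] = \sum_(t <- s) law X t.
  elim=> [_|a s IH /= /andP[as_ us]].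
    by rewrite big_nil -pm0; apply: eq_pm => x _; split.
  rewrite big_cons -IH // -pm_disjointU //; last 2 first.
  - exact: (tfin_pred (mem s) mX).
  - by move=> x _ /= -> h; rewrite h in as_.
  apply: eq_pm => x _ /=; rewrite inE; split=> [/orP[/eqP|]|[->|->]];
    by [left|right|rewrite eqxx|rewrite orbT].
have := Es [seq t <- index_enum F | D t] (filter_uniq _ (index_enum_uniq _)).
rewrite big_filter => <-; apply: eq_pm => x _ /=.
by rewrite mem_filter mem_index_enum andbT.
Qed.

Lemma law_sum X : tfin X -> \sum_t law X t = 1.
Proof.
by move=> mX; rewrite -pmT -(law_pred predT) //; apply: eq_pm.
Qed.

Lemma law_neq0 X t : law X t != 0 -> exists2 z, S z & X z = t.
Proof.
move=> h; apply: contrapT => nh; move/eqP: h; apply; rewrite /law -pm0.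
by apply: eq_pm => x Sx /=; split => // Xx; apply: nh; exists x.
Qed.
End FiniteLaw.

Lemma tfin_comp (F G : finType) (X : T -> F) (f : F -> G) : tfin X -> tfin (f \o X).
Proof.
move=> mX t; have := tfin_pred (fun s => f s == t) mX.
by apply: tmeas_ext => x _ /=; split => /eqP.
Qed.

Lemma law_comp (F G : finType) (X : T -> F) (f : F -> G) t : tfin X ->
  law (f \o X) t = \sum_(s | f s == t) law X s.
Proof.
by move=> mX; rewrite -law_pred //; apply: eq_pm => x _ /=; split => /eqP.
Qed.

Lemma law_comp_sum (F G : finType) (X : T -> F) (f : F -> G) (h : G -> R) : tfin X ->
  \sum_t law (f \o X) t * h t = \sum_s law X s * h (f s).
Proof.
move=> mX; rewrite [RHS](partition_big f predT) //=; apply: eq_bigr => t _.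
rewrite law_comp // mulr_suml; apply: eq_bigr => s /eqP <- //.
Qed.

Lemma tfin_pair (F G : finType) (X : T -> F) (Y : T -> G) :
  tfin X -> tfin Y -> tfin (fun z => (X z, Y z)).
Proof.
move=> mX mY [s t]; apply: tmeas_ext (tmeasI (mX s) (mY t)) => x _ /=.
by split=> [[-> ->]|[-> ->]].
Qed.

Lemma tfin_ffun n (F : finType) (X : 'I_n -> T -> F) :
  (forall k, tfin (X k)) -> tfin (fun z => [ffun k => X k z]).
Proof.
move=> mX t.
have : tmeas (~` [set z | exists2 k : 'I_n, xpredT k & (~` [set z | X k z = t k]) z]).
  by apply/tmeasC/(tmeas_fin xpredT) => k; exact/tmeasC/mX.
apply: tmeas_ext => x _ /=; split=> [h|/ffunP h [k _]].
  apply/ffunP => k; rewrite ffunE; apply: contrapT => hk; apply: h; by exists k.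
by apply; have := h k; rewrite ffunE.
Qed.

Lemma eq_law (F : finType) (X Y : T -> F) t : (forall z, S z -> X z = Y z) ->
  law X t = law Y t.
Proof. by move=> XY; apply: eq_pm => x Sx /=; rewrite XY. Qed.
End TraceProbability.

(** * Measurability and invariance of the lift map on Sigma x Lambda *)

Section LiftMeasurability.
Variables (R : realType) (q : nat) (I : finType) (i0 : I).
Variables (V : set 'rV[R]_q) (phi : I -> 'rV[R]_q -> 'rV[R]_q).
Hypothesis ifs : conformal_IFS V phi.
Local Notation M := (XM R q i0).
Local Notation S := (SxL V phi : set M).
Local Notation Phi := (@Phi_lift R q I i0 phi).

Lemma measurable_prefix_open n (w : {ffun 'I_n -> I}) (U : set 'rV[R]_q) :
  open U -> measurable ([set z | prefix_word n z.1 = w /\ U z.2] : set M).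
Proof.
move=> oU; apply: sub_sigma_algebra; exists n, w, U; split => //.
by apply/seteqP; split=> z /= [/prefix_wordP].
Qed.

Lemma measurable_prefix n (w : {ffun 'I_n -> I}) :
  measurable ([set z | prefix_word n z.1 = w] : set M).
Proof.
have := measurable_prefix_open w (@openT 'rV[R]_q).
by congr measurable; apply/seteqP; split=> z /= => [[]|].
Qed.

Lemma measurable_snd_open (U : set 'rV[R]_q) :
  open U -> measurable ([set z | U z.2] : set M).
Proof.
move=> oU; have := measurable_prefix_open [ffun k : 'I_0 => i0] oU.
congr measurable; apply/seteqP; split=> z /= => [[]//|Uz]; split => //.
by apply/ffunP => -[].
Qed.

Lemma measurable_snd_borel (B : set 'rV[R]_q) :
  <<s [set U : set 'rV[R]_q | open U] >> B -> measurable ([set z | B z.2] : set M).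
Proof.
apply: (@smallest_sub _ _ _ [set B | measurable ([set z | B z.2] : set M)]);
  last exact: measurable_snd_open.
split=> [|A mA|F mF]; rewrite /mkset.
- exact: (@measurable0 _ M).
- have := measurableC mA; congr measurable.
  by apply/seteqP; split=> z /=; [|case].
- exact: (@bigcupT_measurable _ M _ mF).
Qed.

Lemma measurable_SxL : measurable S.
Proof.
have := measurableC (measurable_snd_open (closed_openC (limit_set_closed ifs))).
by congr measurable; rewrite -[RHS]setCK.
Qed.

Lemma SxL_Phi z : S z -> S (Phi z).
Proof. by case: z => w x /=; exact: (limit_set_maps ifs). Qed.

Lemma SxL_iter n z : S z -> S (iter n Phi z).
Proof. by move=> Sz; elim: n => //= n; exact: SxL_Phi. Qed.

Lemma iter_Phi n z :
  iter n Phi z = (iter_shift n z.1, fwd_word phi z.1 n z.2).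
Proof.
elim: n => [|n IH]; first by case: z.
rewrite iterS IH /Phi_lift /= /iter_shift addn0; congr pair.
by apply/funext => k; rewrite /sshift addnS addSn.
Qed.

Local Notation tm := (tmeas S).

(** The preimage of a generator is, on S, a finite union over words u of length n + 1 of the
    cylinder of u times W intersected with the preimage of U under [phi (u ord0)]. That intersection
    is open because W is a neighbourhood of closure V on which the maps are continuous. *)
Lemma tmeas_Phi (A : set M) : tm A -> tm (Phi @^-1` A).
Proof.
move=> mA; apply: (@tmeas_ext _ M S (Phi @^-1` (S `&` A))).
  by move=> z Sz /=; split=> [[]|] // ?; split => //; exact: SxL_Phi.
suff H (B : set M) : measurable B -> tm (Phi @^-1` B) by exact: (H _ mA).
move: B.
apply: (@smallest_sub _ _ _ [set B | tm (Phi @^-1` B)]) => [|_ [n [w [U [oU ->]]]]].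
  split=> [|B mB|F mF] /=.
  - by rewrite preimage_set0; exact: tmeas0.
  - rewrite setTD preimage_setC; apply: tmeasC => //; exact: measurable_SxL.
  - by rewrite preimage_bigcup; exact: tmeas_bigcup.
have [W [oW KW cW]] := ifs_continuous ifs.
pose D (u : {ffun 'I_n.+1 -> I}) := [forall k : 'I_n, u (lift ord0 k) == w k].
pose F (u : {ffun 'I_n.+1 -> I}) : set M :=
  [set z | prefix_word n.+1 z.1 = u /\ (W `&` phi (u ord0) @^-1` U) z.2].
have mF u : tm (F u).
  apply: tmeasW; first exact: measurable_SxL.
  apply: measurable_prefix_open; rewrite openE => x [Wx Ux].
  apply: filterI; first exact: open_nbhs_nbhs.
  by apply: (cW _ _ Wx); exact: open_nbhs_nbhs.
apply: tmeas_ext (tmeas_fin D mF) => z Sz /=; split.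
  move=> [u /forallP Du [zu [Wz Uz]]]; split.
    move=> k; have /eqP <- := Du k; rewrite -zu ffunE /=.
    by rewrite /sshift /bump leq0n add1n.
  by move: Uz; rewrite -zu /= ffunE.
move=> [zw Uz]; exists (prefix_word n.+1 z.1).
  apply/forallP => k; rewrite ffunE -zw /sshift /= /bump leq0n add1n //.
split=> //; split; last by rewrite /= ffunE.
exact: (KW _ (limit_set_sub Sz)).
Qed.

Lemma tmeas_iter n (A : set M) : tm A -> tm (iter n Phi @^-1` A).
Proof.
move=> mA; elim: n => [|n IH]; first by apply: tmeas_ext mA.
by apply: tmeas_ext (tmeas_Phi IH) => z _ /=; rewrite -iterSr.
Qed.

Lemma tfin_iter (F : finType) (Y : M -> F) n : tfin S Y -> tfin S (Y \o iter n Phi).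
Proof. by move=> mY t; exact: tmeas_iter (mY t). Qed.

Lemma tfin_prefix n : tfin S (fun z : M => prefix_word n z.1).
Proof. by move=> w; apply: tmeasW; [exact: measurable_SxL|exact: measurable_prefix]. Qed.

Section Invariant.
Variable mu : probability M R.
Hypothesis muI : invariant_prob V phi mu.

Lemma invariant_full : mu S = 1%E. Proof. by case: muI. Qed.

Lemma pm_Phi (A : set M) : tm A -> pm mu S (Phi @^-1` A) = pm mu S A.
Proof.
move=> mA; rewrite /pm; case: muI => _ /(_ (S `&` A) mA) h.
have -> : S `&` A = S `&` A `&` S by rewrite setIAC setIid.
rewrite -h; congr (fine (mu _)); apply/seteqP; split=> z /=.
  by move=> [Sz Az]; split=> //; split => //; exact: SxL_Phi.
by move=> [[_ Az] Sz].
Qed.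

Lemma pm_iter n (A : set M) : tm A -> pm mu S (iter n Phi @^-1` A) = pm mu S A.
Proof.
move=> mA; elim: n => [//|n IH].
rewrite -IH -[RHS]pm_Phi; last exact: tmeas_iter.
by apply: eq_pm => z _ /=; rewrite -iterSr.
Qed.

Lemma law_iter (F : finType) (Y : M -> F) n t : tfin S Y ->
  law mu S (Y \o iter n Phi) t = law mu S Y t.
Proof. by move=> mY; exact: pm_iter (mY t). Qed.
End Invariant.
End LiftMeasurability.

(** * Shannon entropy of finite-valued functions *)

Section LawEntropy.
Variables (d : measure_display) (T : measurableType d) (R : realType).
Variables (P : probability T R) (S : set T).
Hypotheses (mS : measurable S) (PS : P S = 1%E).
Local Notation H X := (shannon (law P S X)).

Lemma entropy_comp_le (F G : finType) (X : T -> F) (f : F -> G) :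
  tfin S X -> H (f \o X) <= H X.
Proof.
move=> mX; rewrite /shannon.
under eq_bigr do rewrite -mulrN.
rewrite (law_comp_sum P f (fun t => - ln (law P S (f \o X) t)) mX).
apply: ler_sum => s _; rewrite mulrN lerN2.
have := law_ge0 P S X s; rewrite le_eqVlt => /orP[/eqP <-|h0].
  by rewrite !mul0r.
have le : law P S X s <= law P S (f \o X) (f s).
  apply: le_pm; [exact: mX|exact: (tfin_comp f mX (f s))|by move=> x _ /= ->].
by rewrite ler_wpM2l ?law_ge0 // ler_ln ?posrE // (lt_le_trans h0).
Qed.

(** A coding bound: H(X) is at most the entropy of the pair, and this is at most the mean length -
    ln g of any code for the pair with subprobability weights g. *)
Lemma entropy_pair_gibbs (F G : finType) (X : T -> F) (Y : T -> G)
  (g : F -> G -> R) : tfin S X -> tfin S Y ->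
  (forall s t, 0 <= g s t) -> \sum_s \sum_t g s t <= 1 ->
  (forall z, S z -> law P S (fun z => (X z, Y z)) (X z, Y z) != 0 ->
     g (X z) (Y z) != 0) ->
  H X <= \sum_p law P S (fun z => (X z, Y z)) p * - ln (g p.1 p.2).
Proof.
move=> mX mY g0 g1 gn0.
have mXY := tfin_pair mX mY.
apply: le_trans (entropy_comp_le (@fst F G) mXY) _.
under [leRHS]eq_bigr do rewrite mulrN.
apply: gibbs.
- by move=> t; exact: law_ge0.
- by move=> [s t] /=; exact: g0.
- by rewrite law_sum // -(pair_big predT predT g) /= .
- move=> [s t] lst; have [z Sz zst] := law_neq0 lst.
  by move: zst lst => [<- <-]; exact: gn0.
Qed.

(** Gibbs' inequality against the product of the two marginal laws. *)
Lemma entropy_pair_le (F G : finType) (X : T -> F) (Y : T -> G) :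
  tfin S X -> tfin S Y -> H (fun z => (X z, Y z)) <= H X + H Y.
Proof.
move=> mX mY; have mXY := tfin_pair mX mY.
have l1 s t : law P S (fun z => (X z, Y z)) (s, t) <= law P S X s.
  by apply: le_pm => // x _ /= [].
have l2 s t : law P S (fun z => (X z, Y z)) (s, t) <= law P S Y t.
  by apply: le_pm => // x _ /= [].
have pos (a b : R) : 0 <= a -> a <= b -> a != 0 -> 0 < b.
  by move=> a0 ab an0; apply: lt_le_trans ab; rewrite lt_neqAle eq_sym an0.
apply: (@le_trans _ _ (\sum_p - (law P S (fun z => (X z, Y z)) p *
   ln (law P S X p.1 * law P S Y p.2)))).
  apply: gibbs.
  - by move=> p; exact: law_ge0.
  - by move=> p; rewrite mulr_ge0 ?law_ge0.
  - rewrite law_sum // -(pair_big predT predT (fun s t => law P S X s * law P S Y t)) /=.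
    under eq_bigr do rewrite -mulr_sumr law_sum // mulr1.
    by rewrite law_sum.
  - move=> [s t] h; rewrite lt0r_neq0 // mulr_gt0 //.
      exact: pos (law_ge0 _ _ _ _) (l1 s t) h.
    exact: pos (law_ge0 _ _ _ _) (l2 s t) h.
have E1 : H X = \sum_p law P S (fun z => (X z, Y z)) p * - ln (law P S X p.1).
  rewrite -(law_comp_sum P fst (fun s => - ln (law P S X s)) mXY).
  by apply: eq_bigr => s _; rewrite mulrN.
have E2 : H Y = \sum_p law P S (fun z => (X z, Y z)) p * - ln (law P S Y p.2).
  rewrite -(law_comp_sum P snd (fun s => - ln (law P S Y s)) mXY).
  by apply: eq_bigr => s _; rewrite mulrN.
rewrite E1 E2 -big_split /=; apply: ler_sum => -[s t] _ /=.
have [->|h] := eqVneq (law P S (fun z => (X z, Y z)) (s, t)) 0.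
  by rewrite !mul0r oppr0 addr0.
have p1 := pos _ _ (law_ge0 _ _ _ _) (l1 s t) h.
have p2 := pos _ _ (law_ge0 _ _ _ _) (l2 s t) h.
by rewrite lnM ?posrE // mulrDr !mulrN opprD.
Qed.

Lemma entropy_ge0 (F : finType) (X : T -> F) : tfin S X -> 0 <= H X.
Proof.
move=> mX; apply: sumr_ge0 => t _; rewrite -mulrN mulr_ge0 ?law_ge0 // oppr_ge0.
by apply: ln_le0; exact: pm_le1.
Qed.
End LawEntropy.

(** * Approximation by future cylinders *)

Section FutureApproximation.
Variables (R : realType) (q : nat) (I : finType) (i0 : I).
Variables (V : set 'rV[R]_q) (phi : I -> 'rV[R]_q -> 'rV[R]_q).
Hypothesis ifs : conformal_IFS V phi.
Local Notation M := (XM R q i0).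
Local Notation S := (SxL V phi : set M).
Local Notation Phi := (@Phi_lift R q I i0 phi).
Local Notation tm := (tmeas S).
Variable mu : probability M R.
Hypothesis muI : invariant_prob V phi mu.
Local Notation pr := (pm mu S).

Let mS : measurable S. Proof. exact: (@measurable_SxL R q I i0 V phi ifs). Qed.
Let PS : mu S = 1%E. Proof. exact: (invariant_full muI). Qed.

Definition depends_on_prefix (A : Type) m (f : (nat -> I) -> A) :=
  forall t u, (forall k, (k < m)%N -> t k = u k) -> f t = f u.

Lemma depends_on_prefixE (A : Type) m (f : (nat -> I) -> A) t :
  depends_on_prefix m f -> f t = f (ext_word (prefix_word m t) (fun _ => i0)).
Proof.
move=> df; apply: df => k km.
by rewrite -[k]/(val (Ordinal km)) ext_word_ord ffunE.
Qed.

Lemma depends_on_prefix_shift (A : Type) j m (f : (nat -> I) -> A) :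
  depends_on_prefix m f -> depends_on_prefix (j + m) (f \o iter_shift j).
Proof.
move=> df t u tu; apply: df => k km; apply: tu.
by rewrite ltn_add2l.
Qed.

Lemma depends_on_prefix_le (A : Type) m n (f : (nat -> I) -> A) : (m <= n)%N ->
  depends_on_prefix m f -> depends_on_prefix n f.
Proof. by move=> mn df t u tu; apply: df => k km; apply: tu; exact: leq_trans mn. Qed.

Lemma tfin_prefix_fun (F : finType) m (f : (nat -> I) -> F) :
  depends_on_prefix m f -> tfin S (fun z : M => f z.1).
Proof.
move=> df; have := tfin_comp (fun w : {ffun 'I_m -> I} => f (ext_word w (fun=> i0)))
  (@tfin_prefix R q I i0 V phi ifs m).
move=> h t; apply: tmeas_ext (h t) => z _ /=.
by rewrite -depends_on_prefixE.
Qed.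

Definition mismatch N (A : set M) (D : (nat -> I) -> bool) : set M :=
  [set z | ~ (A (iter N Phi z) <-> D z.1)].

Lemma tmeas_mismatch N A m D : tm A -> depends_on_prefix m D -> tm (mismatch N A D).
Proof.
move=> mA dD.
have mA' := tmeas_iter ifs N mA.
have mD : tm [set z : M | D z.1] by exact: (tfin_prefix_fun dD true).
apply: tmeas_ext (tmeasU (tmeasD mS mA' mD) (tmeasD mS mD mA')) => z _ /=.
rewrite /mismatch /=; split=> [[[h1 h2] [h _]|[h1 h2] [_ h]]|h].
- by apply: h2; exact: h.
- by apply: h2; exact: h.
- have [Az|nAz] := pselect (A (iter N Phi z)).
    by left; split => // Dz; apply: h; split.
  right; split => //; apply: contrapT => nDz; apply: h; split => //.
Qed.

Lemma pm_mismatch_shift j N (A : set M) m D : tm A -> depends_on_prefix m D ->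
  pr (mismatch (N + j) A (D \o iter_shift j)) = pr (mismatch N A D).
Proof.
move=> mA dD; rewrite -(pm_iter ifs muI j (tmeas_mismatch N mA dD)).
apply: eq_pm => z _; rewrite /mismatch /= -iterD.
by have -> : (iter j Phi z).1 = iter_shift j z.1 by rewrite iter_Phi.
Qed.

(** The letters of z do not determine whether A holds at time 0, since x is arbitrary. At time N the
    initial x is nearly forgotten by contraction, so it is A at time N that letters can predict. *)
Definition future_approx (A : set M) := forall e : R, 0 < e ->
  exists N m D, depends_on_prefix m D /\ pr (mismatch N A D) < e.

Lemma future_approxC (A : set M) : tm A -> future_approx A -> future_approx (~` A).
Proof.
move=> mA hA e e0; have [N [m [D [dD De]]]] := hA e e0.
exists N, m, (fun t => ~~ D t); split; first by move=> t u tu; rewrite (dD t u).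
rewrite (_ : mismatch _ _ _ = mismatch N A D) //.
apply/seteqP; split=> z; rewrite /mismatch /=; apply: contra_not => -[h1 h2];
  split.
- by move=> nA; apply/negP => /h2.
- by move=> /negP nD /h1.
- by move=> Az; apply: contrapT => /negP nD; apply: (h2 nD).
- by move=> Dz; apply: contrapT => /h1; rewrite Dz.
Qed.

Lemma pmU_le (A B C : set M) : tm A -> tm B -> tm C ->
  (forall z, S z -> C z -> A z \/ B z) -> pr C <= pr A + pr B.
Proof.
move=> mA mB mC CAB.
have mBA := tmeasD mS mB mA.
rewrite (@le_trans _ _ (pr (A `|` (B `\` A)))) //.
  apply: le_pm => //; first exact: tmeasU.
  move=> z Sz Cz; have [Az|nAz] := pselect (A z); first by left.
  by right; split => //; case: (CAB _ Sz Cz).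
rewrite pm_disjointU // ?lerD2l; last by move=> z _ Az [_ /(_ Az)].
by apply: le_pm => // z _ [].
Qed.

Lemma pm_union_le (J : finType) (F : J -> set M) (s : seq J) : (forall j, tm (F j)) ->
  pr [set z | exists2 j, j \in s & F j z] <= \sum_(j <- s) pr (F j).
Proof.
move=> mF; have mB s' : tm [set z | exists2 j, j \in s' & F j z].
  exact: (tmeas_fin (mem s')).
elim: s => [|a s IH].
  by rewrite big_nil (_ : [set _ | _] = set0) ?pm0 // -subset0 => z [].
rewrite big_cons; apply: le_trans (lerD (lexx _) IH).
apply: pmU_le => //; move=> z _ [j]; rewrite inE => /orP[/eqP ->|js] hz; first by left.
by right; exists j.
Qed.

(** Two predictors with different delays N and N' are brought to the common delay N + N' by letting
    each of them read further along the sequence; invariance preserves its error. *)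
Lemma future_approxU (A B : set M) : tm A -> tm B ->
  future_approx A -> future_approx B -> future_approx (A `|` B).
Proof.
move=> mA mB hA hB e e0; have e2 : 0 < e / 2 by rewrite divr_gt0.
have [N [m [D [dD De]]]] := hA _ e2; have [N' [m' [D' [dD' De']]]] := hB _ e2.
pose E := D \o iter_shift N'; pose E' := D' \o iter_shift N.
have dE : depends_on_prefix (N' + m) E by exact: depends_on_prefix_shift.
have dE' : depends_on_prefix (N + m') E' by exact: depends_on_prefix_shift.
exists (N + N')%N, (N' + m + (N + m'))%N, (fun t => E t || E' t); split.
  move=> t u tu; rewrite (dE t u) ?(dE' t u) // => k km; apply: tu.
    exact: ltn_addl.
  exact: ltn_addr.
apply: le_lt_trans (_ : _ <= pr (mismatch (N + N') A E) + pr (mismatch (N + N') B E')) _.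
  apply: pmU_le.
  - exact: (tmeas_mismatch _ mA dE).
  - exact: (tmeas_mismatch _ mB dE').
  - apply: (@tmeas_mismatch _ _ (N' + m + (N + m'))); first exact: tmeasU.
    move=> t u tu; rewrite (dE t u) ?(dE' t u) // => k km; apply: tu.
      exact: ltn_addl.
    exact: ltn_addr.
  - move=> z _; rewrite /mismatch /= => h; apply: contrapT => /not_orP[/contrapT h1 /contrapT h2].
    apply: h; split=> [[/h1 ->|/h2 ->]|/orP[/h1|/h2]]; rewrite ?orbT //; by [left|right].
rewrite (pm_mismatch_shift _ _ mA dD) addnC (pm_mismatch_shift _ _ mB dD').
lra.
Qed.

Lemma future_approx_bigcup (F : nat -> set M) : (forall n, tm (F n)) ->
  (forall n, future_approx (F n)) -> future_approx (\bigcup_n F n).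
Proof.
move=> mF hF e e0; have e2 : 0 < e / 2 by rewrite divr_gt0.
pose G n := \bigcup_(k in [set k | (k <= n)%N]) F k.
have mUF : tm (\bigcup_n F n) by exact: tmeas_bigcup.
have GS n : G n.+1 = G n `|` F n.+1.
  apply/seteqP; split=> [z [k /=]|z [[k /= kn Fk]|Fk]].
  - rewrite leq_eqVlt => /orP[/eqP ->|kn] Fk; first by right.
    by left; exists k.
  - by exists k => //; exact: leqW.
  - by exists n.+1 => /=.
have G0 : G 0%N = F 0%N.
  apply/seteqP; split=> [z [k /=]|z Fz]; first by rewrite leqn0 => /eqP ->.
  by exists 0%N.
have mG n : tm (G n) by elim: n => [|n IH]; rewrite ?G0 // GS; exact: tmeasU.
have hG n : future_approx (G n).
  by elim: n => [|n IH]; rewrite ?G0 // GS; exact: future_approxU.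
have GU : \bigcup_n G n = \bigcup_n F n.
  apply/seteqP; split=> [z [n _ [k _ Fk]]|z [n _ Fn]]; first by exists k.
  by exists n => //; exists n => /=.
have ndG : {homo G : m n / (m <= n)%N >-> m `<=` n}.
  by move=> m n mn z [k /= km Fk]; exists k => //=; exact: leq_trans mn.
have [n hn] := pm_bigcup_tail mu mG ndG e2.
rewrite GU in hn.
have [N [m [D [dD De]]]] := hG n _ e2.
exists N, m, D; split => //.
have mUG := tmeasD mS mUF (mG n).
apply: le_lt_trans (_ : _ <= pr (iter N Phi @^-1` (\bigcup_n F n `\` G n)) +
                             pr (mismatch N (G n) D)) _.
  apply: pmU_le.
  - exact: tmeas_iter.
  - exact: (tmeas_mismatch _ (mG n) dD).
  - exact: (tmeas_mismatch _ mUF dD).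
  - move=> z _ h; have [Gz|nGz] := pselect (G n (iter N Phi z)).
      right; apply: contra_not h => -[h1 h2]; split=> [_|_]; first exact: h1.
      by rewrite -GU; exists n.
    have [Fz|nFz] := pselect ((\bigcup_n F n) (iter N Phi z)); first by left.
    right; apply: contra_not h => -[h1 h2]; split=> [/nFz //|Dz].
    by case: nGz; exact: h2.
rewrite (pm_iter ifs muI) //.
have := pmD mu mS mUF (mG n).
rewrite (_ : _ `&` G n = G n); last by apply/setIidr; rewrite -GU; exact: bigcup_sup.
lra.
Qed.
End FutureApproximation.

Section ForwardWords.
Variables (R : realType) (q : nat) (I : finType).
Variables (V : set 'rV[R]_q) (phi : I -> 'rV[R]_q -> 'rV[R]_q).
Hypothesis ifs : conformal_IFS V phi.
Implicit Types t u : nat -> I.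

Lemma fwd_word_in t n x : closure V x -> closure V (fwd_word phi t n x).
Proof. move=> Kx; elim: n => [|n IH]; first exact Kx.
exact (ifs_maps ifs (t n) IH). Qed.

Lemma eq_fwd_word t u n x : (forall k, (k < n)%N -> t k = u k) ->
  fwd_word phi t n x = fwd_word phi u n x.
Proof.
elim: n => //= n IH tu; rewrite tu // IH // => k kn; apply: tu; exact: ltnW.
Qed.

Lemma fwd_word_contraction : exists s : R, [/\ 0 < s, s < 1 &
  forall t n x y, closure V x -> closure V y ->
    enorm (fwd_word phi t n x - fwd_word phi t n y) <= s ^+ n * enorm (x - y)].
Proof.
have [s [s0 s1 hs]] := ifs_contraction ifs; exists s; split => // t n x y Kx Ky.
elim: n => [|n IH] /=; first by rewrite expr0 mul1r.
rewrite (le_trans (hs _ _ _ (@fwd_word_in t n _ Kx) (@fwd_word_in t n _ Ky))) //.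
by rewrite exprS -mulrA ler_wpM2l // ltW.
Qed.

Lemma geometric_small (s D e : R) : 0 <= s -> s < 1 -> 0 <= D -> 0 < e ->
  exists n, forall m, (n <= m)%N -> s ^+ m * D < e.
Proof.
move=> s0 s1 D0 e0.
have : (fun n => D * s ^+ n) @ \oo --> D * 0.
  by apply: cvgMr; apply: cvg_expr; rewrite ger0_norm.
rewrite mulr0 => /cvgrPdist_lt/(_ e e0)[N _ hN].
exists N => m Nm; have := hN m Nm; rewrite /= sub0r normrN mulrC.
by rewrite ger0_norm // mulr_ge0 // exprn_ge0.
Qed.

Lemma fwd_word_close (e : R) : 0 < e -> exists n, forall t x y,
  closure V x -> closure V y -> enorm (fwd_word phi t n x - fwd_word phi t n y) < e.
Proof.
move=> e0; have [D D0 hD] := ifs_bounded ifs.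
have [s [s0 s1 hs]] := fwd_word_contraction.
have [n hn] := geometric_small (ltW s0) s1 (ltW D0) e0.
exists n => t x y Kx Ky; apply: le_lt_trans (hs _ _ _ _ Kx Ky) _.
apply: le_lt_trans (hn n (leqnn n)); rewrite ler_wpM2l ?hD //.
exact/exprn_ge0/ltW.
Qed.
End ForwardWords.
Arguments fwd_word_in {R q I V phi} ifs t n {x} Kx B nB : rename.

Section FutureApproximationAll.
Variables (R : realType) (q : nat) (I : finType) (i0 : I).
Variables (V : set 'rV[R]_q) (phi : I -> 'rV[R]_q -> 'rV[R]_q).
Hypothesis ifs : conformal_IFS V phi.
Local Notation X := (XT R q i0).
Local Notation M := (XM R q i0).
Local Notation S := (SxL V phi : set M).
Local Notation Phi := (@Phi_lift R q I i0 phi).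
Local Notation tm := (tmeas S).
Variable mu : probability M R.
Hypothesis muI : invariant_prob V phi mu.
Local Notation pr := (pm mu S).

Let mS : measurable S. Proof. exact: (@measurable_SxL R q I i0 V phi ifs). Qed.

(** U is replaced by the closed set [inner k] of points at distance at least [eta k] from its
    complement, which has nearly the same mass. After N steps the orbit of the reference point x0 is
    within [eta k] / 2 of the true second coordinate, so testing the neighbourhood U' at that orbit
    can err only when the second coordinate lies in U but outside [inner k]. *)
Lemma future_approx_gen n (w : {ffun 'I_n -> I}) (U : set 'rV[R]_q) : open U ->
  future_approx V phi mu [set z | prefix_word n z.1 = w /\ U z.2].
Proof.
move=> oU e e0.
pose eta k : R := k.+1%:R^-1.
have eta0 k : 0 < eta k by rewrite invr_gt0 ltr0n.
pose inner k := [set y : 'rV[R]_q | forall z, `|z - y| < eta k -> U z].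
have innerU k : inner k `<=` U by move=> y; apply; rewrite subrr normr0.
have cinner k : open (~` inner k).
  rewrite (_ : ~` inner k = \bigcup_(z in ~` U) ball z (eta k)).
    by apply: bigcup_open => z _; exact: ball_open.
  apply/seteqP; split=> y.
    move=> /existsNP[z /not_implyP[zy nU]]; exists z => //.
    by rewrite -ball_normE /=.
  move=> [z nU]; rewrite -ball_normE /= => zy h; exact: nU (h z zy).
pose F k : set M := [set z | inner k z.2].
have mF k : measurable (F k).
  have := measurableC (@measurable_snd_open R q I i0 _ (cinner k)).
  by congr measurable; rewrite -[RHS]setCK.
have mU := @measurable_snd_open R q I i0 _ oU.
have ndF : {homo F : m n / (m <= n)%N >-> m `<=` n}.
  move=> m k mk z h y yz; apply: h; apply: lt_le_trans yz _.
  by rewrite lef_pV2 ?posrE ?ltr0n // ler_nat ltnS.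
have [k hk] := pm_bigcup_tail mu (fun k => tmeasW mS (mF k)) ndF e0.
have UF : \bigcup_k F k = [set z : M | U z.2].
  apply/seteqP; split=> [z [j _ /innerU //]|z /= Uz].
  have /nbhs_ballP[r /= r0 rU] : nbhs z.2 U by exact: open_nbhs_nbhs.
  have [j _ /(_ j (leqnn j)) hj] := near_infty_natSinv_lt (PosNum r0).
  exists j => // y yz; apply: rU; rewrite -ball_normE /= distrC.
  exact: lt_trans yz hj.
rewrite UF in hk.
have [N hN] := fwd_word_close ifs (divr_gt0 (eta0 k) (@ltr0n R 2)).
have [x0 Kx0] := ifs_nonempty ifs.
pose U' := [set y : 'rV[R]_q | exists2 y', inner k y' & `|y' - y| < eta k / 2].
pose D (t : nat -> I) := (prefix_word n (iter_shift N t) == w) &&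
   `[< U' (fwd_word phi t N x0) >].
have dD : depends_on_prefix (N + n) D.
  move=> t u tu; rewrite /D (@eq_fwd_word _ _ _ _ t u); last first.
    by move=> j jN; apply: tu; exact: ltn_addr.
  congr (_ && _); congr (_ == _); apply/prefix_word_eq => j jn.
  by apply: tu; rewrite ltn_add2l.
exists N, (N + n)%N, D; split => //.
have mA : tm [set z : M | prefix_word n z.1 = w /\ U z.2].
  by apply: tmeasW => //; exact: measurable_prefix_open.
have mUD : tm ([set z : M | U z.2] `\` F k).
  by apply: tmeasD => //; apply: tmeasW.
apply: le_lt_trans (_ : _ <= pr (iter N Phi @^-1` ([set z : M | U z.2] `\` F k))) _.
  apply: le_pm.
  - exact: (tmeas_mismatch ifs _ mA dD).
  - exact: tmeas_iter.
  move=> z Sz; rewrite /mismatch /preimage /= iter_Phi /= /D => h.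
  have zx0 := hN z.1 _ _ (limit_set_sub Sz) Kx0.
  have [zw|zw] := eqVneq (prefix_word n (iter_shift N z.1)) w; last first.
    by case: h; rewrite (negbTE zw) /=; split => // -[/eqP]; rewrite (negbTE zw).
  have zx0' := le_lt_trans (norm_le_enorm _) zx0.
  have UU : U' (fwd_word phi z.1 N x0) -> U (fwd_word phi z.1 N z.2).
    move=> [y' hy' y'x]; apply: (hy').
    have -> : fwd_word phi z.1 N z.2 - y' =
      (fwd_word phi z.1 N z.2 - fwd_word phi z.1 N x0) +
      (fwd_word phi z.1 N x0 - y') by rewrite addrA subrK.
    apply: le_lt_trans (ler_normD _ _) _.
    by rewrite [X in _ + X]distrC; lra.
  have FU : F k (iter_shift N z.1, fwd_word phi z.1 N z.2) ->
      U' (fwd_word phi z.1 N x0).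
    by move=> h'; exists (fwd_word phi z.1 N z.2).
  split.
    apply: contrapT => nU; apply: h; split=> [[_ /nU //]|/andP[_ /asboolP/UU/nU //]].
  move=> /FU hU; apply: h; split=> [_|_]; first by rewrite zw eqxx; exact/asboolP.
  by split => //; exact: UU.
rewrite (pm_iter ifs muI) //.
have := pmD mu mS (tmeasW mS mU) (tmeasW mS (mF k)).
have -> : pr ([set z : M | U z.2] `&` F k) = pr (F k).
  by apply: eq_pm => z _; split=> [[]//|Fz]; split => //; exact: innerU Fz.
lra.
Qed.

Lemma future_approx_measurable (A : set M) : measurable A ->
  future_approx V phi mu A.
Proof.
move=> mA; suff [] : tm A /\ future_approx V phi mu A by [].
move: A mA; apply: (@smallest_sub _ _ _ [set A : set M | tm A /\ future_approx V phi mu A]).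
  split=> [|A [mA hA]|F mF] /=.
  - split; first exact: tmeas0.
    move=> e e0; exists 0%N, 0%N, (fun=> false); split => //.
    by rewrite (_ : mismatch _ _ _ _ = set0) ?pm0 // -subset0 => z; apply.
  - by rewrite setTD; split; [exact: tmeasC|exact: future_approxC].
  - split; first by apply: tmeas_bigcup => n; case: (mF n).
    by apply: future_approx_bigcup => // n; case: (mF n).
move=> A gA; split; first by apply: tmeasW => //; exact: sub_sigma_algebra.
case: gA => n [w [U [oU ->]]].
have := future_approx_gen w oU; congr future_approx.
by apply/seteqP; split=> z /= [/prefix_wordP].
Qed.

Lemma future_approx_tmeas (A : set M) : tm A -> future_approx V phi mu A.
Proof.
move=> mA e e0; have [N [m [D [dD De]]]] := future_approx_measurable mA e0.
exists N, m, D; split => //; apply: le_lt_trans De.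
apply: le_pm; [exact: (tmeas_mismatch ifs _ mA dD)| |].
  by apply: (tmeas_mismatch ifs _ _ dD); apply: tmeasW.
move=> z Sz; apply: contra_not => -[h1 h2]; split=> [Az|/h2 []//].
by apply: h1; split => //; exact: SxL_iter.
Qed.

(** Each level set of Y gets a predictor with error e / #|F|, and all are delayed to a common time.
    The function f picks some value whose predictor fires, [y0] if none does; a wrong value forces a
    mismatch for at least one of the predictors. *)
Lemma future_approx_fun (F : finType) (Y : M -> F) (y0 : F) (e : R) :
  tfin S Y -> 0 < e -> exists N m f, depends_on_prefix m f /\
    pr [set z | Y (iter N Phi z) != f z.1] < e.
Proof.
move=> mY e0; pose A t : set M := [set z | Y z = t].
have F0 : (0 < #|F|)%N by apply/card_gt0P; exists y0.
have e1 : 0 < e / #|F|%:R by rewrite divr_gt0 // ltr0n.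
have h t : exists p : nat * nat * ((nat -> I) -> bool),
    depends_on_prefix p.1.2 p.2 /\ pr (mismatch phi p.1.1 (A t) p.2) < e / #|F|%:R.
  by have [N [m [D hD]]] := future_approx_tmeas (mY t) e1; exists (N, m, D).
have [p hp] := choice h.
pose N := (\max_t (p t).1.1)%N.
pose m := (\max_t (N - (p t).1.1 + (p t).1.2))%N.
pose D t := (p t).2 \o iter_shift (N - (p t).1.1).
have dD t : depends_on_prefix m (D t).
  apply: (depends_on_prefix_le _ (depends_on_prefix_shift (proj1 (hp t)))).
  exact: (@leq_bigmax _ (fun t => (N - (p t).1.1 + (p t).1.2)%N)).
have DN t : pr (mismatch phi N (A t) (D t)) < e / #|F|%:R.
  have [dp] := hp t; rewrite -(pm_mismatch_shift ifs muI (N - (p t).1.1) _ (mY t) dp).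
  by rewrite subnKC //; exact: (@leq_bigmax _ (fun t => (p t).1.1)).
pose f t := odflt y0 [pick y | D y t].
have df : depends_on_prefix m f.
  by move=> t u tu; rewrite /f; congr odflt; apply: eq_pick => y; exact: dD.
exists N, m, f; split => //.
have mm t : tm (mismatch phi N (A t) (D t)) by exact: (tmeas_mismatch ifs _ (mY t) (dD t)).
apply: (@le_lt_trans _ _ (pr [set z | exists2 t, t \in index_enum F &
    mismatch phi N (A t) (D t) z])).
  apply: le_pm.
  - have mYf := tfin_pair (tfin_iter ifs N mY) (tfin_prefix_fun ifs df).
    exact: (tfin_pred (fun p => p.1 != p.2) mYf).
  - exact: (tmeas_fin (mem (index_enum F))).
  - move=> z Sz /= Yf; apply: contrapT => nB; move/eqP: Yf; apply.
    have hB t : Y (iter N Phi z) = t <-> D t z.1.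
      by apply: contrapT => h'; apply: nB; exists t => //=; exact: mem_index_enum.
    rewrite /f; case: pickP => [y /hB //|/(_ (Y (iter N Phi z)))].
    by have /hB -> := erefl (Y (iter N Phi z)).
apply: le_lt_trans (pm_union_le ifs mu _ mm) _.
apply: lt_le_trans (_ : \sum_(t : F) e / #|F|%:R <= _).
  apply: ltr_sum; last by move=> t _; exact: DN.
  by apply/hasP; exists y0; rewrite ?mem_index_enum.
rewrite sumr_const -[leLHS]mulr_natr divfK // pnatr_eq0 -lt0n //.
Qed.
End FutureApproximationAll.

(** * Entropy rate of an invariant measure *)

Section EntropyRate.
Variables (R : realType) (q : nat) (I : finType) (i0 : I).
Variables (V : set 'rV[R]_q) (phi : I -> 'rV[R]_q -> 'rV[R]_q).
Hypothesis ifs : conformal_IFS V phi.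
Local Notation M := (XM R q i0).
Local Notation S := (SxL V phi : set M).
Local Notation Phi := (@Phi_lift R q I i0 phi).
Variable mu : probability M R.
Hypothesis muI : invariant_prob V phi mu.
Local Notation pr := (pm mu S).
Local Notation H Y := (shannon (law mu S Y)).

Let mS : measurable S. Proof. exact: (@measurable_SxL R q I i0 V phi ifs). Qed.
Let PS : mu S = 1%E. Proof. exact: (invariant_full muI). Qed.

Definition itinerary (F : finType) (Y : M -> F) n (z : M) : {ffun 'I_n -> F} :=
  prefix_word n (fun k => Y (iter k Phi z)).

Lemma tfin_itinerary (F : finType) (Y : M -> F) n :
  tfin S Y -> tfin S (itinerary Y n).
Proof.
by move=> mY; apply: (tfin_ffun mS) => k; exact: (tfin_iter ifs k mY).
Qed.

Lemma itinerary_letters n (z : M) :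
  itinerary (fun z : M => z.1 0%N) n z = prefix_word n z.1.
Proof.
by apply/ffunP => k; rewrite !ffunE iter_Phi /iter_shift /= addn0.
Qed.

Lemma tfin_letter : tfin S (fun z : M => z.1 0%N).
Proof.
have df : depends_on_prefix 1 (fun t : nat -> I => t 0%N) by move=> t u; apply.
exact: (tfin_prefix_fun ifs df).
Qed.

Lemma entropy_itinerary_iter (F : finType) (Y : M -> F) N n : tfin S Y ->
  H (itinerary Y n \o iter N Phi) = H (itinerary Y n).
Proof.
move=> mY; rewrite /shannon; apply: eq_bigr => t _.
by rewrite (law_iter ifs muI) //; exact: tfin_itinerary.
Qed.

Lemma eq_entropy (F : finType) (Y Z : M -> F) : (forall z, S z -> Y z = Z z) ->
  H Y = H Z.
Proof. by move=> YZ; rewrite /shannon; apply: eq_bigr => t _; rewrite (eq_law mu t YZ). Qed.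

Lemma entropy_itinerary_subadd (F : finType) (Y : M -> F) m n : tfin S Y ->
  H (itinerary Y (m + n)) <= H (itinerary Y m) + H (itinerary Y n).
Proof.
move=> mY; rewrite -(entropy_itinerary_iter m n mY).
have mm := tfin_itinerary (n := m) mY.
have mn := tfin_iter ifs m (tfin_itinerary (n := n) mY).
apply: le_trans (entropy_pair_le PS mm mn).
rewrite (@eq_entropy _ _ ((fun p => cat_word p.1 p.2) \o
   (fun z => (itinerary Y m z, (itinerary Y n \o iter m Phi) z)))).
  by apply: entropy_comp_le; exact: tfin_pair.
move=> z _ /=; rewrite /itinerary prefix_word_cat; congr (cat_word _ (prefix_word _ _)).
by apply/funext => k; rewrite /iter_shift /= addnC iterD.
Qed.

Lemma entropy_rate_cvg (F : finType) (Y : M -> F) : tfin S Y ->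
  cvgn (fun n => H (itinerary Y n) / n%:R) /\ forall k, (0 < k)%N ->
  limn (fun n => H (itinerary Y n) / n%:R) <= H (itinerary Y k) / k%:R.
Proof.
move=> mY; apply: (@subadditive_cvg _ _ _ 0).
  by move=> m n; exact: entropy_itinerary_subadd.
by move=> n; rewrite mulr0; apply: (entropy_ge0 mS PS); exact: tfin_itinerary.
Qed.

(* Encoding each value of Y by "as predicted" or "other" costs at
   most - ln (1 - e) + r ln (#|F| / e) per symbol on top of the letters. *)
Lemma entropy_prediction (F : finType) (Y : M -> F) N m (f : (nat -> I) -> F)
    (e : R) n :
  tfin S Y -> depends_on_prefix m f -> 0 < e -> e < 1 ->
  H (itinerary Y n) <= H (itinerary (fun z : M => z.1 0%N) (n + m)) +
    n%:R * (- ln (1 - e) +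
      pr [set z | Y (iter N Phi z) != f z.1] * ln (#|F|%:R / e)).
Proof.
move=> mY df e0 e1; set r := pr _.
have F0 : (0 < #|F|)%N by apply/card_gt0P; exists (f (fun=> i0)).
have cF : 1 <= #|F|%:R :> R by rewrite ler1n.
have lF : 0 <= ln (#|F|%:R / e).
  by rewrite ln_ge0 // ler_pdivlMr // mul1r (le_trans (ltW e1)).
have le1 : 0 <= - ln (1 - e).
  by rewrite oppr_ge0 ln_le0 // lerBlDr lerDl ltW.
pose W (z : M) := prefix_word (n + m) z.1.
pose ext (t : {ffun 'I_(n + m) -> I}) := ext_word t (fun=> i0).
pose c (a b : F) : R := if a == b then 1 - e else e / #|F|%:R.
have c0 a b : 0 < c a b.
  by rewrite /c; case: ifP => _; rewrite ?subr_gt0 // divr_gt0 // ltr0n.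
have csum b : \sum_a c a b <= 1.
  rewrite (bigD1 b) //= {1}/c eqxx.
  apply: (@le_trans _ _ (1 - e + \sum_(a : F) e / #|F|%:R)).
    rewrite lerD2l [leRHS](bigD1 b) //= -[leLHS]add0r lerD //.
      by rewrite divr_ge0 // ltW.
    by apply: ler_sum => a /negbTE ab; rewrite /c ab.
  by rewrite sumr_const -[X in _ + X]mulr_natr divfK ?pnatr_eq0 -?lt0n // subrK.
(* The code first describes the n + m letters by their true law, then the n symbols given their
   predictions. The m extra letters are those that f reads beyond the last of the n positions. *)
pose g (s : {ffun 'I_n -> F}) t : R :=
  law mu S W t * \prod_k c (s k) (f (iter_shift k (ext t))).
have mW : tfin S W by exact: (tfin_prefix ifs).
have mX := tfin_iter ifs N (tfin_itinerary (n := n) mY).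
have mXW := tfin_pair mX mW.
pose J := law mu S (fun z => ((itinerary Y n \o iter N Phi) z, W z)).
rewrite -(entropy_itinerary_iter N n mY).
apply: (@le_trans _ _ _ _ _ (@entropy_pair_gibbs _ M R mu S PS _ _ _ W g mX mW _ _ _)).
- move=> s t; rewrite mulr_ge0 ?law_ge0 //.
  by apply: prodr_ge0 => k _; exact: ltW.
- rewrite exchange_big /= -(law_sum PS mW); apply: ler_sum => t _.
  rewrite -mulr_sumr ler_piMr ?law_ge0 //.
  rewrite -(bigA_distr_bigA (fun (k : 'I_n) a => c a (f (iter_shift k (ext t))))).
  apply: prodr_ile1 => k _; rewrite csum andbT; apply: sumr_ge0 => a _; exact: ltW.
- move=> z Sz h; rewrite mulf_neq0 //; last first.
    by apply/prodf_neq0 => k _; exact: lt0r_neq0.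
  apply: lt0r_neq0; apply: lt_le_trans (_ : law mu S (fun z => ((itinerary Y n \o iter N Phi) z, W z)) ((itinerary Y n \o iter N Phi) z, W z) <= _).
    by rewrite lt_neqAle eq_sym h law_ge0.
  by apply: le_pm => // x _ /= [].
have E1 : H (itinerary (fun z : M => z.1 0%N) (n + m)) =
    \sum_p J p * - ln (law mu S W p.2).
  rewrite (eq_entropy (Z := W)); last by move=> z _; exact: itinerary_letters.
  rewrite -(law_comp_sum mu snd (fun s => - ln (law mu S W s)) mXW).
  by apply: eq_bigr => s _; rewrite mulrN.
pose bad (k : 'I_n) (p : {ffun 'I_n -> F} * {ffun 'I_(n + m) -> I}) :=
  p.1 k != f (iter_shift k (ext p.2)).
have Ebad k : \sum_(p | bad k p) J p = r.
  rewrite -law_pred // /r -[RHS](pm_iter ifs muI k); last first.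
    exact: (tfin_pred (fun p => p.1 != p.2)
      (tfin_pair (tfin_iter ifs N mY) (tfin_prefix_fun ifs df))).
  apply: eq_pm => z _; rewrite /bad /= ffunE -!iterD addnC.
  have -> : f (iter_shift k (ext (W z))) = f (iter k Phi z).1; last by [].
  rewrite iter_Phi /=; apply: df => j jm; rewrite /iter_shift /ext /W.
  have kj : (k + j < n + m)%N by have := ltn_ord k; lia.
  by rewrite -[(k + j)%N]/(val (Ordinal kj)) ext_word_ord ffunE.
apply: (@le_trans _ _ (\sum_p J p * (- ln (law mu S W p.2)) +
   \sum_p \sum_(k < n) J p * (- ln (1 - e) + (bad k p)%:R * ln (#|F|%:R / e)))).
  rewrite -/J -big_split /=; apply: ler_sum => -[s t] _ /=.
  have [->|Jn0] := eqVneq (J (s, t)) 0.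
    by rewrite !mul0r add0r big1 // => k _; rewrite mul0r.
  rewrite -mulr_sumr -mulrDr ler_wpM2l ?law_ge0 //.
  have l0 : 0 < law mu S W t.
    apply: lt_le_trans (_ : J (s, t) <= _); first by rewrite lt_neqAle eq_sym Jn0 law_ge0.
    by apply: le_pm => // x _ /= [].
  rewrite /g lnM ?posrE ?prodr_gt0 // opprD lerD2l.
  rewrite ln_prodr //.
  rewrite -sumrN; apply: ler_sum => k _; rewrite /bad /c /=.
  case: eqP => /= _; first by rewrite mul0r addr0.
  by rewrite mul1r !ln_div ?posrE ?ltr0n // opprB lerDr.
rewrite E1 lerD2l exchange_big /=.
rewrite [leRHS](_ : _ = \sum_(k < n) (- ln (1 - e) + r * ln (#|F|%:R / e))); last first.
  by rewrite sumr_const card_ord mulr_natl.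
apply: ler_sum => k _.
under eq_bigr do rewrite mulrDr mulrA.
rewrite big_split /= -!mulr_suml law_sum // mul1r lerD2l ler_wpM2r // -(Ebad k).
rewrite [leRHS]big_mkcond /=; apply: ler_sum => p _.
by case: (bad k p); rewrite ?mulr1 ?mulr0.
Qed.


Local Notation letter := (fun z : M => z.1 0%N).

(** The first-letter partition generates. The excess d is split in three: e is chosen with - ln (1 -
    e) = d / 3, then the predictor so that the cost of its errors is at most d / 3, and finally n
    large enough for the last third to absorb the m extra letters. *)
Lemma entropy_rate_le_letters (F : finType) (Y : M -> F) k : tfin S Y -> (0 < k)%N ->
  limn (fun n => H (itinerary Y n) / n%:R) <= H (itinerary letter k) / k%:R.
Proof.
move=> mY k0; have [_ rate_le] := entropy_rate_cvg mY.
have y0 : F := Y (fun=> i0, 0).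
apply/ler_addgt0Pl => d d0.
pose e : R := 1 - expR (- (d / 3)).
have e1 : e < 1 by rewrite ltrBlDr ltrDl expR_gt0.
have e0 : 0 < e by rewrite subr_gt0 -expR0 ltr_expR oppr_lt0 divr_gt0.
have le : - ln (1 - e) = d / 3 by rewrite /e opprB addrCA subrr addr0 expRK opprK.
have cF : 1 <= #|F|%:R :> R by rewrite ler1n; apply/card_gt0P; exists y0.
have lF : 0 <= ln (#|F|%:R / e).
  by rewrite ln_ge0 // ler_pdivlMr // mul1r (le_trans (ltW e1)).
set L := ln (#|F|%:R / e) in lF.
have r0 : 0 < d / 3 / (L + 1) by rewrite divr_gt0 ?divr_gt0 // ltr_wpDl.
have [N [m [f [df fr]]]] := future_approx_fun ifs muI y0 mY r0.
set r := pm _ _ _ in fr.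
have rL : r * L <= d / 3.
  apply: le_trans (_ : r * (L + 1) <= _).
    by rewrite ler_wpM2l ?pm_ge0 // lerDl.
  by rewrite -ler_pdivlMr ?ltr_wpDl // ltW.
have [C HC] := subadditive_affine_bound
  (fun a b => @entropy_itinerary_subadd _ letter a b tfin_letter) k0.
set h := H (itinerary letter k) / k%:R in HC *.
(* This choice makes the remainder m h + C at most n d / 3. *)
pose n := (Num.truncn (3 * `|m%:R * h + C| / d)).+1.
have n0 : 0 < n%:R :> R by rewrite ltr0n.
apply: le_trans (rate_le n isT) _; rewrite ler_pdivrMr //.
have := entropy_prediction N n mY df e0 e1; rewrite le -/r -/L.
have := HC (n + m)%N; rewrite natrD.
have : 3 * `|m%:R * h + C| / d < n%:R.
  by rewrite -truncn_lt_nat // divr_ge0 ?mulr_ge0 // ltW.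
rewrite ltr_pdivrMr // => b1 b2 b3.
have := ler_norm (m%:R * h + C).
have : n%:R * (r * L) <= n%:R * (d / 3) by rewrite ler_pM2l.
nra.
Qed.

Lemma part_entropy_itinerary m (P : 'I_m -> set M) (Y : M -> 'I_m) :
  (forall j z, P j z <-> Y z = j) ->
  part_entropy V phi mu P = limn (fun n => H (itinerary Y n) / n%:R).
Proof.
move=> PY; rewrite /part_entropy; congr (limn _); apply/funext => n; congr (_ / _).
apply: eq_bigr => s _.
have -> : fine (mu (join_cell V phi P s)) = law mu S (itinerary Y n) s; last by [].
rewrite /law /pm; congr (fine (mu _)); apply/seteqP; split=> z /= [Sz h]; split => //.
  by apply/ffunP => k; rewrite ffunE; apply/PY.
by move=> k; apply/PY; rewrite -h ffunE.
Qed.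

Lemma entropy_le_letters k : (0 < k)%N ->
  (entropy V phi mu <= (H (itinerary letter k) / k%:R)%:E)%E.
Proof.
move=> k0; apply: ub_ereal_sup => _ [m [P [[mP dP cP] ->]]].
have [Y hY] := choice cP.
have PY j z : P j z <-> Y z = j.
  split=> [Pj|<- //]; apply: contrapT => /eqP; rewrite eq_sym => jY.
  by have := dP _ _ jY; rewrite -subset0 => /(_ z); apply.
rewrite (part_entropy_itinerary PY) lee_fin; apply: entropy_rate_le_letters => // j.
by apply: tmeas_ext (tmeasW mS (mP j)) => z _; exact: PY.
Qed.

(** The first letter defines an admissible partition once the alphabet is enumerated; relabelling
    letters through [enum_rank] and back leaves the entropies equal. *)
Lemma entropy_ge_letters :
  ((limn (fun n => H (itinerary letter n) / n%:R))%:E <= entropy V phi mu)%E.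
Proof.
pose Y (z : M) : 'I_#|I| := enum_rank (z.1 0%N).
pose P j : set M := [set z | Y z = j].
have E : limn (fun n => H (itinerary letter n) / n%:R) = part_entropy V phi mu P.
  rewrite (@part_entropy_itinerary _ _ Y) //.
  congr (limn _); apply/funext => n; congr (_ / _); apply/eqP; rewrite eq_le.
  have tY : tfin S Y by exact: (tfin_comp enum_rank tfin_letter).
  apply/andP; split.
    rewrite (@eq_entropy _ _ ((fun w : {ffun 'I_n -> 'I_#|I|} => [ffun k => enum_val (w k)]) \o itinerary Y n)).
      by apply: entropy_comp_le; exact: tfin_itinerary.
    by move=> z _; apply/ffunP => k; rewrite !ffunE enum_rankK.
  rewrite (@eq_entropy _ _ ((fun w : {ffun 'I_n -> I} => [ffun k => enum_rank (w k)]) \o itinerary letter n)).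
    by apply: entropy_comp_le; apply: tfin_itinerary; exact: tfin_letter.
  by move=> z _; apply/ffunP => k; rewrite !ffunE.
rewrite E; apply: ereal_sup_ubound; exists #|I|, P; split => //; split.
- move=> j; have := @measurable_prefix R q I i0 1 [ffun _ : 'I_1 => enum_val j].
  congr measurable; apply/seteqP; split=> z; rewrite /P /Y /=.
    by move/ffunP/(_ ord0); rewrite !ffunE /= => ->; rewrite enum_valK.
  by move=> <-; apply/ffunP => k; rewrite !ffunE enum_rankK ord1.
- move=> j j' jj'; rewrite -subset0 => z [/= h1 h2]; move/eqP: jj'; apply.
  by rewrite -h1 -h2.
- by move=> z; exists (Y z).
Qed.
End EntropyRate.

(** * Integrals compared with those of finite-valued functions *)

Section FiniteIntegral.
Variables (d : measure_display) (T : measurableType d) (R : realType).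
Variables (P : probability T R) (S : set T).
Hypotheses (mS : measurable S) (PS : P S = 1%E).

(* The integral of a non-measurable function is still a difference of suprema
   over simple functions, hence monotone. *)
Lemma integral_mono (f g : T -> \bar R) : (forall z, S z -> (f z <= g z)%E) ->
  (\int[P]_(z in S) f z <= \int[P]_(z in S) g z)%E.
Proof.
move=> fg; rewrite /integral; apply: leeB.
  apply: le_ereal_sup => _ [h /= hf <-]; exists h => //= x.
  apply: le_trans (hf x) _; rewrite !funeposE /patch; case: ifPn => // /set_mem Sx.
  by rewrite ge_max le_max fg //= le_max lexx orbT.
apply: le_ereal_sup => _ [h /= hf <-]; exists h => //= x.
apply: le_trans (hf x) _; rewrite !funenegE /patch; case: ifPn => // /set_mem Sx.
by rewrite ge_max le_max leeN2 fg //= le_max lexx orbT.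
Qed.

Lemma integral_finite_ge0 (F : finType) (Y : T -> F) (h : F -> R) : tfin S Y ->
  (forall t, 0 <= h t) ->
  (\int[P]_(z in S) (h (Y z))%:E = (\sum_t law P S Y t * h t)%:E)%E.
Proof.
move=> mY h0.
have SE : S = \big[setU/set0]_(t <- index_enum F) (S `&` [set z | Y z = t]).
  rewrite -bigcup_seq; apply/seteqP; split=> [z Sz|z [t _ []//]].
  by exists (Y z) => //=; rewrite mem_index_enum.
rewrite {1}SE ge0_integral_bigsetU.
- rewrite -sumEFin; apply: eq_bigr => t _.
  rewrite (@eq_integral _ _ _ _ _ (cst (h t)%:E)); last by move=> z /set_mem [_ /= ->].
  rewrite integral_cst; last exact: mY.
  by rewrite mulrC EFinM; congr (_ * _)%E; exact: (pmE P (mY t)).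
- exact: mY.
- exact: index_enum_uniq.
- by move=> s t _ _ [z [[_ /= <-] [_ /= <-]]].
- rewrite -SE => _ B mB; apply: (tmeas_ext (A := [set z | `[< B (h (Y z))%:E >]])).
    by move=> x _ /=; split => /asboolP.
  exact: (tfin_pred (fun t => `[< B (h t)%:E >]) mY).
- by move=> z _; rewrite lee_fin.
Qed.

Lemma integral_finite (F : finType) (Y : T -> F) (h : F -> R) : tfin S Y ->
  (\int[P]_(z in S) (h (Y z))%:E = (\sum_t law P S Y t * h t)%:E)%E.
Proof.
move=> mY; rewrite integralE.
rewrite (@eq_integral _ _ _ _ _ (fun z => (Num.max (h (Y z)) 0)%:E)); last first.
  by move=> z _; rewrite funeposE EFin_max.
rewrite [X in (_ - X)%E](@eq_integral _ _ _ _ _ (fun z => (Num.max (- h (Y z)) 0)%:E)); last first.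
  by move=> z _; rewrite funenegE EFin_max.
rewrite (integral_finite_ge0 (h := fun t => Num.max (h t) 0) mY); last first.
  by move=> t; rewrite le_max lexx orbT.
rewrite (integral_finite_ge0 (h := fun t => Num.max (- h t) 0) mY); last first.
  by move=> t; rewrite le_max lexx orbT.
rewrite -EFinB -sumrB; congr EFin; apply: eq_bigr => t _; rewrite -mulrBr.
by congr (_ * _); case: (leP (h t) 0) => h0; case: (leP (- h t) 0) => h1; lra.
Qed.

Lemma integral_le_finite (F : finType) (Y : T -> F) (h : F -> R) (g : T -> R) :
  tfin S Y -> (forall z, S z -> g z <= h (Y z)) ->
  (\int[P]_(z in S) (g z)%:E <= (\sum_t law P S Y t * h t)%:E)%E.
Proof.
move=> mY gh; rewrite -(integral_finite h mY).
by apply: integral_mono => z Sz; rewrite lee_fin gh.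
Qed.

Lemma integral_ge_finite (F : finType) (Y : T -> F) (h : F -> R) (g : T -> R) :
  tfin S Y -> (forall z, S z -> h (Y z) <= g z) ->
  ((\sum_t law P S Y t * h t)%:E <= \int[P]_(z in S) (g z)%:E)%E.
Proof.
move=> mY gh; rewrite -(integral_finite h mY).
by apply: integral_mono => z Sz; rewrite lee_fin gh.
Qed.

Lemma integral_bounded_fin_num (g : T -> R) (C : R) : (forall z, S z -> `|g z| <= C) ->
  (\int[P]_(z in S) (g z)%:E)%E \is a fin_num.
Proof.
move=> gC; have mY : tfin S (fun _ : T => tt).
  by move=> []; apply: tmeas_ext (tmeasT mS) => z _ /=; split.
have hu := @integral_le_finite _ _ (fun=> C) g mY.
have hl := @integral_ge_finite _ _ (fun=> - C) g mY.
rewrite fin_real //; apply/andP; split.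
  apply: lt_le_trans (hl _); first exact: ltNyr.
  by move=> z /gC; rewrite ler_norml => /andP[].
apply: le_lt_trans (hu _) _; last exact: ltry.
by move=> z /gC; rewrite ler_norml => /andP[].
Qed.
End FiniteIntegral.

(** * Independent digits on the unit interval *)

Section DigitMap.
Variables (R : realType) (J : finType) (j0 : J) (m : J -> R).
Hypotheses (m0 : forall j, 0 < m j) (m1 : \sum_j m j = 1).
Implicit Types (u : R) (s : seq J).

Let cum (k : nat) : R := \sum_(j | (enum_rank j < k)%N) m j.

Let cumS j : cum (enum_rank j).+1 = cum (enum_rank j) + m j.
Proof.
rewrite /cum (bigD1 j) //= addrC; congr (_ + _); apply: eq_bigl => i.
by rewrite ltnS ltn_neqAle andbC (inj_eq val_inj) (inj_eq enum_rank_inj).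
Qed.

Let cum_le k l : (k <= l)%N -> cum k <= cum l.
Proof.
move=> kl; rewrite /cum [leRHS](bigID (fun j : J => (enum_rank j < k)%N)) /=.
rewrite -[leLHS]addr0 lerD //; last by apply: sumr_ge0 => j _; exact: ltW.
rewrite le_eqVlt; apply/orP; left; apply/eqP; apply: eq_bigl => j.
by rewrite andb_idl // => jk; exact: leq_trans jk kl.
Qed.

(** The unit interval is cut into consecutive intervals of lengths m j; [digit] names the one
    containing u and [digit_shift] stretches it back onto the unit interval. Under Lebesgue measure
    the successive digits of this generalised expansion are independent with law m. *)
Definition digit u : J :=
  odflt j0 [pick j | cum (enum_rank j) <= u < cum (enum_rank j) + m j].

Definition digit_shift u : R := (u - cum (enum_rank (digit u))) / m (digit u).

Let digit_unique u j : cum (enum_rank j) <= u < cum (enum_rank j) + m j -> digit u = j.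
Proof.
move=> /andP[ju uj]; rewrite /digit; case: pickP => [i /andP[iu ui]|/(_ j)]; last first.
  by rewrite ju uj.
apply: enum_rank_inj; apply/val_inj; apply/eqP; rewrite eqn_leq.
rewrite -!cumS in ui uj.
apply/andP; split; rewrite leqNgt; apply/negP => /cum_le h.
  by have := le_lt_trans h (le_lt_trans iu uj); rewrite ltxx.
by have := le_lt_trans h (le_lt_trans ju ui); rewrite ltxx.
Qed.

Let digitP u : 0 <= u -> u < 1 ->
  cum (enum_rank (digit u)) <= u < cum (enum_rank (digit u)) + m (digit u).
Proof.
move=> u0 u1.
have cJ : cum #|J| = 1 by rewrite -m1 /cum; apply: eq_bigl => j; rewrite ltn_ord.
have ex : exists k, u < cum k by exists #|J|; rewrite cJ.
case: (ex_minnP ex) => -[|k] uk kmin.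
  by move: uk; rewrite /cum big_pred0_eq ltNge u0.
have kJ : (k < #|J|)%N by apply: kmin; rewrite cJ.
have ku : cum k <= u by rewrite leNgt; apply/negP => /kmin; rewrite ltnn.
pose j := enum_val (Ordinal kJ).
have jk : enum_rank j = k :> nat by rewrite /j enum_valK.
have := cumS j; rewrite jk => kS.
have h : cum (enum_rank j) <= u < cum (enum_rank j) + m j by rewrite jk ku -kS.
by rewrite (digit_unique h).
Qed.

Fixpoint cyl_start s : R :=
  if s is j :: s' then cum (enum_rank j) + m j * cyl_start s' else 0.
Definition cyl_length s : R := \prod_(j <- s) m j.

Let cyl_start_bounds s : 0 <= cyl_start s /\ cyl_start s + cyl_length s <= 1.
Proof.
elim: s => [|j s [IH0 IH1]]; first by rewrite /cyl_length big_nil add0r.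
have cj0 : 0 <= cum (enum_rank j) by apply: sumr_ge0 => i _; exact: ltW.
have cj1 : cum (enum_rank j) + m j <= 1.
  rewrite -cumS -m1 (le_trans (cum_le (ltn_ord _))) // /cum.
  by rewrite le_eqVlt (eq_bigl predT) ?eqxx // => i; rewrite ltn_ord.
have mj := m0 j.
rewrite /cyl_length big_cons -/(cyl_length s) /=; split.
  by rewrite addr_ge0 // mulr_ge0 // ltW.
have : m j * (cyl_start s + cyl_length s) <= m j * 1 by rewrite ler_pM2l.
rewrite mulrDr mulr1; lra.
Qed.

Lemma digits_cyl s u : 0 <= u < 1 ->
  (forall k, (k < size s)%N -> digit (iter k digit_shift u) = nth j0 s k) <->
  cyl_start s <= u < cyl_start s + cyl_length s.
Proof.
elim: s u => [|j s IH] u u01.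
  by rewrite /cyl_length big_nil add0r /= u01.
have /andP[u0 u1] := u01.
have du := digitP u0 u1; have mj := m0 j; have [s0 s1] := cyl_start_bounds s.
have sh01 : 0 <= digit_shift u < 1.
  have md := m0 (digit u); move: du; rewrite /digit_shift => /andP[d1 d2].
  by rewrite divr_ge0 ?subr_ge0 ?(ltW md) // ltr_pdivrMr // mul1r ltrBlDl.
rewrite /cyl_length big_cons -/(cyl_length s) /=.
have E : digit u = j -> (cyl_start s <= digit_shift u < cyl_start s + cyl_length s) =
   (cum (enum_rank j) + m j * cyl_start s <= u <
     cum (enum_rank j) + m j * cyl_start s + m j * cyl_length s).
  move=> uj; rewrite /digit_shift uj ler_pdivlMr // ltr_pdivrMr //.
  rewrite lerBrDl ltrBlDl -addrA -mulrDr [_ * m j]mulrC.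
  by rewrite [(_ + _) * m j]mulrC.
split=> [h|h].
  have uj : digit u = j by exact: (h 0%N isT).
  rewrite -E //; apply/(IH _ sh01) => k ks; rewrite -iterSr; exact: (h k.+1).
have uj : digit u = j.
  apply: digit_unique; move: h => /andP[h1 h2].
  rewrite (le_trans _ h1) ?lerDl ?mulr_ge0 ?(ltW mj) //= (lt_le_trans h2) //.
  by rewrite -addrA -mulrDr lerD2l ler_piMr // ltW.
rewrite -E // in h; have hk := proj2 (IH _ sh01) h.
by move=> [|k] //= ks; rewrite -iterS iterSr; exact: hk.
Qed.

Lemma cyl_interval s : 0 <= cyl_start s /\ cyl_start s + cyl_length s <= 1.
Proof. exact: cyl_start_bounds. Qed.

End DigitMap.

Section IIDProcess.
Variables (R : realType) (J : finType) (j0 : J) (m : J -> R).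
Hypotheses (m0 : forall j, 0 < m j) (m1 : \sum_j m j = 1).

Definition unit_prob : probability (measurableTypeR R) R := uniform_prob (@ltr01 R).

(** Off the unit interval, a null set for [unit_prob], the digits are set to j0 so that the process
    is measurable on the whole line. *)
Definition iid (k : nat) (u : measurableTypeR R) : J :=
  if (0 <= u < 1) then digit j0 m (iter k (digit_shift j0 m) u) else j0.

Lemma unit_prob_itv (a b : R) : 0 <= a -> a <= b -> b <= 1 ->
  unit_prob `[a, b[%classic = (b - a)%:E.
Proof.
move=> a0 ab b1; rewrite /unit_prob /= /uniform_prob.
rewrite (@eq_integral _ _ _ _ _ (cst 1%E)); last first.
  move=> x /set_mem; rewrite /= in_itv /= => /andP[ax xb].
  rewrite /uniform_pdf (_ : 0 <= x <= 1); first by rewrite subr0 invr1.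
  by rewrite (le_trans a0 ax) (le_trans (ltW xb) b1).
rewrite integral_cst // mul1e; have := @lebesgue_measure_itv R `[a, b[.
rewrite /= => ->; rewrite lte_fin.
move: ab; rewrite le_eqVlt => /orP[/eqP ->|->]; last by rewrite EFinB.
by rewrite ltxx subrr.
Qed.

Let S01 : set (measurableTypeR R) := `[0, 1[%classic.

Let mS01 : measurable S01. Proof. exact: measurable_itv. Qed.

Let start n (w : {ffun 'I_n -> J}) := cyl_start m (codom w).

Let cyl_lengthE n (w : {ffun 'I_n -> J}) : cyl_length m (codom w) = \prod_k m (w k).
Proof. by rewrite /cyl_length codomE big_map big_enum. Qed.

Let prefix_iid n (w : {ffun 'I_n -> J}) :
  [set u | prefix_word n (iid ^~ u) = w] `&` S01 =
  `[start w, start w + \prod_k m (w k)[%classic.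
Proof.
have [s0 s1] := cyl_interval m0 m1 (codom w).
have nthw (k : 'I_n) : nth j0 (codom w) k = w k.
  rewrite codomE (nth_map k) ?size_enum_ord // ; congr (w _); apply/val_inj.
  by rewrite /= nth_enum_ord.
have sz : size (codom w) = n by rewrite size_codom card_ord.
apply/seteqP; split=> u /=; rewrite !in_itv /= -cyl_lengthE.
  move=> [/prefix_wordP uw]; rewrite /S01 /= in_itv /= => u01; apply/(digits_cyl j0 m0 m1 _ u01) => k.
  rewrite sz => kn; have := uw (Ordinal kn); rewrite /iid u01 /= => ->.
  by rewrite -nthw.
move=> uI; have u01 : 0 <= u < 1.
  case/andP: uI => h1 h2; rewrite (le_trans s0 h1) (lt_le_trans h2 s1) //.
split=> //; apply/prefix_wordP => k; rewrite /iid u01.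
have := proj2 (digits_cyl j0 m0 m1 (codom w) u01) uI.
by rewrite sz => -> //; rewrite nthw.
Qed.

Lemma tfin_prefix_iid n :
  tfin (setT : set (measurableTypeR R)) (fun u => prefix_word n (iid ^~ u)).
Proof.
move=> w; rewrite /tmeas setTI -[X in measurable X](setUIDK _ S01) prefix_iid.
apply: measurableU; first exact: measurable_itv.
have out k u : ~ S01 u -> iid k u = j0.
  by rewrite /S01 /= in_itv /= /iid => /negP/negbTE ->.
have [h|h] := eqVneq (prefix_word n (fun=> j0)) w.
  rewrite (_ : _ `\` _ = ~` S01); first exact: measurableC.
  apply/seteqP; split=> u /= => [[]//|nu]; split => //.
  by rewrite -h; apply/prefix_word_eq => k _; rewrite out.
rewrite (_ : _ `\` _ = set0) // -subset0 => u [/= uw nu].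
move/eqP: h; apply; rewrite -uw; apply/prefix_word_eq => k _; rewrite out //.
Qed.

Lemma law_prefix_iid n (w : {ffun 'I_n -> J}) :
  law unit_prob (setT : set (measurableTypeR R)) (fun u => prefix_word n (iid ^~ u)) w =
  \prod_k m (w k).
Proof.
have [s0 s1] := cyl_interval m0 m1 (codom w).
have pr0 : 0 <= \prod_k m (w k) by apply: prodr_ge0 => k _; exact: ltW.
rewrite cyl_lengthE in s1.
have mA := tfin_prefix_iid w.
have mT : measurable (setT : set (measurableTypeR R)) by [].
have mS' := tmeasW mT mS01.
have PT : unit_prob setT = 1%E by exact: probability_setT.
have PS : pm unit_prob (setT : set (measurableTypeR R)) S01 = 1.
  transitivity (fine (unit_prob S01)); first by rewrite /pm setTI.
  by rewrite unit_prob_itv // subr0.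
rewrite /law (pmD unit_prob mT mA mS').
have -> : pm unit_prob setT ([set z | prefix_word n (iid^~ z) = w] `\` S01) = 0.
  apply/eqP; rewrite eq_le pm_ge0 andbT.
  have C0 : pm unit_prob setT (~` S01) = 0 by rewrite (pmC mT PT mS') PS subrr.
  apply: le_trans (_ : _ <= pm unit_prob setT (~` S01)) _; last by rewrite C0.
  apply: le_pm; [exact: tmeasD|exact: tmeasC|by move=> u _ []].
rewrite add0r; transitivity (fine (unit_prob `[start w, start w + \prod_k m (w k)[%classic)).
  by rewrite /pm setTI prefix_iid.
by rewrite unit_prob_itv //= ?lerDl // addrAC subrr add0r.
Qed.

Lemma iid_cylinder n (A : 'I_n -> pred J) :
  pm unit_prob setT [set u | forall i : 'I_n, A i (iid i u)] =
  \prod_i \sum_(j | A i j) m j.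
Proof.
rewrite bigA_distr_big_dep /=.
under eq_bigr do rewrite -law_prefix_iid.
rewrite -(law_pred _ _ (@tfin_prefix_iid n)); apply: eq_pm => u _ /=.
split=> [h|/familyP h i]; last by have := h i; rewrite ffunE.
by apply/familyP => i; rewrite ffunE; exact: h.
Qed.

Lemma tfin_iid k : tfin (setT : set (measurableTypeR R)) (iid k).
Proof.
have := tfin_comp (fun w : {ffun 'I_k.+1 -> J} => w ord_max) (@tfin_prefix_iid k.+1).
by move=> h t; apply: tmeas_ext (h t) => u _ /=; rewrite ffunE.
Qed.

(** By injectivity each digit is subject to at most one constraint, and the unconstrained digits
    contribute the total mass 1. The case of a rearrangement of the blocks is what makes the block
    measures invariant. *)
Lemma law_iid_reindex (tau : nat -> nat) n (w : {ffun 'I_n -> J}) : injective tau ->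
  law unit_prob setT (fun u => prefix_word n (fun k => iid (tau k) u)) w =
  \prod_k m (w k).
Proof.
move=> tau_inj; pose N := (\max_(k < n) tau k).+1.
have tauN (k : 'I_n) : (tau k < N)%N.
  by rewrite ltnS; exact: (@leq_bigmax _ (fun k : 'I_n => tau k)).
pose A (i : 'I_N) j := [forall k : 'I_n, (tau k == i) ==> (j == w k)].
transitivity (pm unit_prob setT [set u | forall i : 'I_N, A i (iid i u)]).
  apply: eq_pm => u _ /=; split=> [wE i|h].
    by apply/forallP => k; apply/implyP => /eqP tk; rewrite -wE ffunE -tk.
  apply/ffunP => k; rewrite ffunE.
  by have /forallP/(_ k) := h (Ordinal (tauN k)); rewrite eqxx /= => /eqP.
rewrite iid_cylinder (partition_big (fun k => Ordinal (tauN k)) predT) //=.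
apply: eq_bigr => i _; rewrite /A; case: (pickP (fun k : 'I_n => tau k == i)) => [k /eqP tk|none].
  rewrite (big_pred1 k) => [|l]; last by rewrite -val_eqE /= -tk (inj_eq tau_inj).
  rewrite (big_pred1 (w k)) // => j; apply/forallP/eqP => [/(_ k)|-> l].
    by rewrite tk eqxx => /eqP.
  by apply/implyP; rewrite -tk => /eqP/tau_inj/val_inj ->.
rewrite [RHS]big_pred0 => [|k]; last by rewrite -val_eqE /= none.
by rewrite (eq_bigl predT) // => j; apply/forallP => k; rewrite none.
Qed.
End IIDProcess.

(** * Averages of image measures *)

Section AveragePushforward.
Variables (d d' : measure_display) (T1 : measurableType d) (T2 : measurableType d').
Variables (R : realType) (P : probability T1 R) (f : nat -> T1 -> T2) (p : nat).
Hypothesis mf : forall k, measurable_fun setT (f k).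

Definition push_at k : measure T2 R :=
  @measure_function_pushforward__canonical__measure_function_Measure
    _ _ _ _ _ P (f k) (mf k).

Definition inv_size : {nonneg R} := p.+1%:R^-1%:nng.

Definition average_push : set T2 -> \bar R := mscale inv_size (msum push_at p.+1).

HB.instance Definition _ := Measure.on average_push.

Lemma average_pushE (A : set T2) : measurable A ->
  average_push A = (p.+1%:R^-1 * \sum_(k < p.+1) pm P setT (f k @^-1` A))%:E.
Proof.
move=> mA; rewrite /average_push /mscale /= /msum EFinM; congr (_ * _)%E.
rewrite -sumEFin; apply: eq_bigr => k _.
rewrite -[LHS]/(P (f k @^-1` A)) -[in LHS](setTI (f k @^-1` A)) pmE //.
exact: mf.
Qed.

Let average_push_setT : average_push setT = 1%E.
Proof.
rewrite average_pushE //; congr EFin.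
rewrite (eq_bigr (fun=> 1)) => [|k _]; last first.
  by rewrite preimage_setT pmT //; exact: probability_setT.
by rewrite sumr_const card_ord mulVf ?pnatr_eq0.
Qed.

HB.instance Definition _ := Measure_isProbability.Build _ _ _ average_push average_push_setT.

Definition average_prob : probability T2 R := average_push.
End AveragePushforward.

(** * Equality of laws for points built from a process of letters *)

Section EqualLaws.
Variables (R : realType) (q : nat) (I : finType) (i0 : I).
Variables (V : set 'rV[R]_q) (phi : I -> 'rV[R]_q -> 'rV[R]_q).
Hypothesis ifs : conformal_IFS V phi.
Variables (J : finType) (d : measure_display) (T : measurableType d) (P : probability T R).
Local Notation M := (XM R q i0).
Local Notation S := (SxL V phi : set M).
Variable p : nat.
Variables (future past : (nat -> J) -> nat -> I) (bound : nat -> nat).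
Hypothesis future_dep : forall n,
  depends_on_prefix (bound n) (fun s => prefix_word n (future s)).
Hypothesis past_dep : forall n,
  depends_on_prefix (bound n) (fun s => prefix_word n (past s)).

(* A process of letters of J is turned into a point of Sigma x Lambda whose
   second coordinate is the projection of the word read into the past. *)
Definition two_sided (s : nat -> J) : M := (future s, ifs_proj V phi (past s)).

Lemma two_sided_SxL s : S (two_sided s).
Proof. exact: (ifs_proj_in ifs). Qed.

(** Cylinder images shrink to the projection, so an open condition on a projected point is an
    increasing union of conditions on finitely many letters. Measurability and equality of laws both
    reduce to finite prefixes in this way. *)
Lemma ifs_proj_openP (U : set 'rV[R]_q) t : open U ->
  U (ifs_proj V phi t) <-> exists k, cyl_image V phi t k `<=` U.
Proof.
move=> oU; split=> [Up|[k kU]]; last exact: kU (ifs_projP ifs t k).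
have [e e0 eU] := open_enorm_ball oU Up.
have [D D0 hD] := ifs_bounded ifs.
have [s [s0 s1 hs]] := comp_word_contraction ifs.
have [n hn] := geometric_small (ltW s0) s1 (ltW D0) e0.
exists n => _ [x Kx <-]; apply: eU; have [y Ky <-] := ifs_projP ifs t n.
apply: le_lt_trans (hs _ _ _ _ Kx Ky) _; apply: le_lt_trans (hn n (leqnn n)).
by apply: ler_wpM2l; [exact/exprn_ge0/ltW|exact: hD].
Qed.

Definition tfin_process (xi : nat -> T -> J) :=
  forall n, tfin setT (fun u => prefix_word n (xi ^~ u)).

Lemma measurable_prefix_event (xi : nat -> T -> J) n (D : set (nat -> J)) :
  tfin_process xi -> depends_on_prefix n D -> measurable [set u | D (xi ^~ u)].
Proof.
move=> mxi dD; pose e u := prefix_word n (xi ^~ u).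
pose B (w : {ffun 'I_n -> J}) := `[< exists2 s, D s & prefix_word n s = w >].
have := tfin_pred B (mxi n); rewrite /tmeas setTI; congr measurable.
apply/seteqP; split=> u /=; last by move=> Du; apply/asboolP; exists (xi^~ u).
by move=> /asboolP[s Ds /prefix_word_eq sx]; rewrite -(dD s).
Qed.

Lemma prefix_event_eq (xi xi' : nat -> T -> J) n (D : set (nat -> J)) :
  tfin_process xi -> tfin_process xi' ->
  (forall w, law P setT (fun u => prefix_word n (xi ^~ u)) w =
             law P setT (fun u => prefix_word n (xi' ^~ u)) w) ->
  depends_on_prefix n D ->
  pm P setT [set u | D (xi ^~ u)] = pm P setT [set u | D (xi' ^~ u)].
Proof.
move=> mxi mxi' hw dD.
pose B (w : {ffun 'I_n -> J}) := `[< exists2 s, D s & prefix_word n s = w >].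
have E (x : nat -> T -> J) : tfin_process x -> pm P setT [set u | D (x ^~ u)] =
    \sum_(w | B w) law P setT (fun u => prefix_word n (x ^~ u)) w.
  move=> mx; rewrite -law_pred; last exact: mx.
  apply: eq_pm => u _ /=; split; first by move=> Du; apply/asboolP; exists (x^~ u).
  by move=> /asboolP[s Ds /prefix_word_eq sx]; rewrite -(dD s).
by rewrite !E //; apply: eq_bigr => w _.
Qed.

Let gen_event n (w : {ffun 'I_n -> I}) (U : set 'rV[R]_q) k : set (nat -> J) :=
  [set s | prefix_word n (future s) = w /\ cyl_image V phi (past s) k `<=` U].

Let gen_event_dep n w U k : depends_on_prefix (bound n + bound k) (@gen_event n w U k).
Proof.
move=> s t st; rewrite /gen_event /=; apply/propext.
have -> : prefix_word n (future s) = prefix_word n (future t).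
  by apply: future_dep => j jn; apply: st; exact: ltn_addr.
have pst : prefix_word k (past s) = prefix_word k (past t).
  by apply: past_dep => j jn; apply: st; exact: ltn_addl.
by move/prefix_word_eq : pst => /(eq_cyl_image V phi) ->.
Qed.

Let gen_eventE n (w : {ffun 'I_n -> I}) (U : set 'rV[R]_q) (xi : nat -> T -> J) :
  open U ->
  (fun u => two_sided (xi ^~ u)) @^-1` [set z : M | prefix_word n z.1 = w /\ U z.2] =
  \bigcup_k [set u | gen_event w U k (xi ^~ u)].
Proof.
move=> oU; apply/seteqP; split=> u /=.
  by move=> [uw /(ifs_proj_openP _ oU)[k kU]]; exists k.
move=> [k _ [uw kU]]; split => //; apply/(ifs_proj_openP _ oU); by exists k.
Qed.

Lemma measurable_two_sided (xi : nat -> T -> J) : tfin_process xi ->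
  measurable_fun setT (fun u => two_sided (xi ^~ u)).
Proof.
move=> mxi _ A mA; rewrite setTI; move: A mA.
apply: (@smallest_sub _ _ _ [set A : set M | measurable ((fun u => two_sided (xi ^~ u)) @^-1` A)]).
  split=> [|A mA|F mF] /=.
  - by rewrite preimage_set0.
  - by rewrite setTD preimage_setC; exact: measurableC.
  - by rewrite preimage_bigcup; exact: bigcupT_measurable.
move=> _ [n [w [U [oU ->]]]].
have -> : [set z : XT R q i0 | (forall k : 'I_n, z.1 k = w k) /\ U z.2] =
    [set z | prefix_word n z.1 = w /\ U z.2].
  by apply/seteqP; split=> z /= [/prefix_wordP].
rewrite /= gen_eventE //; apply: bigcupT_measurable => k.
exact: (measurable_prefix_event mxi (@gen_event_dep n w U k)).
Qed.

Lemma setI_closed_gens : setI_closed (@gens R q I i0).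
Proof.
suff H n (w : {ffun 'I_n -> I}) U n' (w' : {ffun 'I_n' -> I}) U' : (n <= n')%N ->
    open U -> open U' -> gens (i0 := i0) ([set z : XT R q i0 | (forall k : 'I_n, z.1 k = w k) /\ U z.2] `&`
      [set z : XT R q i0 | (forall k : 'I_n', z.1 k = w' k) /\ U' z.2]).
  move=> _ _ [n [w [U [oU ->]]]] [n' [w' [U' [oU' ->]]]].
  case: (leqP n n') => [h|/ltnW h]; first exact: H.
  by rewrite setIC; exact: H.
move=> nn' oU oU'.
have [hw|hw] := pselect (forall k : 'I_n, w k = w' (widen_ord nn' k)).
  exists n', w', (U `&` U'); split; first exact: openI.
  apply/seteqP; split=> z /= [].
    by move=> [_ Uz] [zw Uz'].
  move=> zw [Uz Uz']; split; split=> // k.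
  by rewrite hw -zw.
exists n', w', set0; split; first exact: open0.
apply/seteqP; split=> z /=; last by case.
by move=> [[h1 _] [h2 _]]; case: hw => k; rewrite -h1 -h2.
Qed.

(** The generators are stable under intersection, so it suffices to compare the laws there. A
    generator pulls back to an increasing union of prefix events, on which both processes agree. *)
Lemma two_sided_law (xi xi' : nat -> T -> J) (A : set M) :
  tfin_process xi -> tfin_process xi' ->
  (forall n w, law P setT (fun u => prefix_word n (xi ^~ u)) w =
             law P setT (fun u => prefix_word n (xi' ^~ u)) w) ->
  measurable A ->
  P ((fun u => two_sided (xi ^~ u)) @^-1` A) =
  P ((fun u => two_sided (xi' ^~ u)) @^-1` A).
Proof.
move=> mxi mxi' hl mA.
pose nu (x : nat -> T -> J) (mx : tfin_process x) : measure M R :=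
  @measure_function_pushforward__canonical__measure_function_Measure
    _ _ _ _ _ P _ (measurable_two_sided mx).
suff : nu _ mxi A = nu _ mxi' A by [].
apply: (@measure_unique _ R M (@gens R q I i0 : set (set M)) (fun=> setT)) => //.
- exact: setI_closed_gens.
- move=> _; exists 0%N, [ffun=> i0], setT; split; first exact: openT.
  by apply/seteqP; split=> z //= _; split => // -[].
- by rewrite bigcup_const.
- move=> _ [n [w [U [oU ->]]]].
  have -> : [set z : XT R q i0 | (forall k : 'I_n, z.1 k = w k) /\ U z.2] =
      [set z | prefix_word n z.1 = w /\ U z.2].
    by apply/seteqP; split=> z /= [/prefix_wordP].
  rewrite /= /pushforward !gen_eventE //.
  have mE (x : nat -> T -> J) k : tfin_process x ->
      tmeas setT [set u | gen_event w U k (x ^~ u)].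
    move=> mx; rewrite /tmeas setTI.
    exact: (measurable_prefix_event mx (@gen_event_dep n w U k)).
  have nd (x : nat -> T -> J) : {homo (fun k => [set u | gen_event w U k (x ^~ u)]) :
      j k / (j <= k)%N >-> j `<=` k}.
    move=> j k jk u [uw h]; split => //.
    by move=> y cy; apply: h; exact (@cyl_image_le _ _ _ _ _ ifs (past (x^~ u)) j k jk y cy).
  have mU (x : nat -> T -> J) : tfin_process x ->
      tmeas setT (\bigcup_k [set u | gen_event w U k (x ^~ u)]).
    by move=> mx; apply: tmeas_bigcup => k; exact: mE.
  have H (x y : nat -> T -> J) (mx : tfin_process x) (my : tfin_process y) :
      (forall n w, law P setT (fun u => prefix_word n (x ^~ u)) w =
             law P setT (fun u => prefix_word n (y ^~ u)) w) ->
      pm P setT (\bigcup_k [set u | gen_event w U k (x ^~ u)]) <=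
      pm P setT (\bigcup_k [set u | gen_event w U k (y ^~ u)]).
    move=> xy; apply/ler_addgt0Pl => e e0.
    have [N hN] := pm_bigcup_tail P (fun k => mE x k mx) (nd x) e0.
    rewrite (prefix_event_eq mx my (xy _) (@gen_event_dep n w U N)) in hN.
    have : pm P setT [set u | gen_event w U N (y ^~ u)] <=
        pm P setT (\bigcup_k [set u | gen_event w U k (y ^~ u)]).
      by apply: le_pm; [exact: mE|exact: mU|move=> u _ ?; exists N].
    lra.
  have := pmE P (mU _ mxi); have := pmE P (mU _ mxi'); rewrite !setTI => -> ->.
  by congr EFin; apply/eqP; rewrite eq_le !H.
- by move=> _; rewrite /= /pushforward preimage_setT probability_setT ltry.
Qed.
End EqualLaws.

(** * Hoelder potentials *)

Section HolderPotential.
Variables (R : realType) (q : nat) (I : finType) (i0 : I).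
Variables (V : set 'rV[R]_q) (phi : I -> 'rV[R]_q -> 'rV[R]_q).
Hypothesis ifs : conformal_IFS V phi.
Local Notation X := (XT R q i0).
Local Notation M := (XM R q i0).
Local Notation S := (SxL V phi : set M).
Local Notation Phi := (@Phi_lift R q I i0 phi).
Variable psi : X -> R.
Hypothesis hpsi : holder_cont V phi psi.

Lemma holder_modulus : exists C a : R, [/\ 0 <= C, 0 < a &
  forall (z z' : X) n (r : R), S z -> S z' -> prefix_word n z.1 = prefix_word n z'.1 ->
  (2^-1) ^+ n <= r -> enorm (z.2 - z'.2) <= r -> `|psi z - psi z'| <= C * powR r a].
Proof.
have [C [a [a0 H]]] := hpsi; exists `|C|, a; split => //.
move=> [w x] [w' y] n r Lx Ly /prefix_word_eq ww nr xyr.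
apply: le_trans (H _ _ _ _ n Lx Ly ww) _.
have r0 : 0 <= r by apply: le_trans nr; rewrite exprn_ge0 // invr_ge0.
apply: le_trans (ler_wpM2r (powR_ge0 _ _) (ler_norm C)) _.
apply: ler_wpM2l => //; apply: ge0_ler_powR.
- exact: ltW.
- by rewrite nnegrE le_max exprn_ge0 ?invr_ge0.
- by rewrite nnegrE.
- by rewrite ge_max nr.
Qed.

Lemma psi_bounded : exists B : R, forall z, S z -> `|psi z| <= B.
Proof.
have [C [a [C0 a0 H]]] := holder_modulus.
have [D D0 hD] := ifs_bounded ifs.
have [x0 Kx0] := ifs_nonempty ifs.
pose z0 : X := (fun=> i0, ifs_proj V phi (fun=> i0)).
have Sz0 : S z0 by exact: (ifs_proj_in ifs).
exists (`|psi z0| + C * powR (Num.max 1 D) a) => z Sz.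
have : `|psi z - psi z0| <= C * powR (Num.max 1 D) a.
  apply: (H z z0 0%N) => //; first by apply/ffunP => -[].
    by rewrite expr0 le_max lexx.
  rewrite le_max hD ?orbT //; [exact: (limit_set_sub Sz)|exact: (limit_set_sub Sz0)].
have := ler_normD (psi z - psi z0) (psi z0); rewrite subrK; lra.
Qed.

(** For each word w, [U n w] is the largest open set whose product with the cylinder of w lies, on
    S, in the sublevel set. Hoelder continuity supplies around each point of the sublevel set a
    cylinder and a ball, so countably many such products fill it up on S. *)
Lemma tmeas_psi_lt (c : R) : tmeas S [set z : M | psi z < c].
Proof.
have [C [a [C0 a0 H]]] := holder_modulus.
pose U n (w : {ffun 'I_n -> I}) : set 'rV[R]_q :=
  \bigcup_(G in [set G : set 'rV[R]_q | open G /\ forall z : X,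
     S z -> prefix_word n z.1 = w -> G z.2 -> psi z < c]) G.
have oU n w : open (@U n w) by apply: bigcup_open => G [].
have mU : tmeas S (\bigcup_n [set z : M | exists2 w : {ffun 'I_n -> I}, xpredT w &
    [set z : M | prefix_word n z.1 = w /\ U n w z.2] z]).
  apply: tmeas_bigcup => n; apply: tmeas_fin => w; apply: tmeasW.
    exact: (@measurable_SxL R q I i0 V phi ifs).
  exact: measurable_prefix_open.
apply: tmeas_ext mU => z Sz; split.
  by move=> [n _ [w _ [zw [G [oG hG] Gz]]]]; exact: (hG z).
move=> /= zc; pose e := c - psi z.
have e0 : 0 < e by rewrite subr_gt0.
have [r r0 hr] : exists2 r : R, 0 < r & C * powR r a < e.
  have q0 : 0 < e / (C + 1) by rewrite divr_gt0 // ltr_wpDl.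
  exists (powR (e / (C + 1)) a^-1); first by rewrite powR_gt0.
  rewrite -powRrM mulVf ?lt0r_neq0 // powRr1; last exact: ltW.
  rewrite mulrA ltr_pdivrMr ?ltr_wpDl //; clearbody e; nra.
have half0 : 0 <= 2^-1 :> R by lra.
have half1 : 2^-1 < 1 :> R by lra.
have [n hn] := geometric_small half0 half1 ler01 r0.
pose G : set 'rV[R]_q := [set y | enorm (z.2 - y) < r].
have oG : open G.
  have -> : G = (fun y => enorm (z.2 - y)) @^-1` [set s | s < r] by [].
  apply: open_comp; last exact: open_lt.
  move=> y _; apply: continuous_comp; last exact: enorm_continuous.
  by apply: continuousB; [exact: cst_continuous|exact: cvg_id].
exists n => //; exists (prefix_word n z.1) => //; split => //.
exists G; last by rewrite /G /= subrr enorm0.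
split => // y Sy yz Gy.
have : `|psi y - psi z| <= C * powR r a.
  apply: (H y z n) => //; last by rewrite enormB ltW.
  by have := hn n (leqnn n); rewrite mulr1 => /ltW; apply; lra.
by rewrite ler_norml => /andP[_]; rewrite /e in hr; lra.
Qed.

Lemma psi_approx (e : R) : 0 < e -> exists (F : finType) (Y : M -> F) (h : F -> R),
  tfin S Y /\ forall z, S z -> h (Y z) <= psi z <= h (Y z) + e.
Proof.
move=> e0; have [B hB] := psi_bounded.
pose f (z : M) := (psi z + B) / e.
have f0 z : S z -> 0 <= f z.
  by move=> /hB; rewrite ler_norml => /andP[h _]; apply: divr_ge0; [lra|exact: ltW].
pose N := Num.truncn (2 * B / e).
pose Y (z : M) : 'I_N.+1 := inord (Num.truncn (f z)).
pose h (t : 'I_N.+1) : R := t%:R * e - B.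
have fN z : S z -> (Num.truncn (f z) < N.+1)%N.
  move=> Sz; rewrite ltnS; apply: le_truncn; rewrite ler_pM2r ?invr_gt0 //.
  by have := hB z Sz; rewrite ler_norml => /andP[]; lra.
exists 'I_N.+1, Y, h; split.
  have mS : measurable S by exact: (@measurable_SxL R q I i0 V phi ifs).
  move=> t; apply: tmeas_ext (tmeasD mS (tmeas_psi_lt (t.+1%:R * e - B))
                                        (tmeas_psi_lt (t%:R * e - B))) => z Sz.
  have Yt : (Y z = t) <-> Num.truncn (f z) = t.
    split=> [<-|h0]; first by rewrite inordK // fN.
    by apply/val_inj; rewrite /= inordK ?h0.
  apply: iff_trans (iff_sym Yt).
  have -> : (Num.truncn (f z) = t) <-> t%:R <= f z < t.+1%:R.
    by split=> [/eqP|h0]; [rewrite truncn_eq ?f0|apply/eqP; rewrite truncn_eq ?f0].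
  rewrite /f ler_pdivlMr // ltr_pdivrMr //=; split.
    by move=> [h1 /negP]; rewrite -leNgt => h2; apply/andP; split; lra.
  by move=> /andP[h1 h2]; split; [|apply/negP; rewrite -leNgt]; lra.
move=> z Sz; have /truncn_itv := f0 z Sz; rewrite /h /Y inordK ?fN //.
by rewrite /f ler_pdivlMr // ltr_pdivrMr // -natr1 => /andP[h1 h2]; apply/andP; split; lra.
Qed.

(** At time k the letters still agree on n - k places, and the second coordinates have been
    contracted k times. The error at time k is therefore a multiple of u^k + u^(n-k-1), where u < 1
    combines the contraction ratio with the ratio 1/2 of the metric on sequences; geometric series
    from both ends bound the sum uniformly in n. *)
Lemma birkhoff_variation : exists2 C : R, 0 <= C & forall n (z z' : X), S z -> S z' ->
  prefix_word n z.1 = prefix_word n z'.1 ->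
  `|birkhoff phi psi n z - birkhoff phi psi n z'| <= C.
Proof.
have [C [a [C0 a0 H]]] := holder_modulus.
have [D D0 hD] := ifs_bounded ifs.
have [s [s0 s1 hs]] := fwd_word_contraction ifs.
pose t := Num.max s 2^-1.
have t0 : 0 < t by rewrite lt_max s0.
have t1 : t < 1 by rewrite gt_max s1; lra.
pose u := powR t a.
have u0 : 0 < u by rewrite powR_gt0.
have u1 : u < 1.
  have <- : powR 1 a = 1 :> R by rewrite powR1.
  by rewrite /u gt0_ltr_powR // nnegrE ?ler01 // ltW.
pose E := powR (Num.max D 1) a.
have E0 : 0 <= E by exact: powR_ge0.
have geo n : \sum_(k < n) u ^+ k <= (1 - u)^-1.
  rewrite -[leRHS]mul1r ler_pdivlMr ?subr_gt0 //.
  have := subrX1 u n; rewrite mulrC => h.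
  have : 0 <= u ^+ n by rewrite exprn_ge0 // ltW.
  nra.
exists (C * E * (2 * (1 - u)^-1)).
  by rewrite !mulr_ge0 // invr_ge0 subr_ge0 ltW.
move=> n z z' Sz Sz' zz'; rewrite /birkhoff -sumrB.
apply: le_trans (ler_norm_sum _ _ _) _.
apply: (@le_trans _ _ (\sum_(k < n) C * E * (u ^+ k + u ^+ (n - k.+1)))); last first.
  rewrite -mulr_sumr ler_wpM2l ?mulr_ge0 // big_split /= mulr_natl mulr2n lerD ?geo //.
  rewrite (reindex_inj rev_ord_inj) /= (eq_bigr (fun k : 'I_n => u ^+ k)) ?geo // => k _.
  by rewrite subnSK ?subKn // ltnW.
apply: ler_sum => k _; have kn := ltn_ord k.
pose r := Num.max D 1 * Num.max (t ^+ k) (t ^+ (n - k.+1)).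
have mx1 : 1 <= Num.max D 1 by rewrite le_max lexx orbT.
have tk0 j : 0 <= t ^+ j by rewrite exprn_ge0 // ltW.
have h : `|psi (iter k Phi z) - psi (iter k Phi z')| <= C * powR r a.
  apply: (H _ _ (n - k)%N).
  - exact: SxL_iter.
  - exact: SxL_iter.
  - rewrite !iter_Phi /=; apply/prefix_word_eq => j jn.
    by move/prefix_word_eq : zz'; apply; rewrite -ltn_subRL.
  - apply: (@le_trans _ _ (t ^+ (n - k.+1))).
      apply: (@le_trans _ _ (t ^+ (n - k))).
        by apply: lerXn2r; rewrite ?nnegrE ?invr_ge0 ?(ltW t0) // le_max lexx orbT.
      by rewrite ler_wiXn2l ?(ltW t0) ?(ltW t1) // leq_sub2l.
    rewrite /r -[leLHS]mul1r ler_pM // le_max lexx orbT //.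
  - rewrite !iter_Phi /= (@eq_fwd_word _ _ _ _ z'.1 z.1); last first.
      move=> j jk; move/prefix_word_eq : zz' => -> //; exact: ltn_trans kn.
    apply: le_trans (hs _ _ _ _ (limit_set_sub Sz) (limit_set_sub Sz')) _.
    have h1 := hD _ _ (limit_set_sub Sz) (limit_set_sub Sz').
    have : s ^+ k <= t ^+ k by apply: lerXn2r; rewrite ?nnegrE ?le_max ?lexx // ltW.
    rewrite /r mulrC => h2; apply: ler_pM => //.
    + exact: enorm_ge0.
    + by rewrite exprn_ge0 // ltW.
    + by rewrite le_max h1.
    + by rewrite le_max h2.
apply: le_trans h _; rewrite -mulrA ler_wpM2l //.
rewrite /r powRM; last 2 first.
- by rewrite le_max ltW.
- by rewrite le_max tk0.
rewrite ler_wpM2l // /u.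
have pw j : powR (t ^+ j) a = powR t a ^+ j.
  by rewrite -(powR_mulrn j (ltW t0)) -powRrM mulrC powRrM powR_mulrn ?powR_ge0.
case: (leP (t ^+ k) (t ^+ (n - k.+1))) => _; rewrite pw.
  by rewrite lerDr exprn_ge0 ?powR_ge0.
by rewrite lerDl exprn_ge0 ?powR_ge0.
Qed.
End HolderPotential.

(** * Block competitors *)

Section ShannonConcavity.
Variables (R : realType) (T : finType).

(** Concavity of entropy: [ln_ratio_le] of each f k against the mean g, the differences f k - g
    adding up to zero. *)
Lemma shannon_average (p : nat) (f : 'I_p.+1 -> T -> R) :
  (forall k t, 0 <= f k t) ->
  p.+1%:R^-1 * \sum_k shannon (f k) <= shannon (fun t => p.+1%:R^-1 * \sum_k f k t).
Proof.
move=> f0; have n0 : 0 < p.+1%:R^-1 :> R by rewrite invr_gt0 ltr0n.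
rewrite /shannon exchange_big mulr_sumr; apply: ler_sum => t _.
set g := _ * \sum_k f k t; rewrite -subr_ge0.
have -> : - (g * ln g) - p.+1%:R^-1 * \sum_k - (f k t * ln (f k t)) =
    p.+1%:R^-1 * \sum_k - (f k t * ln g - f k t * ln (f k t)).
  rewrite !sumrN sumrB /g mulrN opprK [in RHS]opprB mulrBr -mulr_suml !mulrA.
  ring.
rewrite mulr_ge0 ?(ltW n0) //.
apply: le_trans (_ : 0 <= \sum_k (f k t - g)) _.
  rewrite sumrB sumr_const card_ord -[X in _ - X]mulr_natl /g mulrA divff ?pnatr_eq0 //.
  by rewrite mul1r subrr.
apply: ler_sum => k _; rewrite lerNr opprB; apply: ln_ratio_le => //.
  by rewrite mulr_ge0 ?(ltW n0) // sumr_ge0.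
move=> fk; rewrite lt0r_neq0 // mulr_gt0 // (bigD1 k) //= ltr_pwDl ?sumr_ge0 //.
by rewrite lt_neqAle eq_sym fk f0.
Qed.
End ShannonConcavity.

Section BlockCompetitor.
Variables (R : realType) (q : nat) (I : finType) (i0 : I).
Variables (V : set 'rV[R]_q) (phi : I -> 'rV[R]_q -> 'rV[R]_q).
Hypothesis ifs : conformal_IFS V phi.
Local Notation X := (XT R q i0).
Local Notation M := (XM R q i0).
Local Notation S := (SxL V phi : set M).
Local Notation Phi := (@Phi_lift R q I i0 phi).
Local Notation Om := (measurableTypeR R).
Variable p : nat.
Local Notation n := p.+1.
Local Notation J := {ffun 'I_n -> I}.

(* Even-indexed blocks form the future, odd-indexed blocks the past; the past is
   read backwards. *)
Definition block_future (s : nat -> J) : nat -> I :=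
  fun i => s (2 * (i %/ n))%N (inord (i %% n)).
Definition block_past (s : nat -> J) : nat -> I :=
  fun i => s (2 * (i %/ n)).+1 (inord (p - i %% n)).

(** The effect of n steps of the lift on the blocks. Future block 2b is replaced by block 2b + 2,
    past block 2b + 3 by block 2b + 1, and the most recent past block, number 1, becomes the
    consumed block 0. *)
Definition block_reindex (k : nat) : nat :=
  if k == 1%N then 0%N else if odd k then (k - 2)%N else (k + 2)%N.

Lemma block_reindex_inj : injective block_reindex.
Proof.
move=> j k; rewrite /block_reindex.
have oddE a : odd a -> exists b, a = (2 * b).+1.
  by move=> oa; exists a./2; rewrite -[LHS]odd_double_half oa mul2n.
have evenE a : odd a = false -> exists b, a = (2 * b)%N.
  by move=> oa; exists a./2; rewrite -[LHS]odd_double_half oa mul2n.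
case: eqP => j1; case: eqP => k1.
- by rewrite j1 k1.
- by case: ifP => [/oddE[b]|_]; lia.
- by case: ifP => [/oddE[b]|_]; lia.
- case: ifP => [/oddE[b]|/evenE[b]]; case: ifP => [/oddE[c]|/evenE[c]]; lia.
Qed.

Lemma block_reindex_even b : block_reindex (2 * b) = (2 * b.+1)%N.
Proof.
rewrite /block_reindex oddM andFb; case: eqP => // h; lia.
Qed.

Lemma block_reindex_odd b : block_reindex (2 * b.+1).+1 = (2 * b).+1.
Proof.
have -> : (2 * b.+1)%N = (2 * b).+2 by lia.
by rewrite /block_reindex !oddS negbK oddM /= subSS subSS subn0.
Qed.

Local Notation two_sided := (@two_sided R q I i0 V phi J block_future block_past).

Lemma block_future_dep k :
  depends_on_prefix (2 * k).+2 (fun s => prefix_word k (block_future s)).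
Proof.
move=> s t st; apply/prefix_word_eq => j jk; rewrite /block_future st //.
by have := leq_div j n; lia.
Qed.

Lemma block_past_dep k :
  depends_on_prefix (2 * k).+2 (fun s => prefix_word k (block_past s)).
Proof.
move=> s t st; apply/prefix_word_eq => j jk; rewrite /block_past st //.
by have := leq_div j n; lia.
Qed.

(** Applying the maps forward prepends letters to the coding of the point, the last applied letter
    coming first. This is why pasts are read backwards. *)
Lemma fwd_word_proj (w v : nat -> I) k : fwd_word phi w k (ifs_proj V phi v) =
  ifs_proj V phi (fun i => if (i < k)%N then w (k.-1 - i)%N else v (i - k)%N).
Proof.
elim: k => [|k IH].
  by congr ifs_proj; apply/funext => i; rewrite subn0.
rewrite /= IH [RHS](ifs_proj_sshift ifs) /= subn0; congr (phi _ (ifs_proj _ _ _)).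
apply/funext => i; rewrite /sshift ltnS subSS; case: ltnP => // ik.
by congr (w _); lia.
Qed.

Lemma two_sided_shift s : iter n Phi (two_sided s) = two_sided (s \o block_reindex).
Proof.
rewrite iter_Phi -[(two_sided s).1]/(block_future s).
rewrite -[(two_sided s).2]/(ifs_proj V phi (block_past s)) fwd_word_proj; congr pair.
  apply/funext => i; rewrite /iter_shift /block_future [RHS]/= block_reindex_even.
  by rewrite divnDl ?dvdnn // divnn modnDl add1n.
congr ifs_proj; apply/funext => i; rewrite /block_past /block_future.
case: ltnP => iN.
  have h : (n.-1 - i < n)%N by rewrite ltnS leq_subr.
  by rewrite [RHS]/= !divn_small // !muln0 !modn_small.
have [c ->] : exists c, i = (n + c)%N by exists (i - n)%N; rewrite subnKC.
by rewrite [RHS]/= addKn divnDl ?dvdnn // divnn modnDl add1n block_reindex_odd.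
Qed.

Variables (j0 : J) (m : J -> R).
Hypotheses (m0 : forall j, 0 < m j) (m1 : \sum_j m j = 1).

Local Notation xi := (iid j0 m).
Local Notation P := (unit_prob R).

Let mxi : tfin_process xi. Proof. by move=> k; exact: tfin_prefix_iid. Qed.

Let mxi' : tfin_process (fun k => xi (block_reindex k)).
Proof. by move=> k; apply: (tfin_ffun measurableT) => i; exact: tfin_iid. Qed.

Definition block_point (k : nat) (u : Om) : M := iter k Phi (two_sided (xi ^~ u)).

Let block_point_SxL k u : S (block_point k u).
Proof. by apply: (SxL_iter ifs); exact: two_sided_SxL. Qed.

Lemma measurable_block_point k : measurable_fun setT (block_point k).
Proof.
move=> _ A mA.
have mA' : tmeas S A by apply: tmeasW => //; exact: (@measurable_SxL R q I i0 V phi ifs).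
have := measurable_two_sided ifs block_future_dep block_past_dep mxi measurableT
  (tmeas_iter ifs k mA').
congr measurable; apply/seteqP; split=> u /= [_].
  by move=> [_ Au].
move=> Au; split => //; split => //; exact: two_sided_SxL.
Qed.

(** The law of the two-sided point is invariant under the n-th iterate of the lift; averaging it
    over the n phases makes it invariant under the lift itself. *)
Definition block_measure : probability M R := average_prob P p measurable_block_point.

Lemma pm_block_measure (A : set M) : tmeas S A ->
  pm block_measure S A = n%:R^-1 * \sum_(k < n) pm P setT (block_point k @^-1` A).
Proof.
move=> mA; rewrite /pm -[block_measure _]/(average_push _ _ _ _).
rewrite average_pushE //=; congr (_ * _); apply: eq_bigr => k _; apply: eq_pm => u _ /=.
by split=> [[]//|Au]; split.
Qed.

Lemma block_measure_invariant : invariant_prob V phi block_measure.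
Proof.
have mS : measurable S by exact: (@measurable_SxL R q I i0 V phi ifs).
split.
  have : pm block_measure S setT = 1.
    rewrite pm_block_measure; last by exact: tmeasT.
    rewrite (eq_bigr (fun=> 1)) => [|k _]; last first.
      by rewrite preimage_setT pmT //; exact: probability_setT.
    by rewrite sumr_const card_ord mulVf ?pnatr_eq0.
  move=> h; have := pmE block_measure (tmeasT mS); rewrite setIT h //.
move=> A mA; have mA' := tmeasW mS mA.
have mPA := tmeas_Phi ifs mA'.
have := pmE block_measure mA'; have := pmE block_measure mPA.
rewrite ![_ `&` SxL V phi]setIC => -> ->; congr EFin.
rewrite !pm_block_measure //; congr (_ * _).
rewrite big_ord_recr [RHS]big_ord_recl /= addrC.
(* Pushing the last phase one step further completes a block. By [two_sided_shift] the result is the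
   two-sided point of a rearranged i.i.d. process, so it has the law of phase 0 and the cyclic sum
   is unchanged. *)
have -> : pm P setT (block_point p @^-1` (Phi @^-1` A)) = pm P setT (block_point 0 @^-1` A).
  rewrite /pm !setTI; congr fine.
  have <- : P ((fun u => two_sided (fun k => xi (block_reindex k) u)) @^-1` A) =
            P (block_point 0 @^-1` A).
    apply: (two_sided_law ifs block_future_dep block_past_dep mxi' mxi _ mA) => k w.
    rewrite law_prefix_iid //; apply: law_iid_reindex => //; exact: block_reindex_inj.
  congr (P _); apply/seteqP; split=> u; rewrite /block_point /preimage /=;
    by rewrite -iterS two_sided_shift.
by congr (_ + _); apply: eq_bigr => k _; apply: eq_pm => u _.
Qed.

Lemma shannon_product L :
  shannon (fun w : {ffun 'I_L -> J} => \prod_k m (w k)) = L%:R * shannon m.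
Proof.
rewrite /shannon.
pose W (u : Om) := prefix_word L (xi ^~ u).
have mW : tfin setT W by exact: tfin_prefix_iid.
transitivity (\sum_w \sum_(k < L) law P setT W w * - ln (m (w k))).
  apply: eq_bigr => w _; rewrite /W law_prefix_iid // ln_prodr // -mulr_sumr sumrN.
  by rewrite mulrN.
rewrite exchange_big /= (eq_bigr (fun=> \sum_t - (m t * ln (m t)))); last first.
  move=> k _; rewrite -(law_comp_sum P (fun w : {ffun 'I_L -> J} => w k) (fun t => - ln (m t)) mW).
  apply: eq_bigr => t _; rewrite mulrN; congr (- (_ * _)).
  have -> : law P setT ((fun w : {ffun 'I_L -> J} => w k) \o W) t =
      law P setT (fun u => prefix_word 1 (fun j => xi (j + k) u)) [ffun=> t].
    apply: eq_pm => u _ /=; rewrite ffunE; split=> [h|/ffunP/(_ ord0)].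
      by apply/ffunP => i; rewrite !ffunE ord1.
    by rewrite !ffunE.
  rewrite (@law_iid_reindex _ _ j0 m m0 m1 (fun j => j + k)%N); last by move=> a b; lia.
  by rewrite big_ord1 ffunE.
by rewrite sumr_const card_ord mulr_natl.
Qed.

Lemma shannon_ge0 : 0 <= shannon m.
Proof.
apply: sumr_ge0 => j _; rewrite -mulrN mulr_ge0 ?(ltW (m0 _)) // oppr_ge0 ln_le0 //.
by rewrite -m1 (bigD1 j) //= lerDl sumr_ge0 // => i _; exact: ltW.
Qed.

(** By concavity each phase may be treated separately. At any phase, N letters contain at least L =
    N / n - 1 complete independent blocks (integer quotient), each of entropy [shannon m]. *)
Lemma block_measure_entropy N : (N%:R / n%:R - 2) * shannon m <=
  shannon (law block_measure S (itinerary phi (fun z : M => z.1 0%N) N)).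
Proof.
pose L := (N %/ n - 1)%N.
pose W (z : M) := prefix_word N z.1.
have mW : tfin S W by exact: (@tfin_prefix R q I i0 V phi ifs).
have mWk k : tfin setT (W \o block_point k).
  move=> w; have := measurable_block_point k measurableT (mW w).
  rewrite /tmeas; congr measurable; apply/seteqP; split=> u [_ h]; split => //.
    by case: h.
have NL : N%:R / n%:R - 2 <= L%:R :> R.
  have : (N < (L + 2) * n)%N.
    by have := ltn_ceil N (ltn0Sn p); rewrite /L; nia.
  rewrite lerBlDr -(ler_nat R) -addn1 natrD natrM natrD ler_pdivrMr ?ltr0n //; lra.
apply: (@le_trans _ _ (L%:R * shannon m)); first by rewrite ler_wpM2r ?shannon_ge0.
rewrite [leRHS](_ : _ = shannon (fun w => n%:R^-1 * \sum_(k < n) law P setT (W \o block_point k) w)); last first.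
  rewrite /shannon; apply: eq_bigr => w _.
  have -> : law block_measure S (itinerary phi (fun z : M => z.1 0%N) N) w =
      law block_measure S W w by apply: eq_law => z _; exact: itinerary_letters.
  by rewrite /law (pm_block_measure (mW w)).
apply: le_trans (shannon_average _); last by move=> k w; exact: law_ge0.
rewrite -[leLHS](mulKf (_ : n%:R != 0 :> R)) ?pnatr_eq0 // ler_pM2l ?invr_gt0 ?ltr0n //.
rewrite [leLHS](_ : _ = \sum_(k < n) L%:R * shannon m); last first.
  by rewrite sumr_const card_ord -[RHS]mulr_natl.
apply: ler_sum => k _.
rewrite -shannon_product.
have [L0|L0] := posnP L.
  rewrite shannon_product L0 mul0r; apply: (entropy_ge0 measurableT (probability_setT P)).
  exact: mWk.
(* At phase k block 0 may be truncated, so decoding starts with the next future block; the b-th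
   decoded block has index 2 (b + 1) in the process and starts at place (b + 1) n - k. *)
pose f (w : {ffun 'I_N -> I}) : {ffun 'I_L -> J} :=
  [ffun b : 'I_L => [ffun i : 'I_n => ext_word w (fun=> i0) (b.+1 * n + i - k)]].
apply: le_trans (entropy_comp_le P f (mWk k)).
rewrite le_eqVlt; apply/orP; left; apply/eqP; apply: eq_bigr => w _.
have <- : law P setT (f \o (W \o block_point k)) w = \prod_b m (w b); last by [].
rewrite -(@law_iid_reindex _ _ j0 m m0 m1 (fun b => 2 * b.+1)%N); last by move=> a b; lia.
apply: eq_law => u _; apply/ffunP => b; rewrite !ffunE; apply/ffunP => i; rewrite ffunE.
have bL := ltn_ord b; have kn := ltn_ord k; have iN := ltn_ord i.
have idx : (b.+1 * n + i - k < N)%N.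
  have bN : (b.+2 * n <= N)%N.
    by apply: leq_trans (leq_divM N n); rewrite leq_mul2r; move: bL; rewrite /L; lia.
  apply: leq_ltn_trans (leq_subr _ _) _; apply: leq_trans bN.
  by rewrite [(b.+2 * n)%N]mulSnr ltn_add2l.
rewrite -[X in ext_word _ _ X]/(val (Ordinal idx)) ext_word_ord /W /= ffunE /=.
rewrite /block_point iter_Phi /= /iter_shift /block_future.
have -> : (k + (b.+1 * n + i - k) = b.+1 * n + i)%N.
  by rewrite subnKC // (leq_trans (ltnW kn)) // (leq_trans _ (leq_addr _ _)) // leq_pmull.
rewrite divnMDl // divn_small // addn0 modnMDl modn_small //.
by congr (_ _); apply/val_inj; rewrite /= inordK.
Qed.

Section BlockPressure.
Variable psi : X -> R.
Hypothesis hpsi : holder_cont V phi psi.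
Variable s : J -> R.
Variable C : R.
Hypothesis sC : forall z : X, S z -> s (prefix_word n z.1) - C <= birkhoff phi psi n z.

(** The mean of psi over the n phases is 1 / n times the Birkhoff sum started at phase 0, whose
    first n letters are block 0, of law m. Replacing psi by a finite-valued lower approximation
    turns the integrals into finite sums. *)
Lemma block_measure_integral :
  (((\sum_w m w * s w - C) / n%:R)%:E <= integ V phi block_measure psi)%E.
Proof.
have mS : measurable S by exact: (@measurable_SxL R q I i0 V phi ifs).
have [B hB] := psi_bounded ifs hpsi.
have fi := integral_bounded_fin_num block_measure mS hB.
rewrite /integ -[leRHS](fineK fi) lee_fin; apply/ler_addgt0Pl => e e0.
have [F [Y [h [mY hY]]]] := psi_approx ifs hpsi e0.
have hY1 z : S z -> h (Y z) <= psi z by move=> /hY /andP[].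
have := integral_ge_finite block_measure mY hY1.
rewrite -[leRHS](fineK fi) lee_fin; set A := fine _ => hA.
have n0 : 0 < n%:R :> R by rewrite ltr0n.
have mYk k : tfin setT (Y \o block_point k).
  move=> t; have := measurable_block_point k measurableT (mY t).
  rewrite /tmeas; congr measurable; apply/seteqP; split=> u [_ h0]; split => //.
  by case: h0.
pose U u := (xi 0 u, [ffun k : 'I_n => Y (block_point k u)]).
have mU : tfin setT U.
  by apply: tfin_pair; [exact: tfin_iid|apply: (tfin_ffun measurableT) => k; exact: mYk].
have E1 : \sum_t law block_measure S Y t * h t =
    n%:R^-1 * \sum_p law P setT U p * \sum_k h (p.2 k).
  transitivity (n%:R^-1 * \sum_(k < n) \sum_t law P setT (Y \o block_point k) t * h t).
    rewrite exchange_big mulr_sumr; apply: eq_bigr => t _.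
    by rewrite /law (pm_block_measure (mY t)) -mulrA mulr_suml.
  congr (_ * _); under [RHS]eq_bigr do rewrite mulr_sumr.
  rewrite [RHS]exchange_big; apply: eq_bigr => k _ /=.
  rewrite -(law_comp_sum P (fun p : J * {ffun 'I_n -> F} => p.2 k) h mU).
  by apply: eq_bigr => t _; congr (_ * _); apply: eq_law => u _ /=; rewrite ffunE.
have E2 : \sum_w m w * s w = \sum_p law P setT U p * s p.1.
  rewrite -(law_comp_sum P fst s mU); apply: eq_bigr => w _; congr (_ * _).
  have tau_inj : injective (fun j : nat => j) by [].
  have := law_iid_reindex j0 m0 m1 [ffun _ : 'I_1 => w] tau_inj.
  rewrite big_ord1 ffunE => <-; apply: eq_pm => u _ /=.
  split=> [/ffunP/(_ ord0)|h0]; first by rewrite !ffunE.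
  by apply/ffunP => j; rewrite !ffunE ord1.
have lU : \sum_p law P setT U p = 1 by exact: (law_sum (probability_setT P) mU).
rewrite ler_pdivrMr // E2.
have : \sum_p law P setT U p * (s p.1 - C - n%:R * e) <=
    \sum_p law P setT U p * \sum_k h (p.2 k).
  apply: ler_sum => -[w f] _ /=.
  have [->|/law_neq0 [u _ [<- <-]]] := eqVneq (law P setT U (w, f)) 0; first by rewrite !mul0r.
  rewrite ler_wpM2l ?law_ge0 //.
  have Su := block_point_SxL 0 u.
  have := sC Su; rewrite /birkhoff.
  have -> : prefix_word n (block_point 0 u).1 = xi 0 u.
    apply/ffunP => i; rewrite ffunE /block_point /= /block_future.
    by rewrite divn_small // muln0 modn_small // inord_val.
  have : \sum_(k < n) (psi (block_point k u) - e) <= \sum_(k < n) h (Y (block_point k u)).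
    apply: ler_sum => k _; have /andP[_] := hY _ (block_point_SxL k u); lra.
  rewrite sumrB sumr_const card_ord -[e *+ _]mulr_natl => h1 h2.
  under eq_bigr do rewrite ffunE.
  by move: h1 h2; rewrite /block_point /=; lra.
under eq_bigr do rewrite !mulrBr.
rewrite !sumrB -!mulr_suml lU !mul1r => h2.
move: hA; rewrite E1 mulrC ler_pdivrMr // => hA; lra.
Qed.

Lemma block_measure_pressure :
  (((shannon m + \sum_w m w * s w - C) / n%:R)%:E <=
   entropy V phi block_measure + integ V phi block_measure psi)%E.
Proof.
have n0 : 0 < n%:R :> R by rewrite ltr0n.
rewrite -addrA mulrDl EFinD; apply: leeD; last exact: block_measure_integral.
apply: le_trans (entropy_ge_letters ifs _).
have [cv _] := entropy_rate_cvg ifs block_measure_invariant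
  (@tfin_letter R q I i0 V phi ifs).
rewrite lee_fin; apply/ler_addgt0Pl => e e0; rewrite -lerBlDl; apply: limr_ge => //.
exists (Num.truncn (2 * shannon m / e)).+1 => // N /= NN.
have N0 : 0 < N%:R :> R by rewrite ltr0n; exact: leq_trans NN.
rewrite ler_pdivlMr //; apply: le_trans (block_measure_entropy N).
have : 2 * shannon m / e < N%:R.
  by rewrite -truncn_lt_nat // divr_ge0 ?mulr_ge0 ?shannon_ge0 // ltW.
rewrite ltr_pdivrMr // => h1.
have -> : (shannon m / n%:R - e) * N%:R = N%:R / n%:R * shannon m - N%:R * e.
  by field; exact: lt0r_neq0.
by rewrite [leRHS]mulrBl lerD2l lerN2 ltW.
Qed.
End BlockPressure.
End BlockCompetitor.

(** * Equilibrium measures and Gibbs weights *)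

Section EquilibriumGibbs.
Variables (R : realType) (q : nat) (I : finType) (i0 : I).
Variables (V : set 'rV[R]_q) (phi : I -> 'rV[R]_q -> 'rV[R]_q).
Hypothesis ifs : conformal_IFS V phi.
Local Notation X := (XT R q i0).
Local Notation M := (XM R q i0).
Local Notation S := (SxL V phi : set M).
Variable psi : X -> R.
Hypothesis hpsi : holder_cont V phi psi.
Variable mu : probability M R.
Hypothesis muI : invariant_prob V phi mu.

Let mS : measurable S. Proof. exact: (@measurable_SxL R q I i0 V phi ifs). Qed.
Let PS : mu S = 1%E. Proof. exact: (invariant_full muI). Qed.

Definition word_point n (w : {ffun 'I_n -> I}) : X :=
  (ext_word w (fun=> i0), ifs_proj V phi (fun=> i0)).

Definition word_sum n (w : {ffun 'I_n -> I}) : R := birkhoff phi psi n (word_point w).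

Lemma word_point_SxL n (w : {ffun 'I_n -> I}) : S (word_point w).
Proof. exact: (ifs_proj_in ifs). Qed.

Lemma word_sum_variation : exists2 C : R, 0 <= C & forall n (z : X), S z ->
  `|birkhoff phi psi n z - word_sum (prefix_word n z.1)| <= C.
Proof.
have [C C0 hC] := birkhoff_variation ifs hpsi; exists C => // n z Sz.
apply: hC => //; first exact: word_point_SxL.
by rewrite /word_point prefix_word_ext.
Qed.

(** By invariance n times the integral of psi is the mean of the n-th Birkhoff sum. The computation
    is made for a finite-valued approximation of psi with error e / (n + 1), so that the n errors
    add up to at most e. *)
Lemma invariant_integral_le n (s : {ffun 'I_n -> I} -> R) (C : R) :
  (forall z : X, S z -> birkhoff phi psi n z <= s (prefix_word n z.1) + C) ->
  n%:R * fine (integ V phi mu psi) <=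
    \sum_w law mu S (fun z : M => prefix_word n z.1) w * s w + C.
Proof.
move=> sC; have [B hB] := psi_bounded ifs hpsi.
have fi := integral_bounded_fin_num mu mS hB.
apply/ler_addgt0Pl => e e0.
pose d := e / n.+1%:R.
have n0 : 0 < n.+1%:R :> R by rewrite ltr0n.
have d0 : 0 < d by rewrite divr_gt0.
have nd : n%:R * d <= e.
  by rewrite /d mulrA ler_pdivrMr // mulrC ler_pM2l // ler_nat.
have [F [Y [h [mY hY]]]] := psi_approx ifs hpsi d0.
have hY1 z : S z -> psi z <= h (Y z) + d by move=> /hY /andP[].
have := integral_le_finite mu mY (h := fun t => h t + d) hY1.
rewrite -[leLHS](fineK fi) lee_fin -/(integ V phi mu psi); set A := fine _ => hA.
pose W (z : M) := prefix_word n z.1.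
pose U z := (W z, itinerary phi Y n z).
have mU : tfin S U.
  by apply: tfin_pair; [exact: tfin_prefix|exact: tfin_itinerary].
have lY : \sum_t law mu S Y t = 1 by exact: (law_sum PS mY).
have lU : \sum_p law mu S U p = 1 by exact: (law_sum PS mU).
have E1 (k : 'I_n) : \sum_t law mu S Y t * h t = \sum_p law mu S U p * h (p.2 k).
  rewrite -(law_comp_sum mu (fun p : {ffun 'I_n -> I} * {ffun 'I_n -> F} => p.2 k) h mU).
  apply: eq_bigr => t _; congr (_ * _); rewrite -(law_iter ifs muI k t mY).
  by apply: eq_law => z _; rewrite /= ffunE.
have E2 : \sum_w law mu S W w * s w = \sum_p law mu S U p * s p.1.
  by rewrite -(law_comp_sum mu fst s mU).
have : \sum_p law mu S U p * \sum_k h (p.2 k) <= \sum_p law mu S U p * (s p.1 + C).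
  apply: ler_sum => -[w f] _ /=.
  have [->|/law_neq0 [z Sz [<- <-]]] := eqVneq (law mu S U (w, f)) 0; first by rewrite !mul0r.
  rewrite ler_wpM2l ?law_ge0 //; apply: le_trans (sC z Sz); rewrite /birkhoff.
  apply: ler_sum => k _; rewrite ffunE.
  by have /andP[] := hY _ (SxL_iter ifs k Sz).
under eq_bigr do rewrite mulr_sumr.
rewrite exchange_big /=; under eq_bigr do rewrite -E1.
under [leRHS]eq_bigr do rewrite mulrDr.
rewrite sumr_const card_ord -[leLHS]mulr_natl big_split /= -mulr_suml lU mul1r -E2 => h1.
have : n%:R * A <= n%:R * (\sum_t law mu S Y t * (h t + d)) by rewrite ler_wpM2l.
have -> : \sum_t law mu S Y t * (h t + d) = \sum_t law mu S Y t * h t + d.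
  under eq_bigr do rewrite mulrDr.
  by rewrite big_split /= -mulr_suml lY mul1r.
rewrite mulrDr -/W; lra.
Qed.

Definition partition_sum n : R := \sum_(w : {ffun 'I_n -> I}) expR (word_sum w).

Definition gibbs_weight n (w : {ffun 'I_n -> I}) : R :=
  expR (word_sum w) / partition_sum n.

Lemma partition_sum_gt0 n : 0 < partition_sum n.
Proof.
rewrite /partition_sum (bigD1 [ffun=> i0]) //= ltr_pwDl ?expR_gt0 //.
by apply: sumr_ge0 => w _; exact: expR_ge0.
Qed.

Lemma gibbs_weight_gt0 n (w : {ffun 'I_n -> I}) : 0 < gibbs_weight w.
Proof. by rewrite divr_gt0 ?expR_gt0 // partition_sum_gt0. Qed.

Lemma gibbs_weight_sum n : \sum_w @gibbs_weight n w = 1.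
Proof. by rewrite -mulr_suml divff // lt0r_neq0 // partition_sum_gt0. Qed.

Lemma ln_gibbs_weight n (w : {ffun 'I_n -> I}) :
  ln (gibbs_weight w) = word_sum w - ln (partition_sum n).
Proof. by rewrite ln_div ?posrE ?expR_gt0 ?partition_sum_gt0 // expRK. Qed.

(** The finite variational principle: the Gibbs weights attain the maximum ln Z_n of entropy plus
    mean energy. *)
Lemma shannon_gibbs_weight n :
  shannon (@gibbs_weight n) + \sum_w gibbs_weight w * @word_sum n w = ln (partition_sum n).
Proof.
rewrite /shannon -big_split /= -[RHS]mul1r -(gibbs_weight_sum n) mulr_suml.
by apply: eq_bigr => w _; rewrite ln_gibbs_weight; ring.
Qed.

Hypothesis equil : forall nu : probability M R, invariant_prob V phi nu ->
  (entropy V phi nu + integ V phi nu psi <= entropy V phi mu + integ V phi mu psi)%E.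

(* Independent blocks distributed by the Gibbs weights have pressure at least
   (ln (partition_sum n) - C) / n, whereas n times the pressure of mu is at most
   that of its n-letter marginal. *)
Lemma equilibrium_kl : exists C : R, forall n, (0 < n)%N ->
  \sum_w law mu S (fun z : M => prefix_word n z.1) w *
    (ln (law mu S (fun z : M => prefix_word n z.1) w) - ln (gibbs_weight w)) <= C.
Proof.
(* One C is lost in the energy of the block competitor and one in that of mu. *)
have [C C0 hC] := word_sum_variation; exists (2 * C) => -[//|p] _.
have hC1 (z : X) : S z -> word_sum (prefix_word p.+1 z.1) - C <= birkhoff phi psi p.+1 z.
  by move=> /(hC p.+1); rewrite ler_norml => /andP[]; lra.
have hC2 (z : X) : S z -> birkhoff phi psi p.+1 z <= word_sum (prefix_word p.+1 z.1) + C.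
  by move=> /(hC p.+1); rewrite ler_norml => /andP[]; lra.
pose j0 : {ffun 'I_p.+1 -> I} := [ffun=> i0].
have h1 := block_measure_pressure ifs j0 (@gibbs_weight_gt0 p.+1) (gibbs_weight_sum p.+1) hpsi hC1.
have := le_trans h1 (equil (@block_measure_invariant R q I i0 V phi ifs p j0 _ (@gibbs_weight_gt0 p.+1) (gibbs_weight_sum p.+1))).
have [B hB] := psi_bounded ifs hpsi.
have fi := integral_bounded_fin_num mu mS hB.
have h2 := entropy_le_letters ifs muI (ltn0Sn p).
move=> h3; have {h3} := le_trans h3 (leeD h2 (lexx _)).
rewrite -[integ V phi mu psi](fineK fi) -EFinD lee_fin shannon_gibbs_weight.
have n0 : 0 < p.+1%:R :> R by rewrite ltr0n.
rewrite ler_pdivrMr // mulrDl divfK ?lt0r_neq0 //.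
have := invariant_integral_le hC2.
set W := fun z : M => prefix_word p.+1 z.1.
have -> : shannon (law mu S (itinerary phi (fun z : M => z.1 0%N) p.+1)) = shannon (law mu S W).
  by apply: eq_entropy => z _; exact: itinerary_letters.
have mW : tfin S W by exact: tfin_prefix.
under [X in _ -> _ -> X <= _]eq_bigr do rewrite ln_gibbs_weight.
have -> : \sum_w law mu S W w * (ln (law mu S W w) - (word_sum w - ln (partition_sum p.+1))) =
   - shannon (law mu S W) - \sum_w law mu S W w * word_sum w + ln (partition_sum p.+1).
  rewrite -[ln (partition_sum _) in RHS]mul1r -(law_sum PS mW) mulr_suml /shannon -sumrN -sumrB.
  by rewrite -big_split /=; apply: eq_bigr => w _; ring.
rewrite [fine _ * _]mulrC; lra.
Qed.
End EquilibriumGibbs.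

(** * Zero-one law *)

Section ZeroOneLaw.
Variables (R : realType) (q : nat) (I : finType) (i0 : I).
Variables (V : set 'rV[R]_q) (phi : I -> 'rV[R]_q -> 'rV[R]_q).
Hypothesis ifs : conformal_IFS V phi.
Local Notation X := (XT R q i0).
Local Notation M := (XM R q i0).
Local Notation S := (SxL V phi : set M).
Local Notation Phi := (@Phi_lift R q I i0 phi).
Variable psi : X -> R.
Hypothesis hpsi : holder_cont V phi psi.
Variable mu : probability M R.
Hypothesis muI : invariant_prob V phi mu.
Local Notation word_sum := (@word_sum R q I i0 V phi psi).
Local Notation gibbs_weight := (@gibbs_weight R q I i0 V phi psi).
Local Notation partition_sum := (@partition_sum R q I i0 V phi psi).
Local Notation pr := (pm mu S).
Local Notation ext w := (ext_word w (fun=> i0)).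

Let mS : measurable S. Proof. exact: (@measurable_SxL R q I i0 V phi ifs). Qed.
Let PS : mu S = 1%E. Proof. exact: (invariant_full muI). Qed.

Lemma birkhoff_add a b (z : X) :
  birkhoff phi psi (a + b) z = birkhoff phi psi a z + birkhoff phi psi b (iter a Phi z).
Proof.
rewrite /birkhoff big_split_ord; congr (_ + _); apply: eq_bigr => k _ //=.
by rewrite addnC iterD.
Qed.

Section Variation.
Variable C : R.
Hypothesis hC : forall n (z : X), S z ->
  `|birkhoff phi psi n z - word_sum (prefix_word n z.1)| <= C.

Lemma word_sum_split a b (w : {ffun 'I_(a + b) -> I}) :
  `|word_sum w - (word_sum (left_word w) + word_sum (right_word w))| <= 2 * C.
Proof.
pose z := word_point i0 V phi w.
have Sz : S z by exact: (word_point_SxL i0 ifs).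
have h1 := hC a Sz; have h2 := hC b (SxL_iter ifs a Sz).
have e1 : prefix_word a z.1 = left_word w.
  by rewrite -(prefix_word_ext w (fun=> i0)) left_prefix_word.
have e2 : prefix_word b (iter a Phi z).1 = right_word w.
  by rewrite iter_Phi /= -right_prefix_word prefix_word_ext.
rewrite e1 in h1; rewrite e2 in h2.
have -> : word_sum w = birkhoff phi psi (a + b) z by [].
rewrite birkhoff_add; move: h1 h2; rewrite !ler_norml => /andP[? ?] /andP[? ?].
by apply/andP; split; lra.
Qed.

Lemma word_sum_split3 a n b (w : {ffun 'I_(a + (n + b)) -> I}) :
  `|word_sum w - (word_sum (left_word w) + (word_sum (left_word (right_word w)) +
     word_sum (right_word (right_word w))))| <= 4 * C.
Proof.
have h1 := word_sum_split w; have h2 := word_sum_split (right_word w).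
move: h1 h2; rewrite !ler_norml => /andP[? ?] /andP[? ?].
by apply/andP; split; lra.
Qed.

(** Near independence of Gibbs weights. Word sums are additive over the three pieces of a word up to
    4 C, so their exponentials factor up to e^(4 C) both from above and from below, whence e^(-8 C):
    among the words satisfying E on the first piece, D fails on the second in a proportion at least
    e^(-8 C) kappa. *)
Lemma gibbs_gap N a n b (E D : (nat -> I) -> bool) (kappa : R) :
  N = (a + (n + b))%N -> depends_on_prefix a E -> depends_on_prefix n D ->
  kappa <= \sum_(v : {ffun 'I_n -> I} | ~~ D (ext v)) gibbs_weight v ->
  expR (- (8 * C)) * kappa *
    \sum_(w : {ffun 'I_N -> I} | E (ext w)) expR (word_sum w) <=
  \sum_(w : {ffun 'I_N -> I} | E (ext w) && ~~ D (iter_shift a (ext w)))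
    expR (word_sum w).
Proof.
move=> -> dE dD hk.
have EL (w : {ffun 'I_(a + (n + b)) -> I}) : E (ext w) = E (ext (left_word w)).
  apply: dE => k ka; rewrite -[in RHS](prefix_word_ext w (fun=> i0)) left_prefix_word.
  by rewrite -[k]/(val (Ordinal ka)) ext_word_ord ffunE.
have DL (w : {ffun 'I_(a + (n + b)) -> I}) :
    D (iter_shift a (ext w)) = D (ext (left_word (right_word w))).
  apply: dD => k kn; rewrite -[in RHS](prefix_word_ext w (fun=> i0)).
  rewrite right_prefix_word left_prefix_word.
  by rewrite -[k in RHS]/(val (Ordinal kn)) ext_word_ord ffunE.
pose fE (u : {ffun 'I_a -> I}) : R := (E (ext u))%:R * expR (word_sum u).
pose fD (v : {ffun 'I_n -> I}) : R := (~~ D (ext v))%:R * expR (word_sum v).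
have fE0 u : 0 <= fE u by rewrite mulr_ge0 ?expR_ge0.
have fD0 v : 0 <= fD v by rewrite mulr_ge0 ?expR_ge0.
pose TE := \sum_u fE u; pose TD := \sum_v fD v.
have TE0 : 0 <= TE by apply: sumr_ge0.
have split3 (f : {ffun 'I_a -> I} -> R) (g : {ffun 'I_n -> I} -> R) (h : {ffun 'I_b -> I} -> R) :
   \sum_(w : {ffun 'I_(a + (n + b)) -> I}) f (left_word w) *
     (g (left_word (right_word w)) * h (right_word (right_word w))) =
   (\sum_u f u) * ((\sum_v g v) * \sum_t h t).
  rewrite (sum_word_split (fun u x => f u * (g (left_word x) * h (right_word x)))).
  rewrite mulr_suml; apply: eq_bigr => u _; rewrite -mulr_sumr; congr (_ * _).
  rewrite (sum_word_split (fun v t => g v * h t)) mulr_suml.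
  by apply: eq_bigr => v _; rewrite mulr_sumr.
have TDk : kappa * partition_sum n <= TD.
  rewrite -ler_pdivlMr ?(partition_sum_gt0 V phi psi) //; apply: le_trans hk _.
  rewrite big_mkcond /TD mulr_suml /=; apply: ler_sum => v _; rewrite /fD.
  by case: (D (ext v)); rewrite /= ?mul0r ?mul1r.
have up : \sum_(w : {ffun 'I_(a + (n + b)) -> I} | E (ext w)) expR (word_sum w) <=
    expR (4 * C) * (TE * (partition_sum n * partition_sum b)).
  rewrite -(split3 fE (fun v => expR (word_sum v)) (fun t => expR (word_sum t))).
  rewrite mulr_sumr big_mkcond /=; apply: ler_sum => w _; rewrite EL /fE.
  case: (E _); last by rewrite !mul0r mulr0.
  rewrite mul1r -!expRD ler_expR; have := word_sum_split3 w.
  by rewrite ler_norml => /andP[_]; lra.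
have lo : expR (- (4 * C)) * (TE * (TD * partition_sum b)) <=
  \sum_(w : {ffun 'I_(a + (n + b)) -> I} | E (ext w) && ~~ D (iter_shift a (ext w)))
    expR (word_sum w).
  rewrite -(split3 fE fD (fun t => expR (word_sum t))).
  rewrite mulr_sumr [leRHS]big_mkcond /=; apply: ler_sum => w _; rewrite EL DL /fE /fD.
  case: (E _); last by rewrite !mul0r mulr0.
  case: (D _); first by rewrite !mul0r !mulr0.
  rewrite !mul1r -!expRD ler_expR; have := word_sum_split3 w.
  by rewrite ler_norml => /andP[+ _]; lra.
apply: le_trans lo; have [k0|k0] := leP 0 kappa; last first.
  apply: (@le_trans _ _ 0); last first.
    by rewrite !mulr_ge0 ?expR_ge0 ?sumr_ge0 // => ? _; exact: expR_ge0.
  rewrite mulr_le0_ge0 //; last by apply: sumr_ge0 => w _; exact: expR_ge0.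
  by rewrite mulr_ge0_le0 ?expR_ge0 // ltW.
apply: le_trans (ler_wpM2l _ up) _; first by rewrite mulr_ge0 ?expR_ge0.
have -> : expR (- (8 * C)) * kappa * (expR (4 * C) * (TE * (partition_sum n * partition_sum b)))
   = expR (- (4 * C)) * (TE * (kappa * partition_sum n * partition_sum b)).
  have -> : expR (- (8 * C)) = expR (- (4 * C)) * expR (- (4 * C)) by rewrite -expRD; congr expR; ring.
  have : expR (- (4 * C)) * expR (4 * C) = 1 :> R by rewrite -expRD addNr expR0.
  move=> e1; transitivity (expR (- (4 * C)) * expR (4 * C) *
    (expR (- (4 * C)) * (TE * (kappa * partition_sum n * partition_sum b)))); first ring.
  by rewrite e1 mul1r.
rewrite ler_wpM2l ?expR_ge0 // ler_wpM2l // ler_wpM2r //.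
exact: ltW (partition_sum_gt0 V phi psi b).
Qed.

(** Each new block on which D is required removes a fixed proportion of the surviving words, by
    [gibbs_gap] with E the event that D holds on the first j blocks. All words have the full length
    K n, so that a single normalisation serves every j. *)
Lemma gibbs_repeat n (D : (nat -> I) -> bool) (kappa : R) K j :
  depends_on_prefix n D -> 0 <= kappa -> kappa <= 1 -> 0 <= C ->
  kappa <= \sum_(v : {ffun 'I_n -> I} | ~~ D (ext v)) gibbs_weight v ->
  (j <= K)%N ->
  \sum_(w : {ffun 'I_(K * n) -> I} |
     [forall b : 'I_j, D (iter_shift (b * n) (ext w))]) gibbs_weight w <=
  (1 - expR (- (8 * C)) * kappa) ^+ j.
Proof.
move=> dD k0 k1 C0 hk; set d := expR _ * kappa.
have d1 : d <= 1.
  rewrite /d -[leRHS]mulr1; apply: ler_pM => //.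
  by rewrite -[leRHS]expR0 ler_expR; lra.
elim: j => [_|j IH jK].
  by rewrite expr0 -(gibbs_weight_sum V phi psi (K * n)) le_eqVlt (eq_bigl predT) ?eqxx // => w; apply/forallP => -[].
pose E j (t : nat -> I) := [forall b : 'I_j, D (iter_shift (b * n) t)].
have dE : depends_on_prefix (j * n) (E j).
  move=> t u tu; apply: eq_forallb => b; apply: dD => k kn; apply: tu.
  have := ltn_ord b; nia.
have ES (t : nat -> I) : E j.+1 t = E j t && D (iter_shift (j * n) t).
  apply/forallP/andP => [h|[/forallP h1 h2] b].
    by split; [apply/forallP => b; exact: (h (widen_ord (leqnSn j) b))|exact: (h ord_max)].
  have [bj|bj] := ltnP b j; first exact: (h1 (Ordinal bj)).
  have -> : b = j :> nat by have := ltn_ord b; lia.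
  exact: h2.
have KE : (K * n = j * n + (n + (K - j.+1) * n))%N by nia.
have := gibbs_gap KE dE dD hk; rewrite -/d => gap.
have := IH (ltnW jK); set G := \sum_(w | _) _ => hG.
rewrite exprS; apply: (@le_trans _ _ ((1 - d) * G)); last by rewrite ler_wpM2l // subr_ge0.
rewrite (eq_bigl (fun w => E j (ext w) && D (iter_shift (j * n) (ext w)))); last by move=> w; exact: ES.
have GE : G = \sum_(w : {ffun 'I_(K * n) -> I} | E j (ext w)) gibbs_weight w by [].
have EG := GE; rewrite (bigID (fun w : {ffun 'I_(K * n) -> I} => D (iter_shift (j * n) (ext w)))) /= in EG.
have : d * G <= \sum_(w : {ffun 'I_(K * n) -> I} | E j (ext w) && ~~ D (iter_shift (j * n) (ext w))) gibbs_weight w.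
  rewrite GE /gibbs_weight -!mulr_suml mulrA ler_wpM2r //.
  by rewrite invr_ge0; exact: ltW (partition_sum_gt0 V phi psi _).
move=> h; rewrite mulrBl mul1r lerBrDr [leRHS]EG lerD2l.
exact: h.
Qed.
End Variation.

Hypothesis equil : forall nu : probability M R, invariant_prob V phi nu ->
  (entropy V phi nu + integ V phi nu psi <= entropy V phi mu + integ V phi mu psi)%E.

Lemma block_index_lt (K n b k : nat) : (b < K)%N -> (k < n)%N -> (b * n + k < K * n)%N.
Proof.
move=> bK kn; apply: (@leq_trans (b * n + n)); first by rewrite ltn_add2l.
by rewrite addnC -mulSn leq_mul2r bK orbT.
Qed.

(** The order of choices is decisive. The bounds [ka] on the Gibbs weight of the failure of D and
    [kb] on that of K repetitions of D depend only on a = pr A and on the relative entropy bound. So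
    K can be fixed with (1 - dd)^K < kb before the approximating event D, whose length is not
    controlled, is chosen. Forward invariance makes a point that enters A stay there, hence see D in
    all K blocks up to approximation errors. *)
Theorem zero_one_law (A : set M) : tmeas S A ->
  (forall z, S z -> A z -> A (Phi z)) -> pr A = 0 \/ pr A = 1.
Proof.
move=> mA AI; apply: contrapT => /not_orP[/eqP a0 /eqP a1].
set a := pr A in a0 a1.
have {}a0 : 0 < a by rewrite lt_neqAle eq_sym a0 pm_ge0.
have {}a1 : a < 1 by rewrite lt_neqAle a1 (pm_le1 mS PS mA).
have [Cv Cv0 hCv] := word_sum_variation ifs hpsi.
have [Ck hCk] := equilibrium_kl ifs hpsi muI equil.
have ln2 : 0 < ln 2 :> R by rewrite ln_gt0 // ltr1n.
pose L := Num.max Ck 0 + ln 2.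
have L0 : 0 <= L by rewrite addr_ge0 ?(ltW ln2) // le_max lexx orbT.
have mass n (D : pred {ffun 'I_n -> I}) (c : R) : (0 < n)%N -> 0 < c ->
    c <= pr [set z | D (prefix_word n z.1)] ->
    expR (- (L / c)) <= \sum_(w | D w) gibbs_weight w.
  move=> n0 c0; have mW : tfin S (fun z : M => prefix_word n z.1) by exact: tfin_prefix.
  rewrite (law_pred mu D mW) => cD.
  have hk : \sum_w law mu S (fun z : M => prefix_word n z.1) w *
     (ln (law mu S (fun z : M => prefix_word n z.1) w) - ln (gibbs_weight w)) <= Num.max Ck 0.
    by rewrite le_max hCk.
  apply: le_trans (kl_mass_bound (D := D) _ (law_sum PS mW)
    (@gibbs_weight_gt0 _ _ _ _ V phi psi n) (gibbs_weight_sum V phi psi n) hk _).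
  - rewrite ler_expR lerN2 -/L ler_wpM2l // lef_pV2 ?posrE //; exact: lt_le_trans cD.
  - by move=> w; exact: law_ge0.
  - exact: lt_le_trans cD.
have a2 : 0 < a / 2 by rewrite divr_gt0.
have b2 : 0 < (1 - a) / 2 by rewrite divr_gt0 // subr_gt0.
pose ka := expR (- (L / ((1 - a) / 2))); pose kb := expR (- (L / (a / 2))).
have ka1 : ka <= 1.
  by rewrite /ka -[leRHS]expR0 ler_expR lerNl oppr0 divr_ge0 // ltW.
pose dd := expR (- (8 * Cv)) * ka.
have dd0 : 0 < dd by rewrite mulr_gt0 ?expR_gt0.
have dd1 : dd <= 1.
  rewrite /dd -[leRHS]mulr1; apply: ler_pM; rewrite ?expR_ge0 //.
  by rewrite -[leRHS]expR0 ler_expR; lra.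
have [K hK] : exists K, (1 - dd) ^+ K < kb.
  have [K hK] := @geometric_small R (1 - dd) 1 kb ltac:(lra) ltac:(lra) ler01 (expR_gt0 _).
  by exists K; have := hK K (leqnn K); rewrite mulr1.
(* The first bound leaves the failure of D a mass at least (1 - a) / 2; the second keeps the total
   error over K blocks below a / 2, so that the repetition has mass at least a / 2. The divisor K +
   1 is nonzero in any case. *)
pose rho := Num.min ((1 - a) / 2) (a / 2 / K.+1%:R).
have rho0 : 0 < rho by rewrite lt_min b2 divr_gt0 // ltr0n.
have [N [m [D [dD hD]]]] := future_approx_tmeas ifs muI mA rho0.
(* The successor ensures a positive block length, which the relative entropy bound requires. *)
pose n := m.+1; have {}dD : depends_on_prefix n D by exact: depends_on_prefix_le dD.
pose A' : set M := iter N Phi @^-1` A.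
have mA' : tmeas S A' by exact: tmeas_iter.
have prA' : pr A' = a by exact: (pm_iter ifs muI N mA).
have A'I j z : S z -> A' z -> A' (iter j Phi z).
  have AIj k y : S y -> A y -> A (iter k Phi y).
    move=> Sy Ay; elim: k => // k IH; exact: (AI _ (SxL_iter ifs k Sy) IH).
  move=> Sz; rewrite /A' /preimage /= -iterD addnC iterD => Az.
  by apply: AIj => //; exact: SxL_iter.
have mB := tmeas_mismatch ifs N mA dD.
have mD : tmeas S [set z : M | D z.1] by exact: (tfin_prefix_fun ifs dD true).
have DE (t : nat -> I) : D t = D (ext (prefix_word n t)) by exact: depends_on_prefixE.
have rho1 : rho <= (1 - a) / 2 by rewrite ge_min lexx.
have rho2 : K%:R * rho <= a / 2.
  apply: (@le_trans _ _ (K.+1%:R * rho)).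
    by apply: ler_wpM2r; [exact: ltW|rewrite ler_nat].
  rewrite mulrC -ler_pdivlMr ?ltr0n //; by rewrite ge_min lexx orbT.
have hka : ka <= \sum_(v : {ffun 'I_n -> I} | ~~ D (ext v)) gibbs_weight v.
  apply: (mass n (fun v => ~~ D (ext v)) _ isT b2).
  have -> : pr [set z | ~~ D (ext (prefix_word n z.1))] = pr (~` [set z | D z.1]).
    by apply: eq_pm => z _ /=; rewrite -DE; split => /negP.
  have := pmU_le ifs mu (tmeasC mS mD) mB (tmeasC mS mA').
  rewrite [pr (~` A')](pmC mS PS mA') prA' => h.
  have : 1 - a <= pr (~` [set z : M | D z.1]) + pr (mismatch phi N A D).
    apply: h => z Sz nA; have [Dz|nDz] := boolP (D z.1); last by left; apply/negP.
    by right; rewrite /mismatch /= => -[_ /(_ Dz)].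
  have := ltW hD; lra.
have gr := gibbs_repeat hCv dD (expR_ge0 _) ka1 Cv0 hka (leqnn K).
have K0 : (0 < K)%N.
  rewrite lt0n; apply/eqP => K0; move: hK; rewrite K0 expr0 ltNge.
  by rewrite /kb -[leRHS]expR0 ler_expR lerNl oppr0 divr_ge0 // ltW.
have := mass (K * n)%N (fun w => [forall b : 'I_K, D (iter_shift (b * n) (ext w))]) (a / 2).
rewrite muln_gt0 K0 => /(_ isT a2).
set E := [set z | _]; move=> hE.
have mWK : tfin S (fun z : M => prefix_word (K * n) z.1) by exact: tfin_prefix.
have mE : tmeas S E.
  exact: (tfin_pred (fun w : {ffun 'I_(K * n) -> I} =>
    [forall b : 'I_K, D (iter_shift (b * n) (ext w))]) mWK).
have EE (z : M) : E z <-> forall b : 'I_K, D (iter_shift (b * n) z.1).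
  have sh (b : 'I_K) : D (iter_shift (b * n) (ext (prefix_word (K * n) z.1))) =
      D (iter_shift (b * n) z.1).
    apply: dD => k kn; have bk : (b * n + k < K * n)%N by exact: block_index_lt.
    by rewrite /iter_shift -[(b * n + k)%N]/(val (Ordinal bk)) ext_word_ord ffunE.
  split=> [/forallP h b|h]; first by rewrite -sh.
  by apply/forallP => b; rewrite sh.
pose F (b : 'I_K) : set M := iter (b * n) Phi @^-1` mismatch phi N A D.
have mF b : tmeas S (F b) by exact: tmeas_iter.
pose U : set M := [set z | exists2 b, b \in index_enum 'I_K & F b z].
have mU : tmeas S U by exact: (tmeas_fin (mem (index_enum 'I_K))).
have hU : pr U <= K%:R * rho.
  apply: le_trans (pm_union_le ifs mu _ mF) _.
  rewrite [leRHS](_ : _ = \sum_(b < K) rho); last by rewrite sumr_const card_ord mulr_natl.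
  by apply: ler_sum => b _; rewrite (pm_iter ifs muI) // ltW.
have : a / 2 <= pr E.
  have : pr A' <= pr E + pr U.
    apply: (pmU_le ifs) => // z Sz A'z; apply: contrapT => /not_orP[nE nU].
    apply: nE; apply/EE => b; apply: contrapT => nD; apply: nU; exists b.
      exact: mem_index_enum.
    rewrite /F /mismatch /= => -[/(_ (A'I _ _ Sz A'z)) + _].
    by rewrite iter_Phi.
  rewrite prA'; lra.
move=> /hE; rewrite -/kb => h; have := le_lt_trans (le_trans h gr) hK.
by rewrite ltxx.
Qed.
End ZeroOneLaw.

(** * Pressure *)

Lemma decreasing_zero (R : realType) (P : R -> R) (b : R) : 0 <= b -> continuous P ->
  0 <= P 0 -> P b <= 0 -> (forall s s', s < s' -> P s' < P s) ->
  exists t, [/\ 0 <= t, P t = 0 & forall s, t < s -> P s < 0] /\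
    forall t', P t' = 0 -> t' = t.
Proof.
move=> b0 cP P0 Pb dP; have [|t] := @IVT R P 0 b 0 b0 (continuous_subspaceT cP).
  by rewrite ge_min Pb orbT le_max P0.
rewrite in_itv /= => /andP[t0 _] Pt; exists t; split; first split => //.
  by move=> s /dP; rewrite Pt.
move=> t' Pt'; apply/eqP; rewrite eq_le; apply/andP; split; rewrite leNgt;
  by apply/negP => /dP; rewrite Pt Pt' ltxx.
Qed.

Section Pressure.
Variables (R : realType) (I : finType) (i0 : I).
Implicit Types (f g : (nat -> I) -> R) (t : nat -> I).

Local Notation orbit_sum f n t := (\sum_(k < n) f (iter k (@sshift I) t)).

Definition bounded_by f (B : R) := forall t, `|f t| <= B.

Lemma orbit_sum_le f B n t : bounded_by f B -> `|orbit_sum f n t| <= n%:R * B.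
Proof.
move=> fB; rewrite (le_trans (ler_norm_sum _ _ _)) //.
rewrite [leRHS](_ : _ = \sum_(k < n) B); last by rewrite sumr_const card_ord mulr_natl.
by apply: ler_sum => k _; exact: fB.
Qed.

Lemma cyl_sup_ge f B n (w : {ffun 'I_n -> I}) t : bounded_by f B ->
  prefix_word n t = w -> orbit_sum f n t <= cyl_sup f w.
Proof.
move=> fB tw; apply: ub_le_sup; last by exists t => //; apply/prefix_wordP.
exists (n%:R * B) => _ [u _ <-]; exact: le_trans (ler_norm _) (orbit_sum_le n u fB).
Qed.

Lemma cyl_sup_le f n (w : {ffun 'I_n -> I}) c :
  (forall t, prefix_word n t = w -> orbit_sum f n t <= c) -> cyl_sup f w <= c.
Proof.
move=> h; apply: ge_sup.
  exists (orbit_sum f n (ext_word w (fun=> i0))); exists (ext_word w (fun=> i0)) => //.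
  by move=> k; rewrite ext_word_ord.
by move=> _ [t /prefix_wordP tw <-]; exact: h.
Qed.

Lemma cyl_sup_split f B a b (w : {ffun 'I_(a + b) -> I}) : bounded_by f B ->
  cyl_sup f w <= cyl_sup f (left_word w) + cyl_sup f (right_word w).
Proof.
move=> fB; apply: cyl_sup_le => t tw.
rewrite big_split_ord /=; apply: lerD.
  by apply: (cyl_sup_ge fB); rewrite -tw left_prefix_word.
under eq_bigr => k _ do rewrite addnC iterD.
by apply: (cyl_sup_ge fB); rewrite -tw right_prefix_word iter_sshift.
Qed.

Definition cyl_partition f n : R := \sum_(w : {ffun 'I_n -> I}) expR (cyl_sup f w).

Lemma cyl_partition_gt0 f n : 0 < cyl_partition f n.
Proof.
rewrite /cyl_partition (bigD1 [ffun=> i0]) //= ltr_pwDl ?expR_gt0 //.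
by apply: sumr_ge0 => w _; exact: expR_ge0.
Qed.

Lemma ln_cyl_partition_split f B a b : bounded_by f B ->
  ln (cyl_partition f (a + b)) <= ln (cyl_partition f a) + ln (cyl_partition f b).
Proof.
move=> fB; rewrite -lnM ?posrE ?cyl_partition_gt0 //.
rewrite ler_ln ?posrE ?mulr_gt0 ?cyl_partition_gt0 //.
rewrite {2 3}/cyl_partition mulr_suml.
have -> : \sum_(u : {ffun 'I_a -> I}) expR (cyl_sup f u) *
    (\sum_(v : {ffun 'I_b -> I}) expR (cyl_sup f v)) =
    \sum_(u : {ffun 'I_a -> I}) \sum_(v : {ffun 'I_b -> I})
      expR (cyl_sup f u) * expR (cyl_sup f v).
  by apply: eq_bigr => u _; rewrite mulr_sumr.
rewrite -sum_word_split; apply: ler_sum => w _.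
by rewrite -expRD ler_expR (cyl_sup_split w fB).
Qed.

Lemma ln_cyl_partition_ge f B n : bounded_by f B -> n%:R * (- B) <= ln (cyl_partition f n).
Proof.
move=> fB; rewrite -[leLHS]expRK ler_ln ?posrE ?expR_gt0 ?cyl_partition_gt0 //.
pose t := (fun=> i0) : nat -> I.
rewrite /cyl_partition (bigD1 (prefix_word n t)) //= ler_wpDr //.
  by apply: sumr_ge0 => w _; exact: expR_ge0.
rewrite ler_expR; apply: le_trans (cyl_sup_ge fB (erefl (prefix_word n t))).
by have := orbit_sum_le n t fB; rewrite mulrN ler_norml => /andP[].
Qed.

Lemma pressure_cvg f B : bounded_by f B ->
  cvgn (fun n => ln (cyl_partition f n) / n%:R) /\
  forall n, (0 < n)%N -> pressure f <= ln (cyl_partition f n) / n%:R.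
Proof.
move=> fB.
exact: (subadditive_cvg (fun a b => ln_cyl_partition_split a b fB)
          (fun n => ln_cyl_partition_ge n fB)).
Qed.

Lemma pressure_shift_le f g B C M : bounded_by f B -> bounded_by g C ->
  (forall t, f t <= g t + M) -> pressure f <= pressure g + M.
Proof.
move=> fB gC fg; rewrite -lerBlDr; have [cg _] := pressure_cvg gC.
apply: limr_ge => //; exists 1%N => // n /= n0; rewrite lerBlDr.
have [_ /(_ n n0) h] := pressure_cvg fB; apply: le_trans h _.
rewrite ler_pdivrMr ?ltr0n // mulrDl divfK ?pnatr_eq0 -?lt0n //.
rewrite -[leRHS]expRK ler_ln ?posrE ?expR_gt0 ?cyl_partition_gt0 //.
rewrite expRD lnK ?posrE ?cyl_partition_gt0 // mulr_suml; apply: ler_sum => w _.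
rewrite -expRD ler_expR; apply: cyl_sup_le => t tw.
apply: (@le_trans _ _ (orbit_sum g n t + M * n%:R)); last first.
  by rewrite lerD2r; exact: cyl_sup_ge gC tw.
rewrite [M * _](_ : _ = \sum_(k < n) M); last by rewrite sumr_const card_ord mulr_natr.
by rewrite -big_split; apply: ler_sum => k _; exact: fg.
Qed.

Lemma pressure_cst_ge (c : R) : ln #|I|%:R + c <= pressure (fun _ : nat -> I => c).
Proof.
have cB : bounded_by (fun _ : nat -> I => c) `|c| by [].
have [cg _] := pressure_cvg cB; apply: limr_ge => //; exists 1%N => // n /= n0.
have I0 : 0 < #|I|%:R :> R by rewrite ltr0n; apply/card_gt0P; exists i0.
rewrite ler_pdivlMr ?ltr0n // -[leLHS]expRK ler_ln ?posrE ?expR_gt0 ?cyl_partition_gt0 //.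
rewrite mulrDl expRD [X in expR X * _]mulrC expRM_natl lnK ?posrE //.
have -> : #|I|%:R ^+ n * expR (c * n%:R) = \sum_(w : {ffun 'I_n -> I}) expR (c * n%:R).
  by rewrite sumr_const card_ffun card_ord -natrX mulr_natl.
apply: ler_sum => w _; rewrite ler_expR.
have := cyl_sup_ge cB (prefix_word_ext w (fun=> i0)).
by rewrite sumr_const card_ord mulr_natr.
Qed.

(* Here g = log |phi'| o pi lies between two negative constants. *)
Variables (g : (nat -> I) -> R) (kap Lg l : R).
Hypothesis kap0 : 0 < kap.
Hypothesis gU : forall t, g t <= - kap.
Hypothesis gL : forall t, - Lg <= g t.
Hypothesis l_le : l <= ln #|I|%:R.
Local Notation pot s := (fun t : nat -> I => s * g t - l).

Lemma pot_bounded s : bounded_by (pot s) (`|s| * Lg + `|l|).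
Proof.
move=> t; rewrite (le_trans (ler_normB _ _)) // lerD2r normrM ler_wpM2l //.
rewrite ler_norml gL; move: (gU t) (gL t) kap0 => h1 h2 h3; apply: (le_trans h1). lra.
Qed.

Lemma pressure_decr s s' : s <= s' ->
  pressure (pot s') <= pressure (pot s) - (s' - s) * kap.
Proof.
move=> ss; apply: (pressure_shift_le (pot_bounded s') (pot_bounded s)) => t.
have : (s' - s) * g t <= (s' - s) * - kap by rewrite ler_wpM2l ?subr_ge0.
lra.
Qed.

Lemma pressure_lip s s' : s <= s' ->
  pressure (pot s) <= pressure (pot s') + (s' - s) * Lg.
Proof.
move=> ss; apply: (pressure_shift_le (pot_bounded s) (pot_bounded s')) => t.
have : (s' - s) * - Lg <= (s' - s) * g t by rewrite ler_wpM2l ?subr_ge0.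
lra.
Qed.

Lemma pressure_continuous : continuous (fun s : R => pressure (pot s)).
Proof.
have Lg0 : 0 < Lg by move: (gU (fun=> i0)) (gL (fun=> i0)) kap0 => ? ? ?; lra.
move=> s; apply/cvgrPdist_lt => e e0.
have e' : 0 < e / Lg by rewrite divr_gt0.
near=> u; have us : `|s - u| < e / Lg by near: u; exact: cvgr_dist_lt.
rewrite ltr_pdivlMr // in us; apply: le_lt_trans us.
have [su|/ltW us] := leP s u.
  have h1 := pressure_lip su; have h2 := pressure_decr su.
  have h3 : 0 <= (u - s) * kap by rewrite mulr_ge0 ?subr_ge0 // ltW.
  rewrite [`|s - u|]distrC [`|u - s|]ger0_norm ?subr_ge0 //.
  move: h1 h2 h3; rewrite ler_norml.
  set x := pressure _; set y := pressure _; set a := (u - s) * _; set b := (u - s) * _.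
  by move=> h1 h2 h3; apply/andP; split; lra.
have h1 := pressure_lip us; have h2 := pressure_decr us.
have h3 : 0 <= (s - u) * kap by rewrite mulr_ge0 ?subr_ge0 // ltW.
rewrite [`|s - u|]ger0_norm ?subr_ge0 //.
move: h1 h2 h3; rewrite ler_norml.
set x := pressure _; set y := pressure _; set a := (s - u) * _; set b := (s - u) * _.
by move=> h1 h2 h3; apply/andP; split; lra.
Unshelve. all: by end_near. Qed.

(** At 0 the potential is the constant - l, whose pressure is at least ln #|I| - l >= 0. As the
    slope is at most - kap, the pressure is nonpositive from P(0) / kap on. *)
Lemma pressure_zero : exists t : R, [/\ 0 <= t, pressure (pot t) = 0 &
  forall s : R, t < s -> pressure (pot s) < 0] /\ forall t' : R, pressure (pot t') = 0 -> t' = t.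
Proof.
have p0 : 0 <= pressure (pot 0).
  apply: (@le_trans _ _ (pressure (fun _ : nat -> I => - l))).
    by rewrite (le_trans _ (pressure_cst_ge _)) // subr_ge0.
  by rewrite le_eqVlt; apply/orP; left; apply/eqP; congr (pressure _);
    apply/funext => t; rewrite mul0r add0r.
have pot_strict (s s' : R) : s < s' -> pressure (pot s') < pressure (pot s).
  move=> ss; apply: le_lt_trans (pressure_decr (ltW ss)) _.
  by rewrite ltrBlDr ltrDl mulr_gt0 // subr_gt0.
pose b := pressure (pot 0) / kap; have b0 : 0 <= b by rewrite divr_ge0 // ltW.
have pb : pressure (pot b) <= 0.
  by rewrite (le_trans (pressure_decr b0)) // subr0 divfK ?lt0r_neq0 // subrr.
exact: (decreasing_zero b0 pressure_continuous p0 pb pot_strict).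
Qed.
End Pressure.

(** * Conformal derivatives and distortion *)

Section ConformalDerivative.
Variables (R : realType) (q : nat).
Hypothesis q0 : (0 < q)%N.
Implicit Types (f : 'rV[R]_q -> 'rV[R]_q) (x y u v : 'rV[R]_q).

Definition unit_row : 'rV[R]_q := delta_mx ord0 (Ordinal q0).

Lemma enorm_unit_row : enorm unit_row = 1.
Proof.
rewrite /enorm (bigD1 (Ordinal q0)) //= big1 ?addr0 => [|j jq].
  by rewrite mxE !eqxx expr1n sqrtr1.
by rewrite mxE eqxx (negbTE jq) expr0n.
Qed.

(** The supremum is the similarity ratio c of the differential, attained at every unit vector.
    Evaluating at the fixed vector [unit_row] transfers continuity of the differential to
    [deriv_norm]. *)
Lemma deriv_norm_conformal f x : conformal_at f x ->
  deriv_norm f x = enorm ('d f x unit_row) /\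
  forall v, enorm ('d f x v) = deriv_norm f x * enorm v.
Proof.
move=> [_ [c [c0 hc]]]; suff -> : deriv_norm f x = c.
  by rewrite hc enorm_unit_row mulr1.
apply/eqP; rewrite eq_le; apply/andP; split.
  apply: ge_sup; first by exists (enorm ('d f x 0)), 0 => //=; rewrite enorm0.
  by move=> _ [v /= v1 <-]; rewrite hc ler_piMr // ltW.
apply: ub_le_sup; first by exists c => _ [v /= v1 <-]; rewrite hc ler_piMr // ltW.
by exists unit_row; rewrite /= ?enorm_unit_row // hc enorm_unit_row mulr1.
Qed.

Lemma deriv_norm_gt0 f x : conformal_at f x -> 0 < deriv_norm f x.
Proof.
move=> cf; have [-> _] := deriv_norm_conformal cf.
by case: cf => _ [c [c0 ->]]; rewrite enorm_unit_row mulr1.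
Qed.

Let row_dot u v : R := \sum_(j < q) u ord0 j * v ord0 j.

Lemma row_dot_continuous u : continuous (row_dot u).
Proof.
move=> v; apply/(@cvgrPdist_lt R R^o _ (nbhs v) (nbhs_filter v)) => e e0.
have C0 : 0 < enorm u * q%:R + 1 by rewrite ltr_wpDl // mulr_ge0 ?enorm_ge0.
have e' : 0 < e / (enorm u * q%:R + 1) by rewrite divr_gt0.
near=> w; have vw : `|v - w| < e / (enorm u * q%:R + 1).
  by near: w; exact: cvgr_dist_lt.
have rowB : row_dot u v - row_dot u w <= enorm u * enorm (v - w).
  rewrite -sumrB (le_trans _ (cauchy_schwarz_row _ _)) //.
  by apply: ler_sum => j _; rewrite !mxE mulrBr.
have rowB' : row_dot u w - row_dot u v <= enorm u * enorm (v - w).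
  rewrite -sumrB enormB (le_trans _ (cauchy_schwarz_row _ _)) //.
  by apply: ler_sum => j _; rewrite !mxE mulrBr.
have : `|row_dot u v - row_dot u w| <= enorm u * enorm (v - w).
  by rewrite ler_norml; move: rowB rowB' => h1 h2; apply/andP; split; lra.
move=> /le_lt_trans; apply; rewrite ltr_pdivlMr // in vw; apply: le_lt_trans vw.
have h1 : enorm u * enorm (v - w) <= enorm u * (q%:R * `|v - w|).
  by rewrite ler_wpM2l ?enorm_ge0 // enorm_le_norm.
have := normr_ge0 (v - w); lra.
Unshelve. all: by end_near. Qed.

(** The scalar mean value theorem applied to the inner product of f along the segment with u = f x -
    f y; Cauchy-Schwarz then allows division by |u|. *)
Lemma mean_value_enorm f x y (L : R) :
  (forall r : R, 0 <= r <= 1 -> differentiable f (y + r *: (x - y))) ->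
  (forall r : R, 0 <= r <= 1 -> enorm ('d f (y + r *: (x - y)) (x - y)) <= L) ->
  enorm (f x - f y) <= L.
Proof.
move=> df dL; set u := f x - f y; set w := x - y in df dL *.
pose h r := row_dot u (f (y + r *: w)).
have hD (r : R) : 0 <= r <= 1 -> is_derive (r : R) 1 (h : R -> R) (row_dot u ('d f (y + r *: w) w)).
  move=> r01; pose z := y + r *: w.
  have dz : (fun s : R => s^-1 *: (f (s *: w + z) - f z)) @ 0^' --> 'd f z w.
    by rewrite -deriveE; [exact: (diff_derivable (df _ r01))|exact: df].
  have : (fun s : R => s^-1 *: ((h \o shift r) (s *: 1) - h r)) @ 0^' -->
      row_dot u ('d f z w).
    have : (row_dot u (s^-1 *: (f (s *: w + z) - f z))) @[s --> (0 : R)^'] -->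
        row_dot u ('d f z w).
      exact: (@cvg_comp _ _ _ _ (row_dot u) _ _ _ dz (@row_dot_continuous u _)).
    apply: cvg_trans; apply: near_eq_cvg; near=> s.
    rewrite /h /= [s%:A]mulr1.
    have -> : y + (s + r) *: w = s *: w + z by rewrite /z scalerDl addrCA.
    rewrite -/z /row_dot -sumrB [RHS]mulr_sumr; apply: eq_bigr => j _.
    by rewrite !mxE -mulrBr mulrCA.
  move=> hc; split; first by apply/cvg_ex; eexists; exact: hc.
  exact: (cvg_lim _ hc).
have ch : {within `[0, 1], continuous h}.
  apply: continuous_in_subspaceT => r /set_mem; rewrite /= in_itv /= => r01.
  have [dr _] := hD _ r01.
  by apply: differentiable_continuous; exact/derivable1_diffP.
have [c] : exists2 c, c \in `]0, 1[%R & h 1 - h 0 = row_dot u ('d f (y + c *: w) w) * (1 - 0).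
  apply: MVT => // r; rewrite in_itv /= => /andP[r0 r1]; apply: hD; by rewrite !ltW.
rewrite in_itv /= => /andP[c0 c1]; rewrite subr0 mulr1 /h scale1r scale0r addr0.
rewrite [y + w]addrC subrK => hh.
have {}hh : enorm u ^+ 2 = row_dot u ('d f (y + c *: w) w).
  rewrite -hh enorm_sqr /row_dot -sumrB; apply: eq_bigr => j _.
  by rewrite -mulrBr /u !mxE expr2.
have c01 : 0 <= c <= 1 by rewrite !ltW.
have [->|u0] := eqVneq (enorm u) 0; first exact: le_trans (enorm_ge0 _) (dL c c01).
have u1 : 0 < enorm u by rewrite lt_neqAle eq_sym u0 enorm_ge0.
apply: le_trans (dL c c01).
by rewrite -(ler_pM2l u1) -expr2 hh cauchy_schwarz_row.
Unshelve. all: by end_near. Qed.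
End ConformalDerivative.

Lemma nbhs_enorm_ball (R : realType) (q : nat) (U : set 'rV[R]_q) (x : 'rV[R]_q) : nbhs x U ->
  exists2 e : R, 0 < e & forall y, enorm (y - x) < e -> U y.
Proof.
rewrite nbhsE => -[B [oB Bx] BU]; have [e e0 eB] := open_enorm_ball oB Bx.
by exists e => // y /eB /BU.
Qed.

Lemma enorm_ball_nbhs (R : realType) (q : nat) (x : 'rV[R]_q) (e : R) : 0 < e ->
  \forall y \near x, enorm (y - x) < e.
Proof.
move=> e0; have e' : 0 < e / (q%:R + 1) by rewrite divr_gt0 // ltr_wpDl ?ler0n.
near=> y; have xy : `|x - y| < e / (q%:R + 1) by near: y; exact: cvgr_dist_lt.
rewrite enormB (le_lt_trans (enorm_le_norm _)) //; move: xy.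
rewrite ltr_pdivlMr ?ltr_wpDl ?ler0n //; apply: le_lt_trans.
by rewrite mulrDr mulr1 mulrC lerDl.
Unshelve. all: by end_near. Qed.

Lemma enorm_segment (R : realType) (q : nat) (p x y : 'rV[R]_q) (d r : R) :
  enorm (x - p) < d -> enorm (y - p) < d -> 0 <= r <= 1 ->
  enorm (y + r *: (x - y) - p) < d.
Proof.
move=> xp yp /andP[r0 r1].
have -> : y + r *: (x - y) - p = (1 - r) *: (y - p) + r *: (x - p).
  by apply/rowP => j; rewrite !mxE; ring.
apply: le_lt_trans (enormD _ _) _; rewrite !enormZ !ger0_norm ?subr_ge0 //.
have [->|rp] := eqVneq r 0; first by rewrite mul0r addr0 subr0 mul1r.
have {}r0 : 0 < r by rewrite lt_neqAle eq_sym rp.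
have h1 : (1 - r) * enorm (y - p) <= (1 - r) * d by rewrite ler_wpM2l ?subr_ge0 // ltW.
have h2 : r * enorm (x - p) < r * d by rewrite ltr_pM2l.
lra.
Qed.

Lemma half_expR_trans (R : realType) (e a b c : R) :
  a < expR (e / 2) * b -> b / expR (e / 2) < c -> a <= expR e * c.
Proof.
move=> ab bc; apply: le_trans (ltW ab) _; rewrite (_ : expR e = expR (e / 2) * expR (e / 2)).
  by rewrite -mulrA ler_pM2l ?expR_gt0 // mulrC -ler_pdivrMr ?expR_gt0 // ltW.
by rewrite -expRD -splitr.
Qed.

Lemma distortion_step (R : realType) (F B c r Ao An E w g : R) :
  F <= B * c * r -> r <= Ao * E * w -> 0 <= B -> 0 <= c -> 0 <= E * w ->
  B * Ao <= An * g -> F <= An * (g * c * E) * w.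
Proof.
move=> h1 h2 B0 c0 Ew h3; apply: le_trans h1 _.
apply: (@le_trans _ _ (B * c * (Ao * E * w))); first by rewrite ler_wpM2l ?mulr_ge0.
have -> : B * c * (Ao * E * w) = B * Ao * (c * (E * w)) by ring.
have -> : An * (g * c * E) * w = An * g * (c * (E * w)) by ring.
by rewrite ler_wpM2r // mulr_ge0.
Qed.

Lemma orbit_sum_recl (R : realType) (I : Type) (f : (nat -> I) -> R) n (t : nat -> I) :
  \sum_(k < n.+1) f (iter k (@sshift I) t) =
  f t + \sum_(k < n) f (iter k (@sshift I) (sshift t)).
Proof.
by rewrite big_ord_recl; congr (_ + _); apply: eq_bigr => k _; rewrite -iterSr.
Qed.

Section Distortion.
Variables (R : realType) (q : nat) (I : finType).
Variables (V : set 'rV[R]_q) (phi : I -> 'rV[R]_q -> 'rV[R]_q).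
Hypothesis ifs : conformal_IFS V phi.
Hypothesis q0 : (0 < q)%N.
Local Notation K := (closure V).
Implicit Types (t u : nat -> I) (x y : 'rV[R]_q) (n m : nat).
Local Notation dn i x := (deriv_norm (phi i) x).

Lemma ifs_derivative : exists W : set 'rV[R]_q, [/\ open W, K `<=` W &
  forall i x, W x -> conformal_at (phi i) x /\ {for x, continuous (deriv_norm (phi i))}].
Proof.
case: ifs => _ _ [W [oW KW hW]] _ _; exists W; split => // i x Wx.
have [cW dW] := hW i; split; first exact: cW.
have h : (fun y => enorm ('d (phi i) y (unit_row R q0))) @ x --> deriv_norm (phi i) x.
  rewrite [deriv_norm _ _](deriv_norm_conformal q0 (cW _ Wx)).1.
  apply: (@cvg_comp _ _ _ (fun y => 'd (phi i) y (unit_row R q0)) (@enorm R q) (nbhs x)).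
    exact: (dW _ _ Wx).
  exact: enorm_continuous.
have E : \forall y \near x, enorm ('d (phi i) y (unit_row R q0)) = deriv_norm (phi i) y.
  near=> y; apply/esym; apply: (deriv_norm_conformal q0 (cW _ _)).1.
  by near: y; exact: open_nbhs_nbhs.
exact: (cvg_trans (near_eq_cvg E) h).
Unshelve. all: by end_near. Qed.

Lemma deriv_norm_lower : exists2 m : R, 0 < m & forall i x, K x -> m <= dn i x.
Proof.
have [W [oW KW hW]] := ifs_derivative.
have ex i : exists m : R, 0 < m /\ forall x, K x -> m <= dn i x.
  have cd : {within K, continuous (deriv_norm (phi i))}.
    by apply: continuous_in_subspaceT => x /set_mem Kx; exact: (hW i x (KW _ Kx)).2.
  have [c Kc hc] := compact_EVT_min (ifs_nonempty ifs) (ifs_compact ifs) cd.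
  exists (dn i c); split; last by move=> x Kx; apply: hc; rewrite inE.
  by apply: (deriv_norm_gt0 q0 (hW i c (KW _ _)).1); rewrite -in_setE.
have [m hm] := choice ex.
exists (\big[Num.min/1]_i m i); first by apply: lt_bigmin => // i _; exact: (hm i).1.
move=> i x Kx; apply: le_trans ((hm i).2 x Kx); exact: bigmin_le.
Qed.

Definition log_deriv t : R := ln (dn (t 0%N) (ifs_proj V phi (sshift t))).

Lemma deriv_norm_gt0_K i x : K x -> 0 < dn i x.
Proof. by have [m m0 hm] := deriv_norm_lower => /(hm i); exact: lt_le_trans. Qed.

Lemma expR_log_deriv t : expR (log_deriv t) = dn (t 0%N) (ifs_proj V phi (sshift t)).
Proof. by rewrite lnK // posrE deriv_norm_gt0_K //; exact (ifs_proj_K ifs _). Qed.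

Lemma log_deriv_bounds : exists kap Lg : R, 0 < kap /\
  forall t, - Lg <= log_deriv t <= - kap.
Proof.
have [m m0 hm] := deriv_norm_lower; case: ifs => _ _ _ _ [kappa [k1 hk]].
pose t0 := fun t => ifs_proj_K ifs (sshift t).
have [i|noI] := pselect (exists i : I, True); last first.
  by exists 1, 0; split => // t; case: noI; exists (t 0%N).
case: i => i _; have [x0 Kx0] := ifs_nonempty ifs.
have k0 : 0 < kappa := lt_trans (deriv_norm_gt0_K i Kx0) (hk i x0 Kx0).
exists (- ln kappa), (- ln m); split; first by rewrite oppr_gt0 ln_lt0 // k0.
move=> t; rewrite !opprK /log_deriv.
have Kt := ifs_proj_K ifs (sshift t).
rewrite !ler_ln ?posrE ?deriv_norm_gt0_K //.
by rewrite hm //= ltW // hk.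
Qed.

(** closure V need not be convex, so the mean value bound is used on small balls around its points,
    inside the neighbourhood W where the maps are conformal. There the derivative varies by at most
    e^(e/2) on either side of its value at the centre, and compactness makes the radius uniform. *)
Lemma ifs_local_distortion (e : R) : 0 < e -> exists2 d : R, 0 < d & forall i p x y,
  K p -> enorm (x - p) < d -> enorm (y - p) < d ->
  enorm (phi i x - phi i y) <= expR e * dn i p * enorm (x - y).
Proof.
move=> e0; have [W [oW KW hW]] := ifs_derivative.
pose P i (d : R) p := forall x y, enorm (x - p) < d -> enorm (y - p) < d ->
  enorm (phi i x - phi i y) <= expR e * dn i p * enorm (x - y).
have ex i : exists d : R, 0 < d /\ forall p, K p -> P i d p.
  have h : \forall d \near (0 : R)^'+, K `<=` P i d.
    apply: (compact_near_coveringP K).1 => [|p0 Kp0]; first exact: (ifs_compact ifs).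
    have c0 := deriv_norm_gt0_K i Kp0.
    have E1 : 1 < expR (e / 2) by rewrite -[ltLHS]expR0 ltr_expR divr_gt0.
    have /nbhs_enorm_ball[r r0 hr] : \forall z \near p0,
        [/\ W z, dn i z < expR (e / 2) * dn i p0 & dn i p0 / expR (e / 2) < dn i z].
      have cd := (hW i p0 (KW _ Kp0)).2.
      near=> z; split; first by near: z; apply: open_nbhs_nbhs; split => //; exact: KW.
        by near: z; apply: (cvgr_lt _ cd); rewrite ltr_pMl.
      by near: z; apply: (cvgr_gt _ cd); rewrite ltr_pdivrMr ?expR_gt0 // ltr_pMr.
    have r2 : 0 < r / 2 by rewrite divr_gt0.
    near=> p d => x y xp yp.
    have pp : enorm (p - p0) < r / 2 by near: p; exact: enorm_ball_nbhs.
    have dr : d < r / 2 by near: d; exact: nbhs_right_lt.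
    have close z : enorm (z - p) < d -> enorm (z - p0) < r.
      move=> zp; apply: le_lt_trans (enorm_triangle z p p0) _; lra.
    have seg s : 0 <= s <= 1 -> enorm (y + s *: (x - y) - p0) < r.
      by apply: enorm_segment; exact: close.
    have r3 : r / 2 < r by lra.
    have [_ _ hp] := hr p (lt_trans pp r3).
    apply: mean_value_enorm => s /seg/hr[Wz hz _]; first by have [[]] := hW i _ Wz.
    have hE := (deriv_norm_conformal q0 (hW i _ Wz).1).2 (x - y).
    have hm : dn i (y + s *: (x - y)) <= expR e * dn i p.
      exact: (half_expR_trans hz hp).
    apply: (le_trans (y := dn i (y + s *: (x - y)) * enorm (x - y))).
      by move: hE; set a := enorm _; set b := dn i _ * _ => ->.
    exact: (ler_wpM2r (enorm_ge0 (x - y)) hm).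
  near (0 : R)^'+ => d; exists d; split; last by near: d.
  by near: d; exact: nbhs_right_gt.
have [d hd] := choice ex.
exists (\big[Num.min/1]_i d i); first by apply: lt_bigmin => // i _; exact: (hd i).1.
move=> i p x y Kp xp yp; apply: (hd i).2 => //.
  by apply: lt_le_trans xp _; exact: bigmin_le.
by apply: lt_le_trans yp _; exact: bigmin_le.
Unshelve. all: by end_near. Qed.

(** Letters are added on the outside. Once the inner word has length at least n0, its image lies
    within d of the projection and the local estimate costs e^e per letter. The at most n0 innermost
    letters are treated by plain contraction, each at the price of a factor A, chosen so that A
    times any derivative is at least 1. *)
Lemma cylinder_distortion (e : R) : 0 < e -> exists2 C : R, 0 < C &
  forall t n x y, K x -> K y -> enorm (comp_word phi t n x - comp_word phi t n y) <=
    C * expR (n%:R * e + \sum_(k < n) log_deriv (iter k (@sshift I) t)) * enorm (x - y).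
Proof.
move=> e0; have [m m0 hm] := deriv_norm_lower.
have [d d0 hd] := ifs_local_distortion e0.
have [s [s0 s1 hs]] := comp_word_contraction ifs.
have [D D0 hD] := ifs_bounded ifs.
have [sc [sc0 sc1 hsc]] := ifs_contraction ifs.
have [n0 hn0] := geometric_small (ltW s0) s1 (ltW D0) d0.
pose A := Num.max 1 m^-1; have A1 : 1 <= A by rewrite le_max lexx.
have A0 : 0 < A by exact: lt_le_trans A1.
exists (A ^+ n0) => [|t n x y Kx Ky]; first exact: exprn_gt0.
pose E t n := expR (n%:R * e + \sum_(k < n) log_deriv (iter k (@sshift I) t)).
have ES u n' : E u n'.+1 = expR e * deriv_norm (phi (u 0%N)) (ifs_proj V phi (sshift u)) * E (sshift u) n'.
  rewrite /E -expR_log_deriv -!expRD orbit_sum_recl -natr1; congr expR; ring.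
suff : enorm (comp_word phi t n x - comp_word phi t n y) <=
    A ^+ minn n n0 * E t n * enorm (x - y).
  move=> /le_trans; apply; rewrite ler_wpM2r ?enorm_ge0 // ler_wpM2r ?expR_ge0 //.
  by rewrite ler_weXn2l // geq_minr.
elim: n t => [|n IH] t.
  by rewrite min0n expr0 /E mul0r big_ord0 addr0 expR0 !mul1r.
set u := sshift t; set a := comp_word phi u n x; set b := comp_word phi u n y.
have Ka : K a by exact (comp_word_in ifs u n Kx).
have Kb : K b by exact (comp_word_in ifs u n Ky).
set p := ifs_proj V phi u.
have cylinder_diam z : K z -> enorm (comp_word phi u n z - p) <= s ^+ n * D.
  move=> Kz; rewrite /p; have [z' Kz' <-] := ifs_projP ifs u n.
  apply: le_trans (hs _ _ _ _ Kz Kz') _.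
  by rewrite ler_wpM2l ?hD // exprn_ge0 // ltW.
have Kp : K p by exact (ifs_proj_K ifs u).
have -> : comp_word phi t n.+1 x = phi (t 0%N) a by rewrite comp_wordSl.
have -> : comp_word phi t n.+1 y = phi (t 0%N) b by rewrite comp_wordSl.
have dp := deriv_norm_gt0_K (t 0%N) Kp.
have IHu := IH u; rewrite -/a -/b in IHu; rewrite ES -/u -/p.
have Ew : 0 <= E u n * enorm (x - y) by rewrite mulr_ge0 ?expR_ge0 ?enorm_ge0.
have [nn0|n0n] := ltnP n n0.
  apply: (distortion_step (B := A) _ IHu (ltW A0) (ltW dp) Ew).
    apply: le_trans (hsc _ _ _ Ka Kb) _; rewrite ler_wpM2r ?enorm_ge0 //.
    apply: le_trans (ltW sc1) _; apply: (@le_trans _ _ (m^-1 * deriv_norm (phi (t 0%N)) p)).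
      by rewrite mulrC ler_pdivlMr // mul1r hm.
    by apply: ler_wpM2r; [exact: ltW|rewrite le_max lexx orbT].
  rewrite (minn_idPl nn0) (minn_idPl (ltnW nn0)) -exprS ler_peMr ?exprn_ge0 ?(ltW A0) //.
  by rewrite -[leLHS]expR0 ler_expR ltW.
apply: (distortion_step (B := expR e) _ IHu (expR_ge0 _) (ltW dp) Ew); last first.
  by rewrite (minn_idPr (leqW n0n)) (minn_idPr n0n) mulrC.
apply: hd => //.
  by apply: le_lt_trans (hn0 n n0n); exact: cylinder_diam.
by apply: le_lt_trans (hn0 n n0n); exact: cylinder_diam.
Qed.
End Distortion.

(** * Covering multiplicity and overlap number *)

Section CoverCounting.
Variables (R : realType) (q : nat) (I : finType) (i0 : I).
Variables (V : set 'rV[R]_q) (phi : I -> 'rV[R]_q -> 'rV[R]_q).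
Hypothesis ifs : conformal_IFS V phi.
Local Notation X := (XT R q i0).
Local Notation M := (XM R q i0).
Local Notation Lambda := (limit_set V phi).
Local Notation K := (closure V).
Implicit Types (x y : 'rV[R]_q) (n : nat) (c : R).

Definition word_image n (w : {ffun 'I_n -> I}) : set 'rV[R]_q :=
  cyl_image V phi (ext_word w (fun=> i0)) n.

Definition cover_words n x : {set {ffun 'I_n -> I}} :=
  [set w | `[< word_image w x >]]%SET.

Lemma word_image_prefix n (t : nat -> I) :
  word_image (prefix_word n t) = cyl_image V phi t n.
Proof.
apply: eq_cyl_image => k kn.
by rewrite -[k]/(val (Ordinal kn)) ext_word_ord ffunE.
Qed.

Lemma fwd_comp_word (t u : nat -> I) n y :
  (forall k, (k < n)%N -> u k = t (n - k.+1)%N) -> fwd_word phi t n y = comp_word phi u n y.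
Proof.
elim: n u => [//|n IH] u tu; rewrite comp_wordSl /= -IH => [|k kn].
  by rewrite tu // subn1.
by rewrite /sshift tu.
Qed.

(* Reversing the letters turns the admissible histories of a point into
   distinct cylinders containing that point. *)
Lemma bcount_le (psi : X -> R) (mu : probability M R) (tau : R) n (z : X) :
  (bcount V phi psi mu tau n z <= #|cover_words n (fwd_word phi z.1 n z.2)|)%N.
Proof.
pose rv (w : {ffun 'I_n -> I}) : {ffun 'I_n -> I} := [ffun k => w (rev_ord k)].
have rvI : injective rv.
  move=> w w' /ffunP h; apply/ffunP => k; have := h (rev_ord k).
  by rewrite !ffunE rev_ordK.
rewrite /bcount -(card_imset _ rvI); apply: subset_leq_card; apply/fintype.subsetP => w'.
move=> /imsetP[eta]; rewrite inE => /asboolP[y [Ly [<- _]]] ->; rewrite inE; apply/asboolP.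
exists y; first exact (limit_set_sub Ly).
apply/esym/fwd_comp_word => k kn.
rewrite -[k in LHS]/(val (Ordinal kn)) ext_word_ord ffunE.
by rewrite -[(n - k.+1)%N]/(val (rev_ord (Ordinal kn))) ext_word_ord.
Qed.

(** Prefixing the letter i maps the words covering x injectively to words covering its image. *)
Lemma cover_words_maps n i x : K x -> (#|cover_words n x| <= #|cover_words n.+1 (phi i x)|)%N.
Proof.
move=> Kx; pose cs (w : {ffun 'I_n -> I}) : {ffun 'I_n.+1 -> I} :=
  [ffun k => if unlift ord0 k is Some j then w j else i].
have csI : injective cs.
  move=> w w' /ffunP h; apply/ffunP => k; have := h (lift ord0 k).
  by rewrite !ffunE liftK.
rewrite -(card_imset _ csI); apply: subset_leq_card; apply/fintype.subsetP => w'.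
move=> /imsetP[w]; rewrite inE => /asboolP wx ->; rewrite inE; apply/asboolP.
rewrite /word_image cyl_imageSl; exists x.
  rewrite (@eq_cyl_image _ _ _ _ _ _ (ext_word w (fun=> i0))) // => k kn.
  rewrite /sshift -[k.+1]/(val (lift ord0 (Ordinal kn))) ext_word_ord ffunE liftK.
  by rewrite -[k in RHS]/(val (Ordinal kn)) ext_word_ord.
by rewrite -[0%N]/(val (ord0 : 'I_n.+1)) ext_word_ord ffunE unlift_none.
Qed.

Definition multiply_covered n c : set 'rV[R]_q :=
  [set x | expR (n%:R * c) <= #|cover_words n x|%:R].

(** Being covered often enough means lying in all images of some sufficiently large set of words: a
    finite union of intersections of closed sets. *)
Lemma multiply_covered_closed n c : closed (multiply_covered n c).
Proof.
have -> : multiply_covered n c =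
    \bigcup_(A in [set A : {set {ffun 'I_n -> I}} | expR (n%:R * c) <= #|A|%:R])
      \bigcap_(w in [set w | w \in A]) word_image w.
  apply/seteqP; split=> [x xc|x [A cA hA]].
    by exists (cover_words n x) => // w; rewrite /= inE => /asboolP.
  apply: le_trans cA _; rewrite ler_nat; apply: subset_leq_card.
  by apply/fintype.subsetP => w wA; rewrite inE; apply/asboolP; exact: hA.
apply: closed_bigcup; first exact: finite_finset.
by move=> A _; apply: closed_bigI => w _; exact: cyl_image_closed.
Qed.

Lemma limit_set_covered n c x : c <= 0 -> Lambda x -> multiply_covered n c x.
Proof.
move=> c0 [t tx]; rewrite /multiply_covered /=; apply: (@le_trans _ _ 1).
  by rewrite -[leRHS]expR0 ler_expR mulr_ge0_le0.
rewrite ler1n card_gt0; apply/set0Pn; exists (prefix_word n t).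
by rewrite inE; apply/asboolP; rewrite word_image_prefix.
Qed.

Lemma multiply_covered_maps c c' : c' < c -> exists N, forall n i x, (N <= n)%N -> K x ->
  multiply_covered n c x -> multiply_covered n.+1 c' (phi i x).
Proof.
move=> cc; have d0 : 0 < c - c' by rewrite subr_gt0.
exists (Num.truncn (`|c'| / (c - c'))).+1 => n i x Nn Kx; rewrite /multiply_covered /= => h.
apply: (@le_trans _ _ #|cover_words n x|%:R); last by rewrite ler_nat cover_words_maps.
apply: le_trans h; rewrite ler_expR -natr1.
have : `|c'| / (c - c') < n%:R by rewrite -truncn_lt_nat // divr_ge0 // ltW.
rewrite ltr_pdivrMr // => h; have := ler_norm c'; lra.
Qed.

(** This is the set where limsup ln N_n(x) / n >= c. The margins 1 / (k + 1) make it stable under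
    the maps: applying phi_i raises n by one without lowering the count, and the resulting loss is
    absorbed by passing to a smaller margin. *)
Definition often_covered c : set 'rV[R]_q :=
  \bigcap_k \bigcap_N \bigcup_n multiply_covered (N + n) (c - k.+1%:R^-1).

Lemma often_covered_borel c : <<s [set U : set 'rV[R]_q | open U] >> (often_covered c).
Proof.
pose T := g_sigma_algebraType [set U : set 'rV[R]_q | open U].
suff : measurable (often_covered c : set T) by [].
apply: bigcapT_measurable => k; apply: bigcapT_measurable => N.
apply: bigcupT_measurable => n; rewrite -[X in measurable X]setCK; apply: measurableC.
by apply: sub_sigma_algebra; apply: closed_openC; exact: multiply_covered_closed.
Qed.

Lemma often_covered_maps c i x : K x -> often_covered c x -> often_covered c (phi i x).
Proof.
move=> Kx hx k _ N _.
have cc : c - k.+1%:R^-1 < c - k.+2%:R^-1.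
  by rewrite ltrD2l ltrN2 ltf_pV2 ?posrE ?ltr0n // ltr_nat.
have [N' hN'] := multiply_covered_maps cc.
have [n _ hn] := hx k.+1 Logic.I (N + N')%N Logic.I.
exists (N' + n).+1 => //=; rewrite addnS addnA.
by apply: hN' => //; rewrite -addnA (leq_trans (leq_addr n N')) // leq_addl.
Qed.

Lemma often_covered_sub c c' x : c' < c -> often_covered c x ->
  forall N, exists2 n, (N <= n)%N & multiply_covered n c' x.
Proof.
move=> cc hx N; pose k := Num.truncn (c - c')^-1.
have k0 : k.+1%:R^-1 < c - c'.
  rewrite invf_plt ?posrE ?subr_gt0 ?ltr0n //.
  by rewrite -truncn_lt_nat // invr_ge0 subr_ge0 ltW.
have [n _ hn] := hx k Logic.I N Logic.I; exists (N + n)%N; first exact: leq_addr.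
apply: le_trans hn; rewrite ler_expR ler_wpM2l // lerBrDl addrC -lerBrDl.
exact: ltW.
Qed.
End CoverCounting.

Section OverlapBound.
Variables (R : realType) (q : nat) (I : finType) (i0 : I).
Variables (V : set 'rV[R]_q) (phi : I -> 'rV[R]_q -> 'rV[R]_q).
Hypothesis ifs : conformal_IFS V phi.
Local Notation X := (XT R q i0).
Local Notation M := (XM R q i0).
Local Notation S := (SxL V phi : set M).
Local Notation Phi := (@Phi_lift R q I i0 phi).
Variable psi : X -> R.
Variable mu : probability M R.
Hypothesis muI : invariant_prob V phi mu.
Local Notation pr := (pm mu S).
Local Notation ov := (overlap_seq V phi psi mu).
Local Notation bc := (bcount V phi psi mu).

Let mS : measurable S. Proof. exact: (@measurable_SxL R q I i0 V phi ifs). Qed.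
Let PS : mu S = 1%E. Proof. exact: (invariant_full muI). Qed.

(** The convention ln 0 = 0 makes this hold also for an empty count. *)
Lemma ln_nat_le (m n : nat) : (m <= n)%N -> ln m%:R <= ln n%:R :> R.
Proof.
case: m => [_|m mn]; last by rewrite ler_ln ?posrE ?ltr0n ?ler_nat // (leq_trans _ mn).
rewrite [leLHS]ln0 //; case: n => [|n]; first by rewrite ln0.
by rewrite ln_ge0 // ler1n.
Qed.

Lemma cover_words_max n (x : 'rV[R]_q) :
  ln #|cover_words i0 V phi n x|%:R <= n%:R * ln #|I|%:R :> R.
Proof.
apply: (@le_trans _ _ (ln (#|I| ^ n)%:R)).
  by apply: ln_nat_le; apply: leq_trans (max_card _) _; rewrite card_ffun card_ord.
have I0 : 0 < #|I|%:R :> R by rewrite ltr0n; apply/card_gt0P; exists i0.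
by rewrite natrX lnXn // mulr_natl.
Qed.

Definition covered_event n (c : R) : set M :=
  [set z | multiply_covered i0 V phi n c z.2].

Lemma tmeas_covered_event n c : tmeas S (covered_event n c).
Proof.
apply: tmeasW => //; apply: (@measurable_snd_borel R q I i0).
have -> : multiply_covered i0 V phi n c = ~` ~` multiply_covered i0 V phi n c by rewrite setCK.
pose T := g_sigma_algebraType [set U : set 'rV[R]_q | open U].
suff : measurable (~` ~` multiply_covered i0 V phi n c : set T) by [].
apply: measurableC; apply: sub_sigma_algebra; apply: closed_openC.
exact: multiply_covered_closed.
Qed.

Lemma bcount_ln_bounds tau n (z : X) : 0 <= ln ((bc tau n z)%:R : R) <= n%:R * ln #|I|%:R.
Proof.
apply/andP; split; last first.
  by apply: le_trans (cover_words_max n (fwd_word phi z.1 n z.2)); apply: ln_nat_le; exact: bcount_le.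
by rewrite -(@ln0 R 0) //; exact: (@ln_nat_le 0).
Qed.

Lemma overlap_integral_fin tau n :
  integ V phi mu (fun z => ln (bc tau n z)%:R) \is a fin_num.
Proof.
apply: (integral_bounded_fin_num mu mS (C := n%:R * ln #|I|%:R)) => z _.
by have /andP[b0 b1] := bcount_ln_bounds tau n z; rewrite ger0_norm.
Qed.

Lemma overlap_seq_mono n tau tau' : tau <= tau' -> ov tau n <= ov tau' n.
Proof.
move=> tt; rewrite /overlap_seq ler_wpM2r ?invr_ge0 //.
rewrite fine_le ?overlap_integral_fin //; apply: integral_mono => z _.
rewrite lee_fin; apply: ln_nat_le; apply: subset_leq_card; apply/fintype.subsetP => w.
rewrite !inE => /asboolP[y [Ly [yz hy]]]; apply/asboolP; exists y; split => //; split => //.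
exact: lt_le_trans tt.
Qed.

(** Where the endpoint of the orbit has fewer than e^(n c) covering words, ln b_n is at most n
    max(c, 0), and elsewhere at most n ln #|I|. Invariance moves the exceptional event from time n
    to time 0. *)
Lemma overlap_seq_le tau n c : (0 < n)%N ->
  ov tau n <= Num.max c 0 + ln #|I|%:R * pr (covered_event n c).
Proof.
move=> n0; have nR : 0 < n%:R :> R by rewrite ltr0n.
pose Y (z : M) : bool := `[< covered_event n c (iter n Phi z) >].
have mE := tmeas_covered_event n c.
have mE' := tmeas_iter ifs n mE.
have mY : tfin S Y.
  move=> []; [apply: tmeas_ext mE' => z _ /=|apply: tmeas_ext (tmeasC mS mE') => z _ /=].
    by rewrite /Y; split => [/asboolP|/asboolP].
  by rewrite /Y; split => [h|/asboolP]; [apply/negbTE; apply/asboolP|].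
pose m := Num.max c 0; have m0 : 0 <= m by rewrite le_max lexx orbT.
pose h (b : bool) : R := if b then n%:R * ln #|I|%:R else n%:R * m.
have hY z : S z -> ln (bc tau n z)%:R <= h (Y z).
  move=> Sz; have /andP[_ b1] := bcount_ln_bounds tau n z.
  rewrite /h /Y; case: asboolP => // /negP; rewrite /covered_event /= iter_Phi /=.
  rewrite /multiply_covered /= -ltNge => hc.
  have hb := ln_nat_le (bcount_le V phi psi mu tau n z).
  apply: (le_trans hb).
  have [->|N0] := posnP #|cover_words i0 V phi n (fwd_word phi z.1 n z.2)|.
    by rewrite ln0 // mulr_ge0.
  rewrite -[leRHS]expRK ler_ln ?posrE ?expR_gt0 ?ltr0n //.
  by apply: le_trans (ltW hc) _; rewrite ler_expR ler_wpM2l // le_max lexx.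
have := integral_le_finite mu mY hY; rewrite -/(integ V phi mu (fun z => ln (bc tau n z)%:R)).
rewrite -[X in (X <= _)%E]fineK ?overlap_integral_fin // lee_fin big_bool /= => hi.
rewrite /overlap_seq ler_pdivrMr //; apply: le_trans hi _.
have -> : law mu S Y true = pr (covered_event n c).
  rewrite -(pm_iter ifs muI n mE); apply: eq_pm => z _ /=.
  by rewrite /Y; split => [/asboolP|/asboolP].
have l1 : law mu S Y false <= 1 by exact: pm_le1.
rewrite -/m /h mulrDl [m * _]mulrC addrC; apply: lerD.
  by rewrite ler_piMl // mulr_ge0.
by rewrite le_eqVlt; apply/orP; left; apply/eqP; ring.
Qed.

Hypothesis cvg_ov : forall tau : R, 0 < tau -> cvgn (ov tau).
Local Notation l := (log_overlap V phi psi mu).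

Lemma limn_ov_mono tau tau' : 0 < tau -> tau <= tau' -> limn (ov tau) <= limn (ov tau').
Proof.
move=> t0 tt; apply: ler_lim; [exact: cvg_ov|exact: cvg_ov (lt_le_trans t0 tt)|].
by near=> n; exact: overlap_seq_mono.
Unshelve. all: by end_near. Qed.

Lemma overlap_seq_ge0 tau n : 0 <= ov tau n.
Proof.
rewrite /overlap_seq divr_ge0 // fine_ge0 //; apply: integral_ge0 => z _.
by rewrite lee_fin; have /andP[] := bcount_ln_bounds tau n z.
Qed.

(** Counts grow with tau, so the limit at 0 from the right exists by monotonicity and is at most the
    value at tau = 1. A single tolerance is then enough for all mass estimates. *)
Lemma log_overlap_le : l <= limn (ov 1).
Proof.
have cv : cvg (limn (ov tau) @[tau --> (0 : R)^'+]).
  apply: nondecreasing_at_right_is_cvgr.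
    near=> e => x y; rewrite !in_itv /= => /andP[x0 _] _ xy; exact: limn_ov_mono.
  near=> e; exists 0 => _ [x /= xe <-]; rewrite in_itv /= in xe.
  have /andP[x0 _] := xe.
  by apply: limr_ge; [exact: cvg_ov|near=> n; exact: overlap_seq_ge0].
apply: limr_le => //; near=> tau; apply: limn_ov_mono; near: tau.
  exact: nbhs_right_gt.
exact: nbhs_right_le.
Unshelve. all: by end_near. Qed.

Lemma log_overlap_le_card : l <= ln #|I|%:R.
Proof.
apply: le_trans log_overlap_le _; apply: limr_le; first exact: cvg_ov.
exists 1%N => // n /= n0; have I0 : 0 <= ln #|I|%:R :> R.
  by rewrite ln_ge0 // ler1n; apply/card_gt0P; exists i0.
have := overlap_seq_le 1 0 n0; rewrite maxxx add0r => /le_trans; apply.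
by rewrite ler_piMr // pm_le1 //; exact: tmeas_covered_event.
Qed.

(** A reverse Markov inequality: the mean of (ln b_n) / n exceeds some m > c for large n, while it
    is bounded by ln #|I|. For c <= 0 every point of Lambda is already covered enough. *)
Lemma covered_event_mass c : c < l ->
  exists2 d : R, 0 < d & exists N, forall n, (N <= n)%N -> d <= pr (covered_event n c).
Proof.
move=> cl; have [c0|c0] := leP c 0.
  exists 1 => //; exists 0%N => n _; rewrite -(pmT PS); apply: le_pm => //.
  - exact: tmeasT.
  - exact: tmeas_covered_event.
  by move=> z Sz _; exact: limit_set_covered.
have I0 : 0 <= ln #|I|%:R :> R.
  by rewrite ln_ge0 // ler1n; apply/card_gt0P; exists i0.
have cl' : c < limn (ov 1) := lt_le_trans cl log_overlap_le.
pose m := (c + limn (ov 1)) / 2; have cm : c < m by rewrite /m; lra.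
have ml : m < limn (ov 1) by rewrite /m; lra.
(* The added 1 keeps the divisor positive for a one-letter alphabet. *)
exists ((m - c) / (ln #|I|%:R + 1)).
  by rewrite divr_gt0 ?subr_gt0 // ltr_wpDl.
have [N _ hN] := cvgr_gt _ (cvg_ov ltr01) _ ml.
exists N.+1 => n Nn; have := hN n (ltnW Nn) => /= hn.
have n0 : (0 < n)%N by exact: leq_trans Nn.
have := overlap_seq_le 1 c n0; rewrite (max_idPl (ltW c0)) => h.
rewrite ler_pdivrMr ?ltr_wpDl //; have := pm_ge0 mu S (covered_event n c).
move: (le_trans (ltW hn) h); set a := pr _; set b := ln _ => h1 h2; nra.
Qed.

Lemma measurable_often_covered c : measurable ([set z | often_covered i0 V phi c z.2] : set M).
Proof. exact: measurable_snd_borel (often_covered_borel i0 ifs c). Qed.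

Lemma tmeas_often_covered c : tmeas S [set z | often_covered i0 V phi c z.2].
Proof. by apply: tmeasW => //; exact: measurable_often_covered. Qed.

(** The unions [A n] of the events from time n on decrease and have mass at least d, hence so has
    their intersection; continuity is applied to the increasing complements, with loss d / 2. *)
Lemma often_covered_pos c : c < l -> 0 < pr [set z | often_covered i0 V phi c z.2].
Proof.
move=> /covered_event_mass[d d0 [N hN]].
pose A n : set M := \bigcup_k covered_event (n + k) c.
have mA n : tmeas S (A n) by apply: tmeas_bigcup => k; exact: tmeas_covered_event.
have An n : d <= pr (A n).
  apply: le_trans (hN (n + N)%N (leq_addl _ _)) _; apply: le_pm => //.
    exact: tmeas_covered_event.
  by move=> z _ hz; exists N.
have [||n hn] := @pm_bigcup_tail _ _ _ mu S (fun n => ~` A n) (d / 2) _ _ (divr_gt0 d0 (ltr0Sn _ 1)).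
- by move=> n; exact: tmeasC.
- move=> m m' mm z /= nz [k _ hk]; apply: nz; exists (m' - m + k)%N => //.
  by rewrite addnA subnKC.
rewrite -setC_bigcap !(pmC mS PS) // in hn; last exact: tmeas_bigcap.
apply: (@lt_le_trans _ _ (pr (\bigcap_n A n))).
  have := An n; lra.
apply: le_pm; [exact: tmeas_bigcap|exact: tmeas_often_covered|].
move=> z _ hz k _ N' _; have [j _ hj] := hz N' Logic.I; exists j => //.
by apply: le_trans hj; rewrite ler_expR ler_wpM2l // gerBl invr_ge0.
Qed.

Hypothesis hpsi : holder_cont V phi psi.
Hypothesis equil : forall nu : probability M R, invariant_prob V phi nu ->
  (entropy V phi nu + integ V phi nu psi <= entropy V phi mu + integ V phi mu psi)%E.

Lemma often_covered_full c : c < l -> mu [set z | (~` often_covered i0 V phi c) z.2] = 0%E.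
Proof.
move=> cl; have mO := measurable_often_covered c.
have mT := tmeas_often_covered c.
have h1 : pr [set z | often_covered i0 V phi c z.2] = 1.
  have [z Sz|h|//] := zero_one_law ifs hpsi muI equil mT.
    by move=> /=; exact: (often_covered_maps _ (limit_set_sub Sz)).
  by have := often_covered_pos cl; rewrite h ltxx.
have : mu (~` (S `&` [set z | often_covered i0 V phi c z.2])) = 0%E.
  by rewrite probability_setC // (pmE mu mT) h1 subee.
apply: subset_measure0.
- exact: measurableC.
- exact: measurableC.
- by move=> z /= nz [_ /nz].
Qed.
End OverlapBound.

(** * Hausdorff measure *)

Section HausdorffNull.
Variables (R : realType) (q : nat).
Implicit Types (U Z : set 'rV[R]_q) (s d : R).

Lemma hterm_ge0 s U : 0 <= hterm s U.
Proof. by rewrite /hterm; case: ifP => // _; exact: powR_ge0. Qed.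

Lemma hterm_set0 s : hterm s (@set0 'rV[R]_q) = 0.
Proof. by rewrite /hterm asboolT. Qed.

Lemma ediam_set0 : ediam (@set0 'rV[R]_q) = -oo%E.
Proof.
rewrite /ediam (_ : [set _ | _ in _ & _ in _] = set0) ?ereal_sup0 //.
by rewrite -subset0 => z [].
Qed.

Lemma ediam_le U d : (forall x y, U x -> U y -> enorm (x - y) <= d) ->
  (ediam U <= d%:E)%E.
Proof.
by move=> Ud; apply: ge_ereal_sup => _ [x Ux [y Uy <-]]; rewrite lee_fin Ud.
Qed.

Lemma hterm_le s U d : 0 <= s -> 0 <= d -> (forall x y, U x -> U y -> enorm (x - y) <= d) ->
  hterm s U <= powR d s.
Proof.
move=> s0 d0 Ud; rewrite /hterm; case: asboolP => [_|/eqP/set0P[x Ux]]; first exact: powR_ge0.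
have Ld := ediam_le Ud.
have L0 : (0 <= ediam U)%E.
  by apply: ereal_sup_ubound; exists x => //; exists x; rewrite // subrr enorm0.
apply: ge0_ler_powR; rewrite ?nnegrE ?fine_ge0 //.
rewrite -lee_fin fineK // ge0_fin_numE //; exact: le_lt_trans Ld (ltry _).
Qed.

Lemma hcontent_bigcup_le s d Z (U : nat -> nat -> set 'rV[R]_q) (b : nat -> R) (B : R) :
  (forall x, Z x -> exists n j, U n j x) ->
  (forall n j, (ediam (U n j) <= d%:E)%E) ->
  (forall n m, \sum_(j < m) hterm s (U n j) <= b n) ->
  (forall m, \sum_(n < m) b n <= B) -> (hcontent s d Z <= B%:E)%E.
Proof.
move=> ZU Ud Ub bB.
have /card_esym/ppcard_eqP[f] := card_nat2.
pose W i := U (f i).1 (f i).2.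
apply: ge_ereal_inf; exists (\sum_(0 <= i <oo) (hterm s (W i))%:E)%E.
  exists W => //; split; last by move=> i; exact: Ud.
  move=> x /ZU[n [j Ux]]; exists (f^-1%FUN (n, j)) => //.
  by rewrite /W invK ?inE.
pose a (p : nat * nat) : \bar R := (hterm s (U p.1 p.2))%:E.
have a0 p : (0 <= a p)%E by rewrite lee_fin hterm_ge0.
rewrite nneseries_esumT; last by move=> i; exact: (a0 (f i)).
rewrite -(reindex_esum setT setT f a) //.
have -> : (\esum_(p in [set: nat * nat]) a p = \esum_(n in setT) \esum_(j in setT) a (n, j))%E.
  rewrite esum_esum //; congr esum; by apply/seteqP; split.
rewrite -nneseries_esumT; last by move=> n; exact: esum_ge0.
apply: lime_le; first by apply: is_cvg_nneseries => n _ _; exact: esum_ge0.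
near=> m; apply: (@le_trans _ _ (\sum_(0 <= n < m) (b n)%:E)%E); last first.
  by rewrite sumEFin lee_fin big_mkord.
apply: lee_sum => n _; rewrite -nneseries_esumT //.
apply: lime_le; first by apply: is_cvg_nneseries => j _ _.
near=> k; rewrite (_ : (\sum_(0 <= j < k) a (n, j))%E = (\sum_(j < k) hterm s (U n j))%:E).
  by rewrite lee_fin.
by rewrite -sumEFin big_mkord.
Unshelve. all: by end_near. Qed.

(** A Borel-Cantelli argument: the covers of all levels from N on cover the limsup set at total cost
    C rho^N / (1 - rho). Covers are lists padded with the empty set, which costs nothing and has
    diameter -oo. *)
Lemma hmeasure_limsup0 s (E : nat -> set 'rV[R]_q) (C rho : R) : 0 <= C -> 0 < rho -> rho < 1 ->
  (forall d, 0 < d -> exists N, forall n, (N <= n)%N -> exists L : seq (set 'rV[R]_q),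
    [/\ forall x, E n x -> exists j, nth set0 L j x,
        forall j, (ediam (nth set0 L j) <= d%:E)%E &
        \sum_(U <- L) hterm s U <= C * rho ^+ n]) ->
  hmeasure s [set x | forall N, exists2 n, (N <= n)%N & E n x] = 0%E.
Proof.
move=> C0 r0 r1 cov; set Z := [set x | _].
have cont0 d : (0 <= hcontent s d Z)%E.
  apply/ereal_infP => _ [U _ <-]; apply: nneseries_ge0 => n _ _.
  by rewrite lee_fin hterm_ge0.
apply/eqP; rewrite eq_le; apply/andP; split; last first.
  by apply: le_trans (cont0 1) _; apply: ereal_sup_ubound; exists 1 => /=.
apply: ge_ereal_sup => _ [d /= d0 <-]; apply/lee_addgt0Pr => e e0; rewrite add0e.
have [N1 hN1] := cov d d0.
have r1' : 0 < 1 - rho by rewrite subr_gt0.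
have [N2 hN2] := @geometric_small R rho (C / (1 - rho)) e (ltW r0) r1 (divr_ge0 C0 (ltW r1')) e0.
pose N := maxn N1 N2.
have ex n : exists L : seq (set 'rV[R]_q),
    [/\ forall x, E (N + n)%N x -> exists j, nth set0 L j x,
        forall j, (ediam (nth set0 L j) <= d%:E)%E &
        \sum_(U <- L) hterm s U <= C * rho ^+ (N + n)].
  by apply: hN1; rewrite (leq_trans (leq_maxl N1 N2)) // leq_addr.
have [L hL] := choice ex.
apply: (@hcontent_bigcup_le s d Z (fun n => nth set0 (L n)) (fun n => C * rho ^+ (N + n))).
- move=> x /(_ N)[n Nn En]; exists (n - N)%N.
  by have [+ _ _] := hL (n - N)%N; apply; rewrite subnKC.
- by move=> n j; have [_ + _] := hL n; apply.
- move=> n m; have [_ _ h] := hL n; apply: le_trans h.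
  elim: (L n) m => [|U l IH] m.
    by rewrite big1 ?big_nil // => j _; rewrite nth_nil hterm_set0.
  case: m => [|m]; first by rewrite big_ord0; apply: sumr_ge0 => i _; exact: hterm_ge0.
  by rewrite big_ord_recl big_cons lerD2l; exact: IH.
move=> m; have := hN2 N (leq_maxr _ _); set A := rho ^+ N * _ => hA.
apply: le_trans (ltW hA).
have -> : \sum_(n < m) C * rho ^+ (N + n) = C * rho ^+ N * \sum_(n < m) rho ^+ n.
  by rewrite mulr_sumr; apply: eq_bigr => n _; rewrite exprD mulrA.
have -> : A = C * rho ^+ N * (1 - rho)^-1 by rewrite /A; ring.
apply: ler_wpM2l; first by rewrite mulr_ge0 // exprn_ge0 // ltW.
rewrite -div1r ler_pdivlMr // mulrC.
have -> : (1 - rho) * \sum_(n < m) rho ^+ n = 1 - rho ^+ m.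
  by have := subrX1 rho m => h; rewrite -[LHS]opprK -mulNr opprB -h opprB.
by rewrite gerBl exprn_ge0 // ltW.
Qed.
End HausdorffNull.

(** * Covers by cylinder images and Hausdorff measure *)

Section CylinderCovers.
Variables (R : realType) (q : nat) (I : finType) (i0 : I).
Variables (V : set 'rV[R]_q) (phi : I -> 'rV[R]_q -> 'rV[R]_q).
Hypothesis ifs : conformal_IFS V phi.
Hypothesis q0 : (0 < q)%N.
Local Notation g := (log_deriv V phi).
Local Notation ext w := (ext_word w (fun=> i0)).
Local Notation image := (word_image i0 V phi).

Definition word_size (C e : R) n (w : {ffun 'I_n -> I}) : R :=
  C * expR (n%:R * e + \sum_(k < n) g (iter k (@sshift I) (ext w))).

Lemma word_size_gt0 C e n (w : {ffun 'I_n -> I}) : 0 < C -> 0 < word_size C e w.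
Proof. by move=> C0; rewrite mulr_gt0 ?expR_gt0. Qed.

Lemma word_image_size (e : R) : 0 < e -> exists2 C : R, 0 < C &
  forall n (w : {ffun 'I_n -> I}) x y, image w x -> image w y ->
    enorm (x - y) <= word_size C e w.
Proof.
move=> e0; have [C C0 hC] := cylinder_distortion ifs q0 e0.
have [D D0 hD] := ifs_bounded ifs.
exists (C * D) => [|n w x y]; first exact: mulr_gt0.
move=> [a Ka <-] [b Kb <-]; apply: le_trans (hC (ext w) n a b Ka Kb) _.
rewrite /word_size mulrAC; apply: ler_wpM2r; first exact: expR_ge0.
by apply: ler_wpM2l; [exact: ltW|exact: hD].
Qed.

Lemma powR_word_size (C e s l : R) n (w : {ffun 'I_n -> I}) : 0 < C -> 0 < s ->
  powR (3 * word_size C e w) s <=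
  powR (3 * C) s * expR (n%:R * (s * e + l)) * expR (cyl_sup (fun t => s * g t - l) w).
Proof.
move=> C0 s0; have [kap [Lg [kap0 hg]]] := log_deriv_bounds ifs q0.
have C3 : 0 <= 3 * C by rewrite mulr_ge0 // ltW.
rewrite /word_size mulrA powRM ?expR_ge0 // -mulrA.
apply: ler_wpM2l; first exact: powR_ge0.
rewrite -expRM -expRD ler_expR.
have fB := @pot_bounded R I g kap Lg l kap0 _ _ s.
have {}fB : bounded_by (fun t => s * g t - l) (`|s| * Lg + `|l|).
  by apply: fB => t; have /andP[] := hg t.
have := cyl_sup_ge fB (prefix_word_ext w (fun=> i0)).
rewrite sumrB -mulr_sumr sumr_const card_ord -[X in _ - X]mulr_natl.
set a := \sum_(i < n) _; set b := cyl_sup _ _ => h; lra.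
Qed.

Lemma word_size_le (C e kap : R) n (w : {ffun 'I_n -> I}) : 0 < C ->
  (forall t, g t <= - kap) -> e <= kap / 2 ->
  3 * word_size C e w <= 3 * C * expR (- (kap / 2)) ^+ n.
Proof.
move=> C0 gk ek; rewrite /word_size mulrA; apply: ler_wpM2l; first by rewrite mulr_ge0 // ltW.
rewrite -expRM_natl ler_expR.
have h1 : \sum_(k < n) g (iter k (@sshift I) (ext w)) <= n%:R * - kap.
  rewrite [leRHS](_ : _ = \sum_(k < n) - kap); last by rewrite sumr_const card_ord mulr_natl.
  by apply: ler_sum.
have h2 : n%:R * e <= n%:R * (kap / 2) by rewrite ler_wpM2l.
move: h1 h2; set a := \sum_(k < n) _; lra.
Qed.

(** If the image of w meets that of v and r w <= r v, it lies in the r v-neighbourhood of the image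
    of v, of diameter at most 3 r v. This is where the factor 3 in the costs comes from. *)
Definition enlarged_image (r : R) n (w : {ffun 'I_n -> I}) : set 'rV[R]_q :=
  [set y | exists2 x, image w x & enorm (y - x) <= r].

Lemma enlarged_image_diam r n (w : {ffun 'I_n -> I}) :
  (forall x y, image w x -> image w y -> enorm (x - y) <= r) ->
  forall x y, enlarged_image r w x -> enlarged_image r w y -> enorm (x - y) <= 3 * r.
Proof.
move=> wr x y [x' wx xx'] [y' wy yy'].
have h1 := enorm_triangle x x' y; have h2 := enorm_triangle x' y' y.
have h3 := wr _ _ wx wy; rewrite enormB in yy'; lra.
Qed.

(** The Vitali selection needs an integral multiplicity N >= 1. The integer part of y, raised to 1
    if it vanishes, is implied by a count of at least y and loses at most a factor 2. *)
Lemma nat_below (y : R) : 0 < y -> exists N, [/\ (0 < N)%N, y <= 2 * N%:R &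
  forall m, y <= m%:R -> (N <= m)%N].
Proof.
move=> y0; exists (maxn 1 (Num.truncn y)).
have /andP[h1 h2] := truncn_itv (ltW y0); split; first by rewrite leq_maxl.
  have [m1|] := leqP 1 (Num.truncn y).
    apply: le_trans (ltW h2) _; rewrite -natr1 mulr_natl mulr2n.
    by rewrite lerD2l ler1n.
  rewrite ltnS leqn0 => /eqP t0; rewrite t0 in h2.
  by apply: le_trans (ltW h2) _; rewrite mulr1 ler1n.
move=> m ym; rewrite geq_max; apply/andP; split.
  by rewrite -(ltr0n R); exact: lt_le_trans ym.
by rewrite -(ler_nat R); exact: le_trans ym.
Qed.

(** With eta = - P / 2, the partition function is at most e^(- n eta) for large n. Distortion costs
    e^(n s e) <= e^(n eta / 4), and dividing e^(n l) by the multiplicity e^(n c), c = l - eta / 4,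
    leaves another e^(n eta / 4). The level-n cover thus costs a constant times e^(- n eta / 2). The
    second bound e <= kap / 2 makes the covering sets shrink. *)
Lemma covered_hmeasure0 (s l : R) : 0 < s -> pressure (fun t => s * g t - l) < 0 ->
  exists2 c, c < l & hmeasure s
    [set x | forall N, exists2 n, (N <= n)%N & multiply_covered i0 V phi n c x] = 0%E.
Proof.
move=> s0 P0; have [kap [Lg [kap0 hg]]] := log_deriv_bounds ifs q0.
have fB : bounded_by (fun t => s * g t - l) (`|s| * Lg + `|l|).
  by apply: (@pot_bounded R I g kap Lg l kap0) => t; have /andP[] := hg t.
have [cZ _] := pressure_cvg i0 fB.
pose eta := - pressure (fun t => s * g t - l) / 2.
have eta0 : 0 < eta by rewrite divr_gt0 // oppr_gt0.
have Peta : pressure (fun t => s * g t - l) < - eta.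
  by move: P0; rewrite /eta; set P := pressure _ => ?; lra.
have [N0 _ hN0] := cvgr_lt _ cZ _ Peta.
pose e := Num.min (eta / 4 / s) (kap / 2).
have e0 : 0 < e.
  by rewrite lt_min; apply/andP; split; [do 2! apply: divr_gt0 => //|exact: divr_gt0].
have es : s * e <= eta / 4.
  by rewrite mulrC -ler_pdivlMr // ge_min lexx.
have ek : e <= kap / 2 by rewrite ge_min lexx orbT.
have [C C0 hC] := word_image_size e0.
pose c := l - eta / 4; exists c; first by rewrite gtrBl divr_gt0.
(* The 2 pays for rounding e^(n c) to an integer. *)
pose C3 := 2 * powR (3 * C) s; have C30 : 0 <= C3 by rewrite mulr_ge0 ?powR_ge0.
have rk : expR (- (kap / 2)) < 1 by rewrite -[ltRHS]expR0 ltr_expR oppr_lt0 divr_gt0.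
apply: (@hmeasure_limsup0 R q s _ C3 (expR (- (eta / 2)))) => //.
- exact: expR_gt0.
- by rewrite -[ltRHS]expR0 ltr_expR oppr_lt0 divr_gt0.
move=> d d0.
have [N1 hN1] := @geometric_small R _ (3 * C) d (expR_ge0 _) rk
  (mulr_ge0 (ler0n _ 3) (ltW C0)) d0.
exists (maxn N0 N1).+1 => n Nn; have n0 : (0 < n)%N by exact: leq_trans Nn.
have nN0 : (N0 <= n)%N by apply: leq_trans (ltnW Nn); exact: leq_maxl.
have nN1 : (N1 <= n)%N by apply: leq_trans (ltnW Nn); exact: leq_maxr.
have [N [Np yN hN]] := nat_below (expR_gt0 (n%:R * c)).
pose r (w : {ffun 'I_n -> I}) := word_size C e w.
have r0 w : 0 < r w by exact: word_size_gt0.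
pose a w := powR (3 * r w) s.
have a0 w : 0 <= a w by exact: powR_ge0.
have [|G [_ costG covG]] := multiplicity_vitali (B := fun w => image w) r
  (E := multiply_covered i0 V phi n c) (F := [set: {ffun 'I_n -> I}]%SET) a0 Np.
  move=> x /hN /leq_trans; apply; apply: subset_leq_card.
  by apply/fintype.subsetP => w; rewrite !inE.
exists [seq enlarged_image (r w) w | w <- enum G]; split.
- move=> x /covG[w [v [vG wx [y [wy vy]] rwv]]].
  have vi : (index v (enum G) < size (enum G))%N by rewrite index_mem mem_enum.
  exists (index v (enum G)); rewrite (nth_map v) // nth_index ?mem_enum //.
  by exists y => //; apply: le_trans rwv; exact: hC.
- move=> j; have [js|js] := ltnP j (size (enum G)); last first.
    by rewrite nth_default ?size_map // ediam_set0 leNye.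
  rewrite (nth_map [ffun=> i0]) //; set w := nth _ _ _; apply: ediam_le.
  move=> x y hx hy; apply: (@le_trans _ _ (3 * r w)).
    by apply: enlarged_image_diam hx hy; exact: hC.
  apply: le_trans (word_size_le w C0 _ ek) _.
    by move=> t; have /andP[] := hg t.
  by rewrite mulrC ltW // hN1.
rewrite big_map big_enum /=.
apply: (@le_trans _ _ (\sum_(w in G) a w)).
  apply: ler_sum => w _; apply: hterm_le; rewrite ?ltW //; first by rewrite mulr_gt0.
  by move=> x y; apply: enlarged_image_diam; exact: hC.
have sumA : \sum_w a w <= powR (3 * C) s * expR (n%:R * (s * e + l)) * expR (- (n%:R * eta)).
  apply: (@le_trans _ _ (\sum_w powR (3 * C) s * expR (n%:R * (s * e + l)) *
      expR (cyl_sup (fun t => s * g t - l) w))).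
    by apply: ler_sum => w _; exact: powR_word_size.
  rewrite -mulr_sumr; apply: ler_wpM2l; first by rewrite mulr_ge0 ?powR_ge0 ?expR_ge0.
  have := hN0 n nN0 => /=; rewrite ltr_pdivrMr ?ltr0n // => hZ.
  rewrite -[leLHS]lnK ?posrE ?(cyl_partition_gt0 i0) // ler_expR ltW //.
  by rewrite mulrC -mulNr.
have N0' : 0 < N%:R :> R by rewrite ltr0n.
rewrite -(ler_pM2l N0'); apply: le_trans costG _.
rewrite (eq_bigl xpredT); last by move=> w; rewrite inE.
apply: le_trans sumA _; rewrite -mulrA -expRD /C3.
have -> : N%:R * (2 * powR (3 * C) s * expR (- (eta / 2)) ^+ n) =
    powR (3 * C) s * (2 * N%:R * expR (- (eta / 2)) ^+ n) by ring.
apply: ler_wpM2l; first exact: powR_ge0.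
rewrite -expRM_natl; apply: (@le_trans _ _ (expR (n%:R * c) * expR (n%:R * - (eta / 2)))).
  rewrite -expRD ler_expR -mulrN -!mulrDr; apply: ler_wpM2l => //.
  rewrite /c; lra.
by apply: ler_wpM2r; [exact: expR_ge0|].
Qed.
End CylinderCovers.

(** * The upper bound for the dimension of the projected measure *)

Theorem theorem2p7 (R : realType) (q : nat) (I : finType) (i0 : I)
  (V : set 'rV[R]_q) (phi : I -> 'rV[R]_q -> 'rV[R]_q)
  (psi : XT R q i0 -> R) (mu : probability (XM R q i0) R) :
  (0 < q)%N ->
  conformal_IFS V phi ->
  holder_cont V phi psi ->
  equilibrium V phi psi mu ->
  (* the inner limits in the definition of o(S, mu) exist *)
  (forall tau : R, 0 < tau -> cvgn (overlap_seq V phi psi mu tau)) ->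
  let P := fun t : R => pressure (fun w : nat -> I =>
             t * ln (deriv_norm (phi (w 0%N)) (ifs_proj V phi (sshift w)))
             - ln (overlap_number V phi psi mu)) in
  exists t : R,
    [/\ P t = 0, (forall t' : R, P t' = 0 -> t' = t)
      & (HD_proj_measure V phi mu <= t%:E)%E].
Proof.
move=> q0 ifs hpsi [muI equil] cv P.
set l := log_overlap V phi psi mu.
have EP : P = fun t => pressure (fun w => t * log_deriv V phi w - l).
  by rewrite /P /overlap_number expRK.
have [kap [Lg [kap0 hg]]] := log_deriv_bounds ifs q0.
have gU t : log_deriv V phi t <= - kap by have /andP[] := hg t.
have gL t : - Lg <= log_deriv V phi t by have /andP[] := hg t.
have [t [[t0 Pt Ps] uniq_t]] :=
  pressure_zero i0 kap0 gU gL (log_overlap_le_card ifs muI cv).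
(* The bound is proved at s = t + e for every e > 0, where the pressure is strictly negative and s
   is positive even if t = 0. *)
rewrite {}EP; exists t; split => //; apply/lee_addgt0Pr => e e0; rewrite -EFinD.
have st : t < t + e by rewrite ltrDl.
have s0 : 0 < t + e by exact: le_lt_trans st.
have [c cl hZ] := covered_hmeasure0 i0 ifs q0 s0 (Ps _ st).
set Z := [set x | _] in hZ.
(* The midpoint of c and l serves both ends: being below l it gives a set of full measure, and being
   above c it leaves room for the margins of [often_covered], so that this set is contained in Z. *)
have [cm ml] := midf_lt cl.
apply: (@le_trans _ _ (hdim Z)).
  apply: ereal_inf_lbound; exists Z => //.
  exists (~` often_covered i0 V phi ((c + l) / 2)); split.
    pose T := g_sigma_algebraType [set U : set 'rV[R]_q | open U].
    suff : measurable (~` often_covered i0 V phi ((c + l) / 2) : set T) by [].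
    by apply: measurableC; exact: often_covered_borel.
  split; first by move=> x [_ nZ] hx; apply: nZ; exact: often_covered_sub hx.
  exact: (@often_covered_full R q I i0 V phi ifs psi mu muI cv hpsi equil _ ml).
by apply: ereal_inf_lbound; exists (t + e) => //; split => //; exact: ltW.
Qed.
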